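(* Let $f > 1$ be an integer, and put $p = 2$, $e = 1$, $m = 2$, $n = 2^f$, $k = n/m = 2^{f-1}$. Then the following two statements hold. (1) $\mathrm{val}_2\, g(2, 2^f) = f - 1$. (2) Write the expansion of $\sum_{\lambda \subset 2^2} s_\lambda s'_{\tilde\lambda^*} \in \Lambda\otimes\Lambda$ in the elementary basis as $$\sum_{\lambda \subset 2^2} s_\lambda s'_{\tilde\lambda^*} = \sum_{(\mu,\nu)} a_{\mu\nu}\, e_\mu e'_\nu, \qquad a_{\mu\nu}\in\mathbb{Z},$$ and let $N = 2(2^{f-1}-1)$. Then every term of the multinomial expansion of the $N$-th power of this sum, upon pairing with $s_{(n-2)^2}\, s'_{(n-2)^2}$, is divisible by $2^{f-1}$. Explicitly, for every family of nonnegative integers $(c_{\mu\nu})$, indexed by the pairs $(\mu,\nu)$ with $a_{\mu\nu}\neq 0$ and satisfying $\sum c_{\mu\nu} = N$, the integer $$\binom{N}{(c_{\mu\nu})} \Big(\prod_{\mu,\nu} a_{\mu\nu}^{c_{\mu\nu}}\Big) \Big\langle \prod_{\mu,\nu} (e_\mu e'_\nu)^{c_{\mu\nu}},\; s_{(n-2)^2}\, s'_{(n-2)^2}\Big\rangle$$ is divisible by $2^{f-1}$.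
   Context: $\Lambda$ is the ring of symmetric functions over $\mathbb{Z}$ in infinitely many variables, with Schur functions $s_\lambda$ and elementary basis $e_\mu = e_{\mu_1}e_{\mu_2}\cdots$ (over partitions $\mu$). The bilinear pairing $\langle -,-\rangle$ on $\Lambda$ is the one for which the Schur functions are orthonormal. In $\Lambda\otimes\Lambda$, unprimed symmetric functions refer to the first factor and primed ones to the second factor. The pairing on $\Lambda\otimes\Lambda$ is the one for which the products $s_\lambda s'_\mu$ are orthonormal. The elementary basis of $\Lambda\otimes\Lambda$ is $\{e_\mu e'_\nu\}$. For integers $a,b\ge 0$, $a^b$ denotes the partition $(a,\dots,a)$ with $b$ parts, i.e. the rectangular Young diagram with $b$ rows and $a$ columns. For positive integers $m$ and $n = km$ define $$g(m,n) = \big\langle s_{m^{n-m}}\, s_{(n-m)^m},\; s_{m^m}^{2(k-1)} \big\rangle .$$ The notation $\lambda\subset 2^2$ means that $\lambda$ has at most $2$ rows and at most $2$ columns. For such $\lambda$, the dual is $\lambda^* = (2-\lambda_2, 2-\lambda_1)$, the complement in the $2\times 2$ square. The tilde denotes the transpose partition, and $\tilde\lambda^*$ is the transpose of the dual. $\mathrm{val}_2$ is the $2$-adic valuation, and $\binom{N}{(c_{\mu\nu})} = N!/\prod c_{\mu\nu}!$ is the multinomial coefficient. *)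

(* Defs.v *)
From HB Require Import structures.
From mathcomp Require Import all_boot all_order all_algebra all_fingroup.
From mathcomp Require Import finmap generic_quotient boolp mpoly zify.

Set Implicit Arguments.
Unset Strict Implicit.
Unset Printing Implicit Defensive.

Import GRing.Theory.
Local Open Scope quotient_scope.
Local Open Scope ring_scope.

Section SymFun.

(* The substitution x_n := 0 (variables are x_0, ..., x_n). *)
Definition restrict_vars n : n.+1.-tuple {mpoly int[n]} :=
  [tuple if unlift ord_max i is Some j then 'X_j else 0 | i < n.+1].

(* A symmetric function in infinitely many variables x_0, x_1, ... is a family
   of symmetric polynomials f_n in x_0, ..., x_(n-1), compatible with setting
   the last variable to 0, and of bounded degree; f_n is the symmetric function
   evaluated at x_n = x_(n+1) = ... = 0.  Ring operations are pointwise in n. *)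
Definition is_symfun (f : forall n, {mpoly int[n]}) : Prop :=
  [/\ forall n, f n \is symmetric,
      forall n, f n.+1 \mPo restrict_vars n = f n
    & exists d, forall n, (msize (f n) <= d)%N].

Record symfun := SymFun { trunc : forall n, {mpoly int[n]};
                          _ : is_symfun trunc }.

Lemma symfunP f : is_symfun (trunc f). Proof. by case: f. Qed.

Lemma symfun_eq f g : (forall n, trunc f n = trunc g n) -> f = g.
Proof.
case: f g => [f Hf] [g Hg] /= E.
have {}E : f = g by apply: functional_extensionality_dep.
by case: g / E Hg => Hg; rewrite (Prop_irrelevance Hf Hg).
Qed.

HB.instance Definition _ := gen_eqMixin symfun.
HB.instance Definition _ := gen_choiceMixin symfun.

Fact symfun0_subproof : is_symfun (fun n => 0).
Proof.
split=> [n|n|]; [exact: rpred0 | exact: raddf0 |].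
by exists 0%N => n; rewrite msize0.
Qed.
Definition symfun0 := SymFun symfun0_subproof.

Fact symfun1_subproof : is_symfun (fun n => 1).
Proof.
split=> [n|n|]; [exact: rpred1 | exact: comp_mpoly1 |].
by exists 1%N => n; rewrite msize1.
Qed.
Definition symfun1 := SymFun symfun1_subproof.

Fact symfunN_subproof f : is_symfun (fun n => - trunc f n).
Proof.
have [fS fC [d fd]] := symfunP f; split=> [n|n|].
- by rewrite rpredN fS.
- by rewrite raddfN /= fC.
- by exists d => n; rewrite msizeN.
Qed.
Definition symfunN f := SymFun (symfunN_subproof f).

Fact symfunD_subproof f g : is_symfun (fun n => trunc f n + trunc g n).
Proof.
have [fS fC [d fd]] := symfunP f; have [gS gC [e ge]] := symfunP g.
split=> [n|n|].
- by rewrite rpredD ?fS ?gS.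
- by rewrite raddfD /= fC gC.
exists (maxn d e) => n; apply: leq_trans (msizeD_le _ _) _.
by rewrite geq_max !leq_max fd ge orbT.
Qed.
Definition symfunD f g := SymFun (symfunD_subproof f g).

Fact symfunM_subproof f g : is_symfun (fun n => trunc f n * trunc g n).
Proof.
have [fS fC [d fd]] := symfunP f; have [gS gC [e ge]] := symfunP g.
split=> [n|n|].
- by rewrite rpredM ?fS ?gS.
- by rewrite rmorphM /= fC gC.
exists (d + e)%N => n.
have [->|nz_f] := eqVneq (trunc f n) 0; first by rewrite mul0r msize0.
have [->|nz_g] := eqVneq (trunc g n) 0; first by rewrite mulr0 msize0.
rewrite msizeM // (leq_trans (leq_pred _)) // leq_add //.
Qed.
Definition symfunM f g := SymFun (symfunM_subproof f g).

Fact symfun_addA : associative symfunD.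
Proof. by move=> f g h; apply: symfun_eq => n; apply: addrA. Qed.
Fact symfun_addC : commutative symfunD.
Proof. by move=> f g; apply: symfun_eq => n; apply: addrC. Qed.
Fact symfun_add0 : left_id symfun0 symfunD.
Proof. by move=> f; apply: symfun_eq => n; apply: add0r. Qed.
Fact symfun_addN : left_inverse symfun0 symfunN symfunD.
Proof. by move=> f; apply: symfun_eq => n; apply: addNr. Qed.

HB.instance Definition _ := GRing.isZmodule.Build symfun
  symfun_addA symfun_addC symfun_add0 symfun_addN.

Fact symfun_mulA : associative symfunM.
Proof. by move=> f g h; apply: symfun_eq => n; apply: mulrA. Qed.
Fact symfun_mulC : commutative symfunM.
Proof. by move=> f g; apply: symfun_eq => n; apply: mulrC. Qed.
Fact symfun_mul1 : left_id symfun1 symfunM.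
Proof. by move=> f; apply: symfun_eq => n; apply: mul1r. Qed.
Fact symfun_mulD : left_distributive symfunM +%R.
Proof. by move=> f g h; apply: symfun_eq => n; apply: mulrDl. Qed.
Fact symfun_1neq0 : symfun1 != 0.
Proof.
by apply/eqP => /(congr1 (fun f => trunc f 0)) /eqP; rewrite /= oner_eq0.
Qed.

HB.instance Definition _ := GRing.Zmodule_isComNzRing.Build symfun
  symfun_mulA symfun_mulC symfun_mul1 symfun_mulD symfun_1neq0.

End SymFun.

Section Elementary.
Implicit Types (n k : nat).

Lemma mesym_restrict n k : mesym n.+1 int k \mPo restrict_vars n = mesym n int k.
Proof.
rewrite /mesym raddf_sum /=.
have E (h : {set 'I_n.+1}) : (\prod_(i in h) 'X_i) \mPo restrict_vars n =
   \prod_(i in h) (if unlift ord_max i is Some j then 'X_j else 0) :> {mpoly int[n]}.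
  rewrite rmorph_prod /=; apply: eq_bigr => i _.
  by rewrite comp_mpolyXU -tnth_nth tnth_mktuple.
rewrite (eq_bigr _ (fun h _ => E h)) (bigID (fun h : {set 'I_n.+1} => ord_max \in h)) /=.
rewrite big1 ?add0r; last first.
  by move=> h /andP[_ h1]; rewrite (bigD1 ord_max) //= unlift_none mul0r.
have liftI : injective (@lift n.+1 ord_max) by apply: lift_inj.
rewrite (reindex_onto (fun h : {set 'I_n} => lift ord_max @: h)
                      (fun h => lift ord_max @^-1: h)) /=; last first.
  move=> h /andP[_ h1]; apply/setP => i; apply/imsetP/idP => [[j]|hi].
    by rewrite inE => hj ->.
  have [j Ej|Ei] := unliftP ord_max i; last by rewrite -Ei hi in h1.
  by exists j; rewrite // inE -Ej.
apply: eq_big => [h|h _].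
  rewrite card_imset //.
  have ->: (ord_max \in lift ord_max @: h) = false.
    by apply/negP => /imsetP[j _] /eqP; rewrite (negPf (neq_lift _ _)).
  rewrite andbT; apply/andb_idr => _; apply/eqP/setP => i.
  by rewrite inE mem_imset.
rewrite big_imset /=; last by move=> ? ? _ _; apply: liftI.
by apply: eq_bigr => i _; rewrite liftK.
Qed.

Fact elem_subproof k : is_symfun (fun n => mesym n int k).
Proof.
split=> [n|n|]; [exact: mesym_sym | exact: mesym_restrict |].
exists k.+1 => n; rewrite msizeE; apply/bigmax_leqP_seq => m hm _.
by move: hm; rewrite msupp_mesymP => /existsP[h /andP[/eqP hk /eqP ->]]; rewrite mdeg_mesym1 hk.
Qed.
Definition elem k := SymFun (elem_subproof k).

End Elementary.

Definition is_partition (s : seq nat) := sorted geq s && (0%N \notin s).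

Record intpart := IntPart { parts :> seq nat; _ : is_partition parts }.

HB.instance Definition _ := [isSub for parts].
HB.instance Definition _ := [Countable of intpart by <:].

Fact part_of_subproof s : is_partition (sort geq [seq i <- s | i != 0%N]).
Proof.
rewrite /is_partition sort_sorted => [|i j]; last exact: leq_total.
by rewrite mem_sort mem_filter eqxx.
Qed.
(* Sorts and drops zeros: [part_of] of a weakly decreasing sequence is the
   partition it represents up to trailing zeros. *)
Definition part_of s := IntPart (part_of_subproof s).

Section Schur.
Variable la : intpart.

(* Boxes (row, column) of the Young diagram, counted from 0; the bound on the
   column in the ambient type is the largest part. *)
Definition cell :=
  {c : 'I_(size la) * 'I_(head 0%N la) | (c.2 < nth 0%N la c.1)%N}.
Definition crow (c : cell) : nat := (val c).1.
Definition ccol (c : cell) : nat := (val c).2.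

Definition semistandard n (T : {ffun cell -> 'I_n}) : bool :=
  [forall c, forall d,
     ((crow c == crow d) && (ccol c <= ccol d)%N ==> (T c <= T d)%N) &&
     ((ccol c == ccol d) && (crow c < crow d)%N ==> (T c < T d)%N)].

Definition schur_pol n : {mpoly int[n]} :=
  \sum_(T : {ffun cell -> 'I_n} | semistandard T) \prod_c 'X_(T c).

Lemma semistandardP n (T : {ffun cell -> 'I_n}) :
  reflect (forall c d,
      (crow c = crow d -> ccol c <= ccol d -> T c <= T d)%N /\
      (ccol c = ccol d -> crow c < crow d -> T c < T d)%N)
    (semistandard T).
Proof.
apply: (iffP forallP) => [H c d|H c].
  have /forallP/(_ d)/andP[/implyP h1 /implyP h2] := H c.
  split=> e1 e2; first by apply: h1; rewrite e1 eqxx.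
  by apply: h2; rewrite e1 eqxx.
apply/forallP => d; have [h1 h2] := H c d.
by apply/andP; split; apply/implyP => /andP[/eqP e1 e2]; [apply: h1|apply: h2].
Qed.

Lemma cell_eq (c d : cell) : crow c = crow d -> ccol c = ccol d -> c = d.
Proof.
rewrite /crow /ccol => e1 e2; apply: val_inj.
by case: (val c) (val d) e1 e2 => [? ?] [? ?] /= /val_inj -> /val_inj ->.
Qed.

Lemma parts_anti r s : (r <= s)%N -> (nth 0 la s <= nth 0 la r)%N.
Proof.
move=> rs; have [hs|hs] := ltnP s (size la); last by rewrite nth_default.
have /andP[sla _] := valP la.
apply: (sorted_leq_nth _ _ 0%N sla r s) => //; rewrite ?inE //.
- by move=> x y z /= h1 h2; apply: leq_trans h2 h1.
- by move=> x /=.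
exact: leq_ltn_trans hs.
Qed.

Lemma mkcellP r j : (j < nth 0 la r)%N -> exists c : cell, crow c = r /\ ccol c = j.
Proof.
move=> hj; have hr : (r < size la)%N.
  by rewrite ltnNge; apply/negP => h; rewrite nth_default in hj.
have hj0 : (j < head 0%N la)%N.
  by rewrite -nth0 (leq_trans hj) // parts_anti.
by exists (exist _ (Ordinal hr, Ordinal hj0) hj).
Qed.

Lemma ccolP c : (ccol c < nth 0 la (crow c))%N.
Proof. exact: (valP c). Qed.

Lemma card_row r j : (j <= nth 0 la r)%N ->
  #|[set c : cell | (crow c == r) && (ccol c < j)%N]| = j.
Proof.
elim: j => [|j IHj] hj.
  by apply: eq_card0 => c; rewrite inE ltn0 andbF.
have [c [cr cc]] := mkcellP hj.
rewrite -[RHS](congr1 S (IHj (ltnW hj))) (cardsD1 c) inE cr eqxx cc leqnn /=.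
congr (_.+1); apply: eq_card => d; rewrite !inE ltnS.
case: eqP => [->|ne] /=; first by rewrite cc ltnn andbF.
case: (crow d =P r) => //= dr; rewrite leq_eqVlt; case: eqP => //= dc.
by case: ne; apply: cell_eq; rewrite ?dr ?dc.
Qed.

Section Counts.
Variables (n : nat) (T : {ffun cell -> 'I_n}).

Definition row_count r v := #|[set c : cell | (crow c == r) && (T c < v)%N]|.

Lemma row_count_le r v : (row_count r v <= nth 0 la r)%N.
Proof.
rewrite -[leqRHS](card_row (leqnn _)); apply: subset_leq_card.
apply/subsetP => c; rewrite !inE => /andP[/eqP <- _].
by rewrite eqxx ccolP.
Qed.

Lemma row_count_mono r v w : (v <= w)%N -> (row_count r v <= row_count r w)%N.
Proof.
move=> vw; apply: subset_leq_card; apply/subsetP => c; rewrite !inE.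
by case/andP=> -> /= h; apply: leq_trans vw.
Qed.

Hypothesis ssT : semistandard T.

Lemma row_countP c v : (T c < v)%N = (ccol c < row_count (crow c) v)%N.
Proof.
have /semistandardP ss := ssT; apply/idP/idP => [hT|].
  rewrite -(card_row (ccolP c)); apply: subset_leq_card.
  apply/subsetP => d; rewrite !inE => /andP[/eqP h1]; rewrite ltnS => h2.
  by rewrite h1 eqxx /=; apply: leq_ltn_trans hT; case: (ss d c) => + _; apply.
rewrite !ltnNge; apply: contra => hT.
rewrite -[leqRHS](card_row (ltnW (ccolP c))); apply: subset_leq_card.
apply/subsetP => d; rewrite !inE => /andP[/eqP h1 h2]; rewrite h1 eqxx /=.
rewrite ltnNge; apply/negP => h3; have [/(_ (esym h1) h3) + _] := ss c d.
by move/(leq_trans hT); rewrite leqNgt h2.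
Qed.

Lemma row_count_lt r s v : (r < s)%N -> (row_count s v.+1 <= row_count r v)%N.
Proof.
move=> rs; rewrite leqNgt; apply/negP => h.
have [c [cs cc]] := mkcellP (leq_trans h (row_count_le _ _)).
have [|d [dr dc]] := @mkcellP r (row_count r v).
  apply: (leq_trans h); apply: (leq_trans (row_count_le _ _)).
  exact: parts_anti (ltnW rs).
have: (T c < v.+1)%N by rewrite row_countP cs cc.
have: (T d < v)%N = false by rewrite row_countP dr dc ltnn.
have /semistandardP/(_ d c)[_ ss] := ssT.
have := ss (etrans dc (esym cc)); rewrite dr cs => /(_ rs); lia.
Qed.

End Counts.

Lemma row_countE n (T : {ffun cell -> 'I_n}) r v j : (j <= nth 0 la r)%N ->
  (forall c, crow c = r -> (T c < v)%N = (ccol c < j)%N) -> row_count T r v = j.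
Proof.
move=> hj H; rewrite -[RHS](card_row hj); apply: eq_card => c; rewrite !inE.
by case: eqP => //= /H ->.
Qed.

Section BenderKnuth.
Variables (n : nat) (k k' : 'I_n).
Hypothesis kk' : k' = k.+1 :> nat.
Implicit Types T : {ffun cell -> 'I_n}.

Definition bk_lo T r := maxn (row_count T r k) (row_count T r.+1 k.+2).
Definition bk_hi T r :=
  if r is r'.+1 then minn (row_count T r k.+2) (row_count T r' k)
  else row_count T r k.+2.
Definition bk_mid T r := (bk_lo T r + bk_hi T r - row_count T r k.+1)%N.
Definition bk T : {ffun cell -> 'I_n} :=
  [ffun c => if (T c == k) || (T c == k') then
               if (ccol c < bk_mid T (crow c))%N then k else k'
             else T c].

Lemma bk_bounds T r : semistandard T ->
  [/\ bk_lo T r <= row_count T r k.+1 <= bk_hi T r,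
      bk_lo T r <= bk_mid T r <= bk_hi T r,
      row_count T r k <= bk_lo T r & bk_hi T r <= row_count T r k.+2]%N.
Proof.
move=> ss; have m1 := row_count_mono T r (leqnSn k).
have m2 := row_count_mono T r (leqnSn k.+1).
have l1 := row_count_lt ss k.+1 (ltnSn r).
have hlo : (bk_lo T r <= row_count T r k.+1)%N by rewrite geq_max m1 l1.
have hhi : (row_count T r k.+1 <= bk_hi T r)%N.
  by rewrite /bk_hi; case: r m2 {m1 l1 hlo} => //= r m2; rewrite leq_min m2 row_count_lt.
split; rewrite ?hlo ?hhi // ?leq_maxl //.
  by rewrite /bk_mid; lia.
by rewrite /bk_hi; case: (r) => // r'; rewrite geq_minl.
Qed.

Definition bk_count T r v := if v == k.+1 then bk_mid T r else row_count T r v.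

Lemma bk_countP T c v : semistandard T ->
  (bk T c < v)%N = (ccol c < bk_count T (crow c) v)%N.
Proof.
move=> ss; rewrite /bk_count ffunE.
have [_ /andP[h1 h2] h3 h4] := bk_bounds (crow c) ss.
have E w := row_countP ss c w.
have Ek : (T c == k) = (T c == k :> nat) by [].
have Ek' : (T c == k') = (T c == k.+1 :> nat) by rewrite -kk'.
rewrite Ek Ek'; have := E k; have := E k.+2; have := E v.
case: ifP => hb; case: eqP => [->|hv]; case: (ltnP (ccol c) (bk_mid T (crow c))) => hm /=; lia.
Qed.

Lemma bk_semistandard T : semistandard T -> semistandard (bk T).
Proof.
move=> ss; apply/semistandardP => c d; split=> [er ec|ec er].
  rewrite leqNgt; apply/negP; rewrite bk_countP // -er => h.
  by have := leq_ltn_trans ec h; rewrite -bk_countP // ltnn.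
rewrite ltnNge -ltnS; apply/negP; rewrite bk_countP // -ec => h.
suff: (bk T c < bk T c)%N by rewrite ltnn.
rewrite [X in is_true X]bk_countP //; apply: leq_trans h _; move: (bk T c : nat) => v.
have [_ /andP[c1 c2] c3 c4] := bk_bounds (crow c) ss.
have [_ /andP[d1 d2] d3 d4] := bk_bounds (crow d) ss.
have L w := row_count_lt ss w er.
rewrite /bk_count eqSS; case: (v =P k) => [->|hk].
  rewrite (_ : (k == k.+1 :> nat) = false); last by lia.
  apply: (leq_trans d2); case: (crow d) er => // r' hr; rewrite /bk_hi.
  rewrite (leq_trans (geq_minr _ _)) //.
  move: hr; rewrite ltnS leq_eqVlt => /orP[/eqP -> //|hr].
  by rewrite (leq_trans (row_count_mono T r' (leqnSn k))) ?row_count_lt.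
case: eqP => [->|//].
apply: leq_trans c1; rewrite leq_max; apply/orP; right.
move: er; rewrite leq_eqVlt => /orP[/eqP -> //|er].
rewrite (leq_trans (row_count_mono T _ (leqnSn k.+2))) //.
exact: row_count_lt.
Qed.

Lemma row_count_bk T r v : semistandard T -> row_count (bk T) r v = bk_count T r v.
Proof.
move=> ss; apply: row_countE => [|c <-]; last exact: bk_countP.
rewrite /bk_count; case: eqP => _; last exact: row_count_le.
have [_ /andP[_ h1] _ h2] := bk_bounds r ss.
exact: leq_trans (leq_trans h1 h2) (row_count_le _ _ _).
Qed.

Lemma bkK T : semistandard T -> bk (bk T) = T.
Proof.
move=> ss; apply/ffunP => c; apply: val_inj.
have ss' := bk_semistandard ss; set r := crow c.
have [/andP[h1 h2] h3 h4 h5] := bk_bounds r ss.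
have Emid : bk_mid (bk T) r = row_count T r k.+1.
  rewrite /bk_mid; have ->: bk_lo (bk T) r = bk_lo T r.
    by rewrite /bk_lo !row_count_bk // /bk_count; do 2?case: eqP; lia.
  have ->: bk_hi (bk T) r = bk_hi T r.
    rewrite /bk_hi; case: (r) => [|r']; rewrite !row_count_bk // /bk_count;
    by do 2?case: eqP; lia.
  by rewrite row_count_bk // /bk_count eqxx /bk_mid; lia.
have key v : (bk (bk T) c < v)%N = (T c < v)%N.
  rewrite bk_countP // /bk_count -/r Emid row_count_bk // /bk_count.
  by case: eqP => [->|_]; rewrite row_countP.
have := key (T c); have := key (bk (bk T) c); rewrite !ltnn => a b.
apply/eqP; rewrite eqn_leq; apply/andP; split; rewrite leqNgt; [by rewrite -a | by rewrite b].
Qed.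

Definition count_lt T v := #|[set c : cell | (T c < v)%N]|.

Lemma count_ltE T v : count_lt T v = (\sum_(r < size la) row_count T r v)%N.
Proof.
rewrite /count_lt -sum1_card.
rewrite (partition_big (fun c : cell => (val c).1) xpredT) //=.
apply: eq_bigr => r _; rewrite /row_count -sum1_card; apply: eq_bigl => c.
by rewrite !inE andbC.
Qed.

Lemma bk_sum T : semistandard T -> (count_lt (bk T) k.+1 + count_lt T k.+1 =
  count_lt T k + count_lt T k.+2)%N.
Proof.
move=> ss; rewrite !count_ltE -!big_split /=.
transitivity (\sum_(r < size la) (bk_lo T r + bk_hi T r))%N.
  apply: eq_bigr => r _; rewrite row_count_bk // /bk_count eqxx /bk_mid.
  by have [/andP[? ?] _ _ _] := bk_bounds r ss; lia.
have H m : (\sum_(r < m) (bk_lo T r + bk_hi T r) + bk_hi T m =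
   \sum_(r < m) (row_count T r k + row_count T r k.+2) + row_count T m k.+2)%N.
  elim: m => [|m IH]; first by rewrite !big_ord0.
  have h : (bk_lo T m + bk_hi T m.+1 = row_count T m k + row_count T m.+1 k.+2)%N.
    by rewrite /bk_hi /bk_lo minnC; lia.
  by rewrite !big_ord_recr; move: IH h => /=; lia.
have := H (size la); have q0 : row_count T (size la) k.+2 = 0%N.
  by apply/eqP; rewrite -leqn0 (leq_trans (row_count_le _ _ _)) // nth_default.
have ->: bk_hi T (size la) = 0%N.
  by move: q0; rewrite /bk_hi; case: (size la) => // m ->; rewrite min0n.
by rewrite q0 !addn0.
Qed.

Definition content T : 'X_{1..n} := [multinom #|[set c | T c == i]| | i < n].

Lemma prodX_content T : \prod_c 'X_(T c) = 'X_[content T] :> {mpoly int[n]}.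
Proof.
rewrite mpolyXE_id (partition_big T xpredT) //=; apply: eq_bigr => i _.
rewrite mnmE -prodr_const; apply: eq_big => [c|c /eqP -> //].
by rewrite inE.
Qed.

Lemma contentE T i : content T i = (count_lt T i.+1 - count_lt T i)%N.
Proof.
rewrite mnmE; have ->: count_lt T i.+1 = (count_lt T i + #|[set c | T c == i]|)%N.
  rewrite -cardsUI [X in (_ + X)%N](_ : _ = 0%N) ?addn0; last first.
    by apply: eq_card0 => c; rewrite !inE andbC; case: eqP => // ->; rewrite ltnn.
  by apply: eq_card => c; rewrite !inE ltnS leq_eqVlt orbC.
by rewrite addKn.
Qed.

Lemma content_bk T : semistandard T ->
  \prod_c 'X_(bk T c) = msym (tperm k k') (\prod_c 'X_(T c)) :> {mpoly int[n]}.
Proof.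
move=> ss; rewrite !prodX_content msymX; congr 'X_[_].
have C v : v != k.+1 -> count_lt (bk T) v = count_lt T v.
  move=> hv; rewrite !count_ltE; apply: eq_bigr => r _.
  by rewrite row_count_bk // /bk_count (negPf hv).
have S := bk_sum ss.
have M v : (count_lt T v <= count_lt T v.+1)%N.
  by apply: subset_leq_card; apply/subsetP => c; rewrite !inE => /ltnW.
have M' v : (count_lt (bk T) v <= count_lt (bk T) v.+1)%N.
  by apply: subset_leq_card; apply/subsetP => c; rewrite !inE => /ltnW.
have m1 := M k; have m2 := M k.+1; have m3 := M' k; have m4 := M' k.+1.
have c1 := C k; have c2 := C k.+2.
apply/mnmP => i; rewrite [RHS]mnmE tpermV !contentE.
case: tpermP => [->|->|/eqP h1 /eqP h2].
- by rewrite kk' c1; lia.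
- by rewrite kk' c2; lia.
have h1' : i != k :> nat by [].
have h2' : i != k.+1 :> nat by rewrite -kk'.
by rewrite !C //; lia.
Qed.

Lemma schur_pol_bk : msym (tperm k k') (schur_pol n) = schur_pol n.
Proof.
rewrite raddf_sum /= [RHS](reindex_onto bk bk) /=; last by move=> T /bkK.
have E T : semistandard (bk T) && (bk (bk T) == T) = semistandard T.
  apply/andP/idP => [[h /eqP <-]|h]; first exact: bk_semistandard.
  by rewrite bkK // bk_semistandard.
by rewrite (eq_bigl _ _ E); apply: eq_bigr => T /content_bk ->.
Qed.

End BenderKnuth.

Lemma adjacent_symmetric n (p : {mpoly int[n]}) :
    (forall i j : 'I_n, j = i.+1 :> nat -> msym (tperm i j) p = p) ->
  p \is symmetric.
Proof.
move=> H; have H2 (i j : 'I_n) : (i < j)%N -> msym (tperm i j) p = p.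
  move: {2}(j : nat) (leqnn j) => m; elim: m i j => [|m IHm] i j jm ij; first by lia.
  have [e|ne] := eqVneq (j : nat) i.+1; first exact: H.
  have hj : (j.-1 < n)%N by have := ltn_ord j; lia.
  pose j0 := Ordinal hj.
  have ->: tperm i j = (tperm j0 j * tperm i j0 * tperm j0 j)%g.
    rewrite -{1}(tpermV j0 j) -mulgA -conjgE tpermJ tpermL tpermD //.
      by rewrite -val_eqE /=; lia.
    by rewrite -val_eqE /=; lia.
  have a1 : msym (tperm j0 j) p = p by apply: H => /=; lia.
  have a2 : msym (tperm i j0) p = p by apply: IHm => /=; lia.
  by rewrite !msymMm a1 a2 a1.
apply/issymP => s; have [ts -> hts] := prod_tpermP s.
elim: ts hts => [|[i j] ts IH] /=; first by rewrite big_nil msym1m.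
case/andP=> ij hts; rewrite big_cons msymMm /=.
suff ->: msym (tperm i j) p = p by apply: IH.
case: (ltngtP i j) => h; first exact: H2.
- by rewrite tpermC; apply: H2.
by case/negP: ij; apply/eqP/val_inj.
Qed.

Lemma schur_pol_restrict n : schur_pol n.+1 \mPo restrict_vars n = schur_pol n.
Proof.
rewrite raddf_sum /=.
have E (T : {ffun cell -> 'I_n.+1}) : (\prod_c 'X_(T c)) \mPo restrict_vars n =
   \prod_c (if unlift ord_max (T c) is Some j then 'X_j else 0) :> {mpoly int[n]}.
  rewrite rmorph_prod /=; apply: eq_bigr => c _.
  by rewrite comp_mpolyXU -tnth_nth tnth_mktuple.
rewrite (eq_bigr _ (fun T _ => E T)).
pose L (T : {ffun cell -> 'I_n}) := [ffun c => lift ord_max (T c)].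
have Linj : injective L.
  move=> T1 T2 /ffunP eqL; apply/ffunP => c; have := eqL c.
  by rewrite !ffunE; apply: lift_inj.
have Lss T : semistandard (L T) = semistandard T.
  by apply: eq_forallb => c; apply: eq_forallb => d; rewrite !ffunE !lift_max.
rewrite (bigID (mem (L @: setT))) /= [X in _ + X]big1 ?addr0; last first.
  move=> T /andP[ssT hT]; have [/existsP[c /eqP hc]|] := boolP [exists c, T c == ord_max].
    by rewrite (bigD1 c) //= hc unlift_none mul0r.
  rewrite negb_exists => /forallP hmax; case/negP: hT.
  have [c|T0 hT0] := @fin_all_exists _ _ (fun c j => T c = lift ord_max j).
    by case: (unliftP ord_max (T c)) => [j|] Ec; [exists j | have := hmax c; rewrite Ec eqxx].
  by apply/imsetP; exists (finfun T0) => //; apply/ffunP => c; rewrite !ffunE.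
rewrite (eq_bigl (fun T => (T \in L @: setT) && semistandard T)) => [|T]; last by rewrite andbC.
rewrite big_mkcondr /= big_imset /=; last by move=> ? ? _ _; apply: Linj.
rewrite -big_mkcondr /=; apply: eq_big => [T|T _]; first by rewrite inE Lss.
by apply: eq_bigr => c _; rewrite ffunE liftK.
Qed.

Fact schur_subproof : is_symfun schur_pol.
Proof.
split=> [n|n|]; [|exact: schur_pol_restrict|].
  by apply: adjacent_symmetric => i j; apply: schur_pol_bk.
exists #|{: cell}|.+1 => n; rewrite msizeE; apply/bigmax_leqP_seq => m + _.
have /dhomogP h : schur_pol n \is #|{: cell}|.-homog.
  apply: rpred_sum => T _; rewrite prodX_content dhomogX /= mdegE.
  under eq_bigr => i _ do rewrite mnmE -sum1_card.
  rewrite -sum1_card (partition_big T xpredT) //=; apply/eqP.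
  by apply: eq_bigr => i _; apply: eq_bigl => c; rewrite inE.
by move/h => /= ->.
Qed.
Definition schur := SymFun schur_subproof.

End Schur.

(* Over Z, bilinear means biadditive. *)
Definition biadditive (U V W : zmodType) (phi : U -> V -> W) : Prop :=
  (forall u u' v, phi (u + u') v = phi u v + phi u' v) /\
  (forall u v v', phi u (v + v') = phi u v + phi u v').

Section BiadditiveTheory.
Variables (U V W : zmodType) (phi : U -> V -> W).
Hypothesis phiB : biadditive phi.

Lemma biadd0l v : phi 0 v = 0.
Proof. by apply: (addrI (phi 0 v)); rewrite -phiB.1 !addr0. Qed.
Lemma biadd0r u : phi u 0 = 0.
Proof. by apply: (addrI (phi u 0)); rewrite -phiB.2 !addr0. Qed.
Lemma biaddNl u v : phi (- u) v = - phi u v.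
Proof. by apply: (addrI (phi u v)); rewrite -phiB.1 !subrr biadd0l. Qed.

End BiadditiveTheory.

Section Tensor.
Variables A B : comNzRingType.
Implicit Types (s t : seq (A * B)).

(* A sequence [:: (a_1, b_1); ...] stands for the formal sum of the a_i (x) b_i.
   Two formal sums are identified when no biadditive map separates them; the
   quotient is therefore the tensor product over Z, [tens] being the universal
   biadditive map (tens_biadditive, tens_sumE, tens_lift_tens). *)
Definition formal_eval (G : zmodType) (phi : A -> B -> G) s : G :=
  \sum_(p <- s) phi p.1 p.2.

Definition formal_eq s t : bool :=
  `[< forall (G : zmodType) (phi : A -> B -> G), biadditive phi ->
      formal_eval phi s = formal_eval phi t >].

Lemma formal_eqP s t : reflect
  (forall (G : zmodType) (phi : A -> B -> G), biadditive phi ->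
      formal_eval phi s = formal_eval phi t) (formal_eq s t).
Proof. exact: asboolP. Qed.

Fact formal_eq_refl : reflexive formal_eq.
Proof. by move=> s; apply/formal_eqP. Qed.
Fact formal_eq_sym : ssrbool.symmetric formal_eq.
Proof.
by move=> s t; apply/formal_eqP/formal_eqP => H G phi phiB; rewrite H.
Qed.
Fact formal_eq_trans : transitive formal_eq.
Proof.
move=> s t u /formal_eqP H1 /formal_eqP H2; apply/formal_eqP => G phi phiB.
by rewrite H1 // H2.
Qed.

Canonical formal_equiv :=
  EquivRel formal_eq formal_eq_refl formal_eq_sym formal_eq_trans.

Definition tensor := {eq_quot formal_equiv}.
HB.instance Definition _ := Choice.on tensor.

Definition tens_sum s : tensor := \pi_({eq_quot formal_equiv}) s.
Definition tens (a : A) (b : B) : tensor := tens_sum [:: (a, b)].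

Lemma tens_sumP s t : reflect
  (forall (G : zmodType) (phi : A -> B -> G), biadditive phi ->
      formal_eval phi s = formal_eval phi t)
  (tens_sum s == tens_sum t).
Proof. by rewrite eqmodE; apply: formal_eqP. Qed.

Lemma tens_sum_eq s t :
  (forall (G : zmodType) (phi : A -> B -> G), biadditive phi ->
      formal_eval phi s = formal_eval phi t) -> tens_sum s = tens_sum t.
Proof. by move=> H; apply/eqP/tens_sumP. Qed.

Lemma tens_sum_repr (u : tensor) : tens_sum (repr u) = u.
Proof. exact: reprK. Qed.

Definition tens_lift (G : zmodType) (phi : A -> B -> G) (u : tensor) : G :=
  formal_eval phi (repr u).

Lemma tens_lift_sum (G : zmodType) (phi : A -> B -> G) s : biadditive phi ->
  tens_lift phi (tens_sum s) = formal_eval phi s.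
Proof.
move=> phiB; have /eqP/tens_sumP H := tens_sum_repr (tens_sum s).
exact: H.
Qed.

Definition formal_opp s := [seq (- p.1, p.2) | p <- s].
Definition formal_mul s t := [seq (p.1 * q.1, p.2 * q.2) | p <- s, q <- t].

Definition tensor0 : tensor := tens_sum [::].
Definition tensor1 : tensor := tens 1 1.
Definition tensorD (u v : tensor) : tensor := tens_sum (repr u ++ repr v).
Definition tensorN (u : tensor) : tensor := tens_sum (formal_opp (repr u)).
Definition tensorM (u v : tensor) : tensor :=
  tens_sum (formal_mul (repr u) (repr v)).

Lemma eval_cat (G : zmodType) (phi : A -> B -> G) s t :
  formal_eval phi (s ++ t) = formal_eval phi s + formal_eval phi t.
Proof. exact: big_cat. Qed.

Lemma eval_opp (G : zmodType) (phi : A -> B -> G) s : biadditive phi ->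
  formal_eval phi (formal_opp s) = - formal_eval phi s.
Proof.
move=> phiB; rewrite /formal_eval big_map -sumrN; apply: eq_bigr => p _ /=.
exact: biaddNl.
Qed.

Lemma eval_mul (G : zmodType) (phi : A -> B -> G) s t :
  formal_eval phi (formal_mul s t) =
  \sum_(p <- s) \sum_(q <- t) phi (p.1 * q.1) (p.2 * q.2).
Proof. by rewrite /formal_eval big_allpairs_dep. Qed.

Lemma eval_repr (G : zmodType) (phi : A -> B -> G) s : biadditive phi ->
  formal_eval phi (repr (tens_sum s)) = formal_eval phi s.
Proof. exact: tens_lift_sum. Qed.

Lemma biadditive_mull (G : zmodType) (phi : A -> B -> G) a b : biadditive phi ->
  biadditive (fun x y => phi (a * x) (b * y)).
Proof.
by case=> p1 p2; split=> *; rewrite mulrDr ?p1 ?p2.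
Qed.

Lemma tens_sumD s t : tensorD (tens_sum s) (tens_sum t) = tens_sum (s ++ t).
Proof.
by apply: tens_sum_eq => G phi phiB; rewrite !eval_cat !eval_repr.
Qed.

Lemma tens_sumN s : tensorN (tens_sum s) = tens_sum (formal_opp s).
Proof.
by apply: tens_sum_eq => G phi phiB; rewrite !eval_opp // eval_repr.
Qed.

Lemma tens_sumM s t : tensorM (tens_sum s) (tens_sum t) = tens_sum (formal_mul s t).
Proof.
apply: tens_sum_eq => G phi phiB; rewrite !eval_mul.
transitivity (\sum_(p <- repr (tens_sum s)) \sum_(q <- t)
                phi (p.1 * q.1) (p.2 * q.2)).
  apply: eq_bigr => p _; exact: (eval_repr t (biadditive_mull p.1 p.2 phiB)).
rewrite exchange_big [RHS]exchange_big /=; apply: eq_bigr => q _.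
under eq_bigr => p _ do rewrite mulrC [p.2 * _]mulrC.
under [RHS]eq_bigr => p _ do rewrite mulrC [p.2 * _]mulrC.
exact: (eval_repr s (biadditive_mull q.1 q.2 phiB)).
Qed.

Lemma tensorW (P : tensor -> Prop) : (forall s, P (tens_sum s)) -> forall u, P u.
Proof. by move=> H u; rewrite -(tens_sum_repr u). Qed.

Fact tensor_addA : associative tensorD.
Proof.
elim/tensorW=> s; elim/tensorW=> t; elim/tensorW=> u.
by rewrite !tens_sumD catA.
Qed.
Fact tensor_addC : commutative tensorD.
Proof.
elim/tensorW=> s; elim/tensorW=> t; rewrite !tens_sumD.
by apply: tens_sum_eq => G phi _; rewrite !eval_cat addrC.
Qed.
Fact tensor_add0 : left_id tensor0 tensorD.
Proof. by elim/tensorW=> s; rewrite tens_sumD. Qed.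
Fact tensor_addN : left_inverse tensor0 tensorN tensorD.
Proof.
elim/tensorW=> s; rewrite tens_sumN tens_sumD; apply: tens_sum_eq => G phi phiB.
by rewrite eval_cat eval_opp // addNr /formal_eval big_nil.
Qed.

HB.instance Definition _ := GRing.isZmodule.Build tensor
  tensor_addA tensor_addC tensor_add0 tensor_addN.

Fact tensor_mulA : associative tensorM.
Proof.
elim/tensorW=> s; elim/tensorW=> t; elim/tensorW=> u.
rewrite !tens_sumM; apply: tens_sum_eq => G phi _.
rewrite !eval_mul /formal_mul big_allpairs_dep /=; apply: eq_bigr => p _.
rewrite big_allpairs_dep /=; apply: eq_bigr => q _.
by apply: eq_bigr => r _; rewrite !mulrA.
Qed.
Fact tensor_mulC : commutative tensorM.
Proof.
elim/tensorW=> s; elim/tensorW=> t; rewrite !tens_sumM.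
apply: tens_sum_eq => G phi _; rewrite !eval_mul exchange_big.
by apply: eq_bigr => p _; apply: eq_bigr => q _; rewrite mulrC [X in phi _ X]mulrC.
Qed.
Fact tensor_mul1 : left_id tensor1 tensorM.
Proof.
elim/tensorW=> s; rewrite tens_sumM; apply: tens_sum_eq => G phi _.
rewrite eval_mul big_seq1; apply: eq_bigr => p _ /=.
by rewrite !mul1r.
Qed.
Fact tensor_mulD : left_distributive tensorM +%R.
Proof.
elim/tensorW=> s; elim/tensorW=> t; elim/tensorW=> u.
have D s' t' : tens_sum s' + tens_sum t' = tens_sum (s' ++ t') := tens_sumD s' t'.
rewrite D !tens_sumM D.
by apply: tens_sum_eq => G phi _; rewrite eval_cat !eval_mul big_cat.
Qed.

HB.instance Definition _ := GRing.Zmodule_isComPzRing.Build tensor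
  tensor_mulA tensor_mulC tensor_mul1 tensor_mulD.

Lemma tens_biadditive : biadditive tens.
Proof.
split=> *; rewrite [RHS]tens_sumD; apply: tens_sum_eq => G phi [p1 p2];
  by rewrite /formal_eval big_cons !big_nil big_cons big_seq1 /= addr0 ?p1 ?p2.
Qed.

Lemma tensM a b a' b' : tens a b * tens a' b' = tens (a * a') (b * b').
Proof. exact: tens_sumM. Qed.

Lemma tens_sumE s : tens_sum s = \sum_(p <- s) tens p.1 p.2.
Proof.
elim: s => [|[a b] s IH]; first by rewrite big_nil.
by rewrite big_cons -IH [RHS]tens_sumD.
Qed.

Lemma tens_lift_tens (G : zmodType) (phi : A -> B -> G) a b : biadditive phi ->
  tens_lift phi (tens a b) = phi a b.
Proof. by move=> phiB; rewrite tens_lift_sum // /formal_eval big_seq1. Qed.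

Lemma tens_liftD (G : zmodType) (phi : A -> B -> G) u v : biadditive phi ->
  tens_lift phi (u + v) = tens_lift phi u + tens_lift phi v.
Proof.
move=> phiB; elim/tensorW: u => s; elim/tensorW: v => t.
by rewrite [_ + _ as X in tens_lift _ X]tens_sumD !tens_lift_sum // eval_cat.
Qed.

End Tensor.

Definition orthonormal_form (I : eqType) (V : zmodType) (b : I -> V)
    (form : V -> V -> int) : Prop :=
  biadditive form /\ forall i j, form (b i) (b j) = (i == j)%:R.

(* Existence of the pairing: Kostka numbers are unitriangular with respect to
   [part_weight], so the coordinates on Schur functions can be computed from
   the coefficients of dominant monomials. *)
Section HallExistence.

Definition part_exp n (mu : seq nat) : 'X_{1..n} := [multinom nth 0%N mu i | i < n].
Definition part_coef (mu : intpart) (f : symfun) : int :=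
  (trunc f (size mu))@_(part_exp (size mu) mu).
Definition part_weight (mu : seq nat) : nat := (\sum_(i < size mu) i * nth 0 mu i)%N.

Lemma part_coefD mu f g : part_coef mu (f + g) = part_coef mu f + part_coef mu g.
Proof. exact: mcoeffD. Qed.

Lemma intpart_eq (la mu : intpart) : (forall i, nth 0%N la i = nth 0%N mu i) -> la = mu.
Proof.
have pos (nu : intpart) i : (i < size nu)%N = (nth 0%N nu i != 0%N).
  have [h|h] := ltnP; last by rewrite nth_default.
  have /andP[_] := valP nu; case: eqP => //= e.
  by rewrite -e mem_nth.
move=> H; apply: val_inj; apply: (@eq_from_nth _ 0%N) => [|i _]; last exact: H.
have S i : (i < size la)%N = (i < size mu)%N by rewrite !pos H.
by apply/eqP; rewrite eqn_leq; apply/andP; split; rewrite leqNgt; [rewrite S | rewrite -S]; rewrite ltnn.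
Qed.

Lemma sumn_nth (s : seq nat) : sumn s = (\sum_(i < size s) nth 0 s i)%N.
Proof. by rewrite sumnE (big_nth 0%N) big_mkord. Qed.

Lemma card_cell (la : intpart) : #|{: cell la}| = sumn la.
Proof.
rewrite sumn_nth -sum1_card (partition_big (fun c : cell la => (val c).1) xpredT) //=.
apply: eq_bigr => r _; rewrite -[RHS](@card_row la r _ (leqnn _)) -sum1_card.
apply: eq_bigl => c; rewrite inE.
by case: eqP => [<-|ne]; [rewrite eqxx ccolP|case: eqP => // /val_inj].
Qed.

Lemma row_weight (la : intpart) : (\sum_(c : cell la) crow c = part_weight la)%N.
Proof.
rewrite (partition_big (fun c : cell la => (val c).1) xpredT) //=.
apply: eq_bigr => r _; rewrite mulnC -[X in (X * _)%N](@card_row la r _ (leqnn _)).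
rewrite -sum_nat_const; apply: eq_big => c; last by move/eqP <-.
by rewrite inE; case: eqP => [<-|ne]; [rewrite eqxx ccolP|case: eqP => // /val_inj].
Qed.

Lemma semistandard_row (la : intpart) n (T : {ffun cell la -> 'I_n}) c :
  semistandard T -> (crow c <= T c)%N.
Proof.
move=> /semistandardP ss; move: {2}(crow c) (erefl (crow c)) => r.
elim: r c => [|r IH] c cr; first by rewrite cr.
have [d [dr dc]] := @mkcellP la r (ccol c) (leq_trans (ccolP c) (parts_anti _ (leq_trans (leqnSn r) (eq_leq (esym cr))))).
have [_ /(_ dc)] := ss d c; rewrite dr cr => /(_ (ltnSn r)).
by apply: leq_ltn_trans; rewrite -dr; apply: IH.
Qed.

Lemma part_coef_schur (la mu : intpart) :
  part_coef mu (schur la) =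
  #|[pred T : {ffun cell la -> 'I_(size mu)} |
      semistandard T && (content T == part_exp (size mu) mu)]|%:R.
Proof.
rewrite /part_coef /= /schur_pol raddf_sum /=.
under eq_bigr => T _ do rewrite prodX_content mcoeffX.
rewrite -sum1_card natr_sum big_mkcond [RHS]big_mkcond /=.
by apply: eq_bigr => T _; rewrite inE; case: ifP; case: eqP.
Qed.

Lemma content_rows (la : intpart) n (T : {ffun cell la -> 'I_n}) (i : 'I_n) :
  (forall c, T c = crow c :> nat) -> content T i = nth 0%N la i.
Proof.
move=> H; rewrite mnmE -[RHS](@card_row la i _ (leqnn _)); apply: eq_card => c.
rewrite !inE -val_eqE /= H; case: eqP => // <-.
by rewrite ccolP.
Qed.

Lemma content_weight (la mu : intpart) (T : {ffun cell la -> 'I_(size mu)}) :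
  content T = part_exp (size mu) mu ->
  (\sum_c (T c : nat) = part_weight mu)%N /\ #|{: cell la}| = sumn mu.
Proof.
move=> E; have En (i : 'I_(size mu)) : #|[set c | T c == i]| = nth 0%N mu i.
  by have /mnmP/(_ i) := E; rewrite !mnmE.
split.
  rewrite (partition_big T xpredT) //=; apply: eq_bigr => i _.
  rewrite mulnC -En -sum_nat_const; apply: eq_big => c; first by rewrite inE.
  by move/eqP ->.
rewrite sumn_nth -sum1_card (partition_big T xpredT) //=; apply: eq_bigr => i _.
by rewrite -En -sum1_card; apply: eq_bigl => c; rewrite inE.
Qed.

Lemma semistandard_weight (la mu : intpart) (T : {ffun cell la -> 'I_(size mu)}) :
  semistandard T -> content T = part_exp (size mu) mu ->
  sumn la = sumn mu /\ ((part_weight la < part_weight mu)%N \/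
    la = mu /\ forall c, T c = crow c :> nat).
Proof.
move=> ss E; have [Ew Es] := content_weight E.
split; first by rewrite -card_cell.
rewrite -Ew -row_weight.
have [le_w eq_w] := leqif_sum (P := xpredT)
  (fun c _ => leqif_eq (semistandard_row c ss)).
move: le_w; rewrite leq_eqVlt => /orP[e|]; [right | by left].
have {e eq_w}H c : T c = crow c :> nat.
  by move: e; rewrite eq_w => /forallP/(_ c)/eqP.
split=> //; apply: intpart_eq => i; have [hi|hi] := ltnP i (size mu).
  by rewrite -(content_rows (Ordinal hi) H) E mnmE.
rewrite [RHS]nth_default //; apply/eqP; rewrite -leqn0 leqNgt; apply/negP => h.
have [c [cr _]] := mkcellP h; have := ltn_ord (T c).
by rewrite H cr ltnNge hi.
Qed.

Lemma kostka_diag (la : intpart) : part_coef la (schur la) = 1.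
Proof.
pose T0 : {ffun cell la -> 'I_(size la)} := [ffun c => (val c).1].
have HT0 c : T0 c = crow c :> nat by rewrite ffunE.
rewrite part_coef_schur (eq_card1 (x := T0)) // => T; rewrite !inE.
apply/andP/eqP => [[ss /eqP E]|->].
  have [_ [|[_ H]]] := semistandard_weight ss E; first by rewrite ltnn.
  by apply/ffunP => c; apply: val_inj; rewrite /= H HT0.
split; last by apply/eqP/mnmP => i; rewrite (content_rows i HT0) mnmE.
apply/semistandardP => c d; rewrite !HT0; split=> [-> //|_ //].
Qed.

Lemma kostka_offdiag (la mu : intpart) : la != mu ->
  ~~ ((sumn la == sumn mu) && (part_weight la < part_weight mu)%N) ->
  part_coef mu (schur la) = 0.
Proof.
move=> ne h; rewrite part_coef_schur eq_card0 // => T; rewrite inE.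
apply/negP => /andP[ss /eqP E]; have [es [ew|[e _]]] := semistandard_weight ss E.
  by rewrite es eqxx ew in h.
by rewrite e eqxx in ne.
Qed.

Lemma part_of_perm (la : intpart) s : perm_eq [seq i <- s | i != 0%N] la -> part_of s = la.
Proof.
have gtr : transitive geq by move=> x y z /= h1 h2; apply: leq_trans h2 h1.
move=> p; apply: val_inj => /=; apply: (sorted_eq gtr).
- by move=> x y /= /andP[h1 h2]; apply/eqP; rewrite eqn_leq h1 h2.
- by apply: sort_sorted => x y; apply: leq_total.
- by have /andP[] := valP la.
by rewrite perm_sort.
Qed.

Definition parts_of_size d : seq intpart :=
  undup [seq part_of (map val (tval t)) | t <- enum {: d.-tuple 'I_d.+1}].

Lemma mem_parts_of_size (la : intpart) : la \in parts_of_size (sumn la).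
Proof.
have /andP[_ la0] := valP la; set d := sumn la.
have size_le : (size la <= d)%N.
  suff: (\sum_(i < size la) 1 <= d)%N by rewrite sum_nat_const card_ord muln1.
  rewrite /d sumn_nth; apply: leq_sum => i _; rewrite lt0n; apply: contraNneq la0 => <-.
  by rewrite mem_nth.
have part_le i : (nth 0%N la i <= d)%N.
  have [hi|hi] := ltnP i (size la); last by rewrite nth_default.
  by rewrite /d sumn_nth (bigD1 (Ordinal hi)) //= leq_addr.
pose s := la ++ nseq (d - size la) 0%N.
have size_s : size s = d by rewrite size_cat size_nseq subnKC.
rewrite mem_undup; apply/mapP.
exists [tuple inord (nth 0%N s i) | i < d]; first by rewrite mem_enum.
apply/esym/part_of_perm; rewrite (_ : map val _ = s).
  rewrite filter_cat [X in _ ++ X](_ : _ = [::]) ?cats0.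
    rewrite (all_filterP _) //; apply/allP => i hi; apply: contraNneq la0 => <- //.
  by apply/eqP; rewrite -[_ == _]negbK -has_filter; apply/hasPn => i /nseqP[->].
apply: (@eq_from_nth _ 0%N) => [|i]; rewrite size_map size_tuple // => hi.
rewrite (nth_map (inord 0)) ?size_tuple // -[i]/(val (Ordinal hi)) -tnth_nth.
rewrite tnth_mktuple /= inordK // ltnS nth_cat; case: ifP => // _.
by rewrite nth_nseq; case: ifP.
Qed.

Fixpoint schur_coef k (la : intpart) (f : symfun) : int :=
  if k is k'.+1 then
    part_coef la f -
    \sum_(mu <- parts_of_size (sumn la) |
            (sumn mu == sumn la) && (part_weight mu < part_weight la)%N)
      part_coef la (schur mu) * schur_coef k' mu f
  else 0.

Lemma schur_coefD k la f g :
  schur_coef k la (f + g) = schur_coef k la f + schur_coef k la g.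
Proof.
elim: k la => [|k IH] la /=; first by rewrite addr0.
rewrite part_coefD addrACA -opprD -big_split /=; congr (_ - _).
by apply: eq_bigr => mu _; rewrite IH mulrDr.
Qed.

Lemma schur_coef_schur k (la nu : intpart) : (part_weight la < k)%N ->
  schur_coef k la (schur nu) = (la == nu)%:R.
Proof.
elim: k la => // k IH la; rewrite ltnS => hk /=.
rewrite [X in _ - X](_ : _ = \sum_(mu <- parts_of_size (sumn la) |
    (sumn mu == sumn la) && (part_weight mu < part_weight la)%N)
    part_coef la (schur mu) * (mu == nu)%:R); last first.
  by apply: eq_bigr => mu /andP[_ hmu]; rewrite IH // (leq_trans hmu).
have [h|h] := boolP ((sumn nu == sumn la) && (part_weight nu < part_weight la)%N).
  have hin : nu \in parts_of_size (sumn la).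
    by case/andP: h => /eqP <- _; apply: mem_parts_of_size.
  rewrite big_mkcond (bigD1_seq nu) ?undup_uniq //=.
  rewrite h eqxx mulr1 big1 ?addr0 ?subrr => [|mu /negPf ->]; last first.
    by rewrite mulr0; case: ifP.
  by case: (la =P nu) h => // ->; rewrite ltnn andbF.
rewrite big1 ?subr0 => [|mu hmu]; last first.
  by case: (mu =P nu) hmu => [->|_]; rewrite ?mulr0 // (negPf h).
have [->|ne] := eqVneq la nu; first exact: kostka_diag.
by rewrite kostka_offdiag // eq_sym.
Qed.

Definition deg_lt (f : symfun) d := forall n, (msize (trunc f n) <= d)%N.

Lemma deg_ltP f : exists d, deg_lt f d.
Proof. by have [_ _] := symfunP f. Qed.

Lemma schur_coef_big k (la : intpart) f d : deg_lt f d -> (d <= sumn la)%N ->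
  schur_coef k la f = 0.
Proof.
move=> fd; elim: k la => // k IH la hd /=.
rewrite /part_coef memN_msupp_eq0 ?sub0r; last first.
  apply: msize_mdeg_ge; apply: leq_trans (fd _) _; apply: leq_trans hd _.
  rewrite mdegE sumn_nth; apply: eq_leq; apply: eq_bigr => i _.
  by rewrite mnmE.
rewrite big1 ?oppr0 // => mu /andP[/eqP e _].
by rewrite IH ?mulr0 // e.
Qed.

Definition schur_coord (la : intpart) := schur_coef (part_weight la).+1 la.

Definition hall_sum d f g : int :=
  \sum_(i < d) \sum_(la <- parts_of_size i | sumn la == i)
    schur_coord la f * schur_coord la g.

Lemma hall_sum_stable f g d d' : deg_lt f d -> deg_lt f d' ->
  hall_sum d f g = hall_sum d' f g.
Proof.
have H d1 k : deg_lt f d1 -> hall_sum (d1 + k) f g = hall_sum d1 f g.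
  move=> fd; elim: k => [|k IH]; first by rewrite addn0.
  rewrite addnS /hall_sum big_ord_recr /= -/(hall_sum _ _ _) IH big1 ?addr0 //.
  move=> la /eqP e; rewrite /schur_coord (schur_coef_big _ fd) ?mul0r //.
  by rewrite e leq_addr.
by move=> h h'; rewrite -(H d d') // addnC H.
Qed.

Lemma hall_exists : exists form, orthonormal_form schur form.
Proof.
pose deg f := sval (cid (deg_ltP f)).
have degP f : deg_lt f (deg f) by rewrite /deg; case: cid.
pose form f g := hall_sum (deg f) f g.
exists form; split; first split=> [f f' g|f g g'].
- have lt1 : deg_lt f (maxn (deg f) (deg f')).
    by move=> n; rewrite leq_max degP.
  have lt2 : deg_lt f' (maxn (deg f) (deg f')).
    by move=> n; rewrite leq_max degP orbT.
  have lt3 : deg_lt (f + f') (maxn (deg f) (deg f')).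
    move=> n; apply: leq_trans (msizeD_le _ _) _.
    by rewrite geq_max lt1 lt2.
  rewrite /form (hall_sum_stable g (degP (f + f')) lt3).
  rewrite (hall_sum_stable g (degP f) lt1) (hall_sum_stable g (degP f') lt2).
  rewrite -big_split /=; apply: eq_bigr => i _; rewrite -big_split /=.
  by apply: eq_bigr => la _; rewrite /schur_coord schur_coefD mulrDl.
- rewrite /form /hall_sum -big_split /=; apply: eq_bigr => i _.
  rewrite -big_split /=; apply: eq_bigr => la _.
  by rewrite /schur_coord schur_coefD mulrDr.
move=> la mu; have ltd : deg_lt (schur la) (deg (schur la) + (sumn la).+1).
  by move=> n; apply: leq_trans (degP _ n) (leq_addr _ _).
rewrite /form (hall_sum_stable _ (degP _) ltd).
have C nu ka : schur_coord nu (schur ka) = (nu == ka)%:R.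
  exact: schur_coef_schur.
have hla : (sumn la < deg (schur la) + (sumn la).+1)%N by lia.
rewrite /hall_sum (bigD1 (Ordinal hla)) //= big_mkcond.
rewrite (bigD1_seq la) ?undup_uniq ?mem_parts_of_size //= eqxx !C eqxx mul1r.
rewrite big1 ?addr0 => [|nu /negPf ne]; last first.
  by case: ifP => _; rewrite ?C ?ne ?mul0r.
rewrite big1 ?addr0 // => i ne; apply: big1 => nu /eqP hnu.
rewrite !C; case: eqP => [e|_]; last by rewrite mul0r.
by case/eqP: ne; apply: val_inj; rewrite /= -hnu e.
Qed.

End HallExistence.
(* Unique, as the Schur functions form a Z-basis; likewise for [hall2]. *)
Definition hall : symfun -> symfun -> int := sval (cid hall_exists).

Lemma hallP : orthonormal_form schur hall.
Proof. by rewrite /hall; case: cid. Qed.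

(* For f, g : symfun, the product f g' of f in the first factor and g in the
   second one is [tens f g] = [tens f 1 * tens 1 g]. *)
Notation symfun2 := (tensor symfun symfun).

Definition schur2 (p : intpart * intpart) : symfun2 := tens (schur p.1) (schur p.2).

Lemma hall2_exists : exists form, orthonormal_form schur2 form.
Proof.
have [[Hl Hr] Ho] := hallP.
pose phi a b := fun c d => hall a c * hall b d.
have phiB a b : biadditive (phi a b).
  by split=> *; rewrite /phi ?Hl ?Hr (mulrDl, mulrDr).
have liftB (v : symfun2) : biadditive (fun a b => tens_lift (phi a b) v).
  split=> a a' b; rewrite -(tens_sum_repr v) !tens_lift_sum // /formal_eval;
    rewrite -big_split /=; apply: eq_bigr => p _;
    by rewrite /phi (Hl, Hr) (mulrDl, mulrDr).
pose form u v := tens_lift (fun a b => tens_lift (phi a b) v) u.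
exists form; split; first split=> [u u' v|u v v'].
- exact: tens_liftD.
- rewrite /form -(tens_sum_repr u) !tens_lift_sum // /formal_eval -big_split /=.
  by apply: eq_bigr => p _; rewrite tens_liftD.
move=> [la mu] [la' mu']; rewrite /form !tens_lift_tens // /phi !Ho /=.
by rewrite xpair_eqE; do 2!case: eqP.
Qed.

Definition hall2 : symfun2 -> symfun2 -> int := sval (cid hall2_exists).

Lemma hall2P : orthonormal_form schur2 hall2.
Proof. by rewrite /hall2; case: cid. Qed.

Definition elem_prod (mu : intpart) : symfun := \prod_(k <- mu) elem k.

Definition elem2 (p : intpart * intpart) : symfun2 :=
  tens (elem_prod p.1) (elem_prod p.2).

Definition elem2_expansion (u : symfun2)
    (a : {fsfun intpart * intpart -> int with 0}) : Prop :=
  u = \sum_(p <- finsupp a) elem2 p *~ a p.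

(* The rectangle a^b: b rows of length a. *)
Definition rect (a b : nat) : intpart := part_of (nseq b a).
Arguments rect (a b)%_N.

(* Meaningful for 0 < m and m %| n; then k = n %/ m. *)
Definition pairing_g m n : int :=
  hall (schur (rect m (n - m)) * schur (rect (n - m) m))
       (schur (rect m m) ^+ (2 * (n %/ m - 1))%N).

Definition transpose (la : intpart) : intpart :=
  part_of [seq count (ltn j) la | j <- iota 0 (head 0%N la)].

(* The partitions contained in the 2 x 2 square, see sub22_uniq and mem_sub22. *)
Definition sub22 : seq intpart :=
  [seq part_of [:: i; j] | i <- iota 0 3, j <- iota 0 i.+1].

Lemma sub22_uniq : uniq sub22. Proof. by []. Qed.

Lemma part_ofE (la : intpart) (s : seq nat) : s = la -> part_of s = la.
Proof.
move=> ->; apply: part_of_perm; rewrite (all_filterP _) //.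
apply/allP => i hi; apply: contraNneq (proj2 (andP (valP la))) => <- //.
Qed.

Lemma mem_sub22 (la : intpart) :
  (la \in sub22) = (size la <= 2)%N && all (geq 2) la.
Proof.
apply/idP/idP; first by move: la; apply/allP.
move=> h; rewrite -[la](part_ofE (erefl _)).
have := valP la; case: (la : seq nat) h => [|i [|j [|//]]] //=.
- by case: i => [|[|[|]]].
by case: i j => [|[|[|?]]] [|[|[|?]]].
Qed.

(* Complement in the 2 x 2 square of a partition contained in it. *)
Definition dual22 (la : intpart) : intpart :=
  part_of [:: 2 - nth 0 la 1; 2 - nth 0 la 0]%N.

Definition kernel22 : symfun2 :=
  \sum_(la <- sub22) tens (schur la) (schur (transpose (dual22 la))).

(* Main.v *)
(** By Pieri's rule, <h_gamma, F> is the coefficient of x^gamma in F.  Since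
    s_22 = h_2^2 - h_1 h_3, this turns g(2, 2^f) into the pairing of K^N with
    s_(N,N) s'_(N,N), where N = 2^f - 2 and K is the sum in (2): both K and
    theta_2^2 - theta_1 theta_3, with theta_k the sum of the h_i e'_(k-i), are the
    image of s_22 under the coproduct followed by omega on the second factor.

    Pairing with a two-row Schur function kills the multiples of e_3, modulo which
    K has seven terms, and <e_1^i e_2^j, s_(N,N)> is 0 or the Catalan number of
    i/2.  All valuations are then expressed by v(x) = val_2(x!), which is
    superadditive with v(2x) = v(2x+1) = x + v(x) and v(2^f - 1) = 2^f - 1 - f;
    (2) follows from superadditivity for two decompositions of 2^f - 1.

    For (1), two involutions on the exponents preserve the terms, so modulo 2^f
    only their common fixed points matter; all of these vanish modulo 2^f but one,
    whose valuation is f - 1. *)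

From HB Require Import structures.
Require Import Defs.
From mathcomp Require Import all_boot all_order all_fingroup all_algebra finmap.
From mathcomp Require Import boolp mpoly zify ring.

Set Implicit Arguments.
Unset Strict Implicit.
Unset Printing Implicit Defensive.

Import GRing.Theory.
Local Open Scope ring_scope.

(** * One variable at a time, and horizontal strips *)

(** Neither the coproduct nor omega is constructed: strips are counted instead. A coefficient of
    x^gamma is computed one variable at a time, and x^k in a product s_tcol s_mu removes a
    horizontal strip of size i from the two-column shape and one of size k - i from mu. Transposed,
    the first is a vertical strip removed from a two-row shape, which is the adjoint of e_i'; the
    second is the adjoint of h_(k-i). The sum over i is theta_k.

    In (2), let 2m and 2m' be the exponents of e_1 and e_1'. The degrees in the two factors give N +
    1 = 2 c0 + c2 + c3 + c5 + (m + 1) = 2 c1 + c2 + c4 + c6 + (m' + 1), where the added 1 matches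
    the (m + 1)! under the Catalan number. Together the two lines absorb every factorial in the
    denominators.

    In (1), each involution has to gain only one factor 2, as every term is already divisible by
    2^(f-1). The surviving term involves b^2 and B^2 only; it is the central binomial coefficient of
    N, whose valuation is the number f - 1 of binary digits 1 of N/2 = 2^(f-1) - 1. *)

Section Muni.
Variable n : nat.
Implicit Types (p : {mpoly int[n.+1]}) (m : 'X_{1..n.+1}).

Lemma muniX_ord (i : 'I_n.+1) :
  muni ('X_i : {mpoly int[n.+1]}) =
  if unlift ord_max i is Some j then ('X_j)%:P else 'X.
Proof.
rewrite muniE msuppX big_seq1 mcoeffX eqxx scale1r mnmE.
case: unliftP => [j ->|->].
  rewrite eq_sym (negPf (neq_lift _ _)) expr0 alg_polyC; congr (_%:P).
  congr 'X_[_]; apply/mnmP => k; rewrite !mnmE -!val_eqE.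
  by rewrite /= /bump leqNgt ltn_ord.
rewrite eqxx expr1 [X in 'X_[X]](_ : _ = 0%MM) ?mpolyX0 ?scale1r //.
by apply/mnmP => k; rewrite !mnmE -val_eqE /= gtn_eqF.
Qed.

Definition mrestr m : 'X_{1..n} := [multinom m (widen_ord (leqnSn n) i) | i < n].

Lemma mcoeff_muni p m : p@_m = ((muni p)`_(m ord_max))@_(mrestr m).
Proof.
rewrite muniE coef_sum raddf_sum /= {1}[p]mpolyE raddf_sum /=.
apply: eq_bigr => k _; rewrite mcoeffZ mcoeffX.
rewrite coefZ coefXn mulr_natr mcoeffMn mcoeffZ mcoeffX -mulrnAr; congr (_ * _).
have -> : (k == m) = (m ord_max == k ord_max) && (mrestr k == mrestr m).
  apply/eqP/andP => [->//|[/eqP e1 /eqP/mnmP e2]].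
  apply/mnmP => i; case: (unliftP ord_max i) => [j|] ->; last by rewrite e1.
  have := e2 j; rewrite !mnmE.
  rewrite (_ : widen_ord _ _ = lift ord_max j) //.
  by apply: val_inj; rewrite /= /bump leqNgt ltn_ord.
by case: (m ord_max == _); rewrite ?andbF //= mulr0n.
Qed.

Lemma muni_inj : injective (@muni n int).
Proof. by move=> p q E; apply/mpolyP => m; rewrite !mcoeff_muni E. Qed.

End Muni.

Lemma nth_part_gt0 (la : intpart) i : (0 < nth 0 la i)%N = (i < size la)%N.
Proof.
have [h|h] := ltnP i; last by rewrite nth_default.
rewrite lt0n; apply: contraNneq (proj2 (andP (valP la))) => <-; exact: mem_nth.
Qed.

Lemma nth_part_of (s : seq nat) i :
  sorted geq s -> nth 0%N (part_of s) i = nth 0%N s i.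
Proof.
move=> ss; have gtr : transitive geq by move=> x y z /= h1 h2; apply: leq_trans h2 h1.
have E : sort geq [seq j <- s | j != 0%N] = [seq j <- s | j != 0%N].
  by apply: sorted_sort => //; apply: sorted_filter.
rewrite /= E {E}; elim: s i ss => [|x s IH] i //= ss.
have ss' := path_sorted ss; case: eqP => [x0|_] /=; last by case: i => //= i; apply: IH.
rewrite x0 in ss; have z j : nth 0%N s j = 0%N.
  have [h|h] := ltnP j (size s); last by rewrite nth_default.
  have /allP/(_ _ (mem_nth 0%N h)) := order_path_min gtr ss.
  by rewrite /= leqn0 => /eqP.
by rewrite IH // z; case: i => //= i; rewrite z.
Qed.

(** The interlacing form of: la/mu is a horizontal strip. Beyond the length of [la] the inequalities
    only say mu_i = 0, which the condition on the sizes covers. *)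
Definition hstrip (la mu : seq nat) : bool :=
  (size mu <= size la)%N &&
  all (fun i => (nth 0 la i.+1 <= nth 0 mu i <= nth 0 la i)%N) (iota 0 (size la)).

Lemma hstripP (la mu : intpart) :
  reflect (forall i, nth 0 la i.+1 <= nth 0 mu i <= nth 0 la i)%N (hstrip la mu).
Proof.
apply: (iffP andP) => [[h /allP H] i|H].
  have [hi|hi] := ltnP i (size la); first by apply: H; rewrite mem_iota.
  by rewrite (nth_default _ (leqW hi)) (nth_default _ hi) (nth_default _ (leq_trans h hi)).
split; last by apply/allP => i _; exact: H.
rewrite leqNgt -nth_part_gt0; have /andP[_] := H (size la).
by rewrite [X in (_ <= X)%N]nth_default // -leqNgt.
Qed.

Lemma sub_sumn (la mu : seq nat) :
  (forall i, nth 0 mu i <= nth 0 la i)%N -> (sumn mu <= sumn la)%N.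
Proof.
elim: mu la => [|x mu IH] [|y la] //= H.
  have := H 0%N; rewrite /= leqn0 => /eqP ->.
  by rewrite add0n; apply: (IH [::]) => i; have := H i.+1; rewrite /= nth_nil.
apply: leq_add; [exact: (H 0%N) | apply: IH => i; exact: (H i.+1)].
Qed.

Lemma hstrip_sub (la mu : intpart) i : hstrip la mu -> (nth 0 mu i <= nth 0 la i)%N.
Proof. by move/hstripP/(_ i)/andP => []. Qed.

Lemma hstrip_sumn (la mu : intpart) : hstrip la mu -> (sumn mu <= sumn la)%N.
Proof. by move=> h; apply: sub_sumn => i; apply: hstrip_sub. Qed.

(** [parts_of_size i] contains all partitions of i but also partitions of other sizes, so the
    concatenated lists overlap; hence [undup]. *)
Definition hsubs (la : intpart) : seq intpart :=
  undup [seq mu : intpart <- flatten [seq parts_of_size i | i <- iota 0 (sumn la).+1] | hstrip la mu].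

Definition hsups k (mu : intpart) : seq intpart :=
  [seq la : intpart <- parts_of_size (sumn mu + k) | (sumn la == sumn mu + k)%N && hstrip la mu].

Lemma mem_hsubs la mu : (mu \in hsubs la) = hstrip la mu.
Proof.
rewrite mem_undup mem_filter andb_idr // => /hstrip_sumn h.
apply/flattenP; exists (parts_of_size (sumn mu)); last exact: mem_parts_of_size.
by apply/mapP; exists (sumn mu); rewrite // mem_iota.
Qed.

Lemma mem_hsups k la mu :
  (la \in hsups k mu) = (sumn la == sumn mu + k)%N && hstrip la mu.
Proof.
rewrite mem_filter andb_idr // => /andP[/eqP <- _]; exact: mem_parts_of_size.
Qed.

Lemma hsubs_uniq la : uniq (hsubs la). Proof. exact: undup_uniq. Qed.
Lemma hsups_uniq k mu : uniq (hsups k mu).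
Proof. by rewrite filter_uniq // undup_uniq. Qed.

(** * Branching rule *)

Section Branching.
Variables (la : intpart) (n : nat).

(* The shape formed by the cells with an entry other than the last value. *)
Definition tab_shape (T : {ffun cell la -> 'I_n.+1}) : intpart :=
  part_of [seq row_count T r n | r <- iota 0 (size la)].

Lemma nth_tab_shape T r :
  semistandard T -> nth 0%N (tab_shape T) r = row_count T r n.
Proof.
move=> ss; have E i : nth 0%N [seq row_count T r n | r <- iota 0 (size la)] i = row_count T i n.
  have [h|h] := ltnP i (size la).
    by rewrite (nth_map 0%N) ?size_iota // nth_iota.
  rewrite nth_default ?size_map ?size_iota //; apply/esym/eqP.
  by rewrite -leqn0 (leq_trans (row_count_le _ _ _)) // nth_default.
rewrite nth_part_of ?E //; apply/(sortedP 0%N) => i _; rewrite !E /=.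
exact: leq_trans (row_count_mono T _ (leqnSn n)) (row_count_lt ss n (ltnSn i)).
Qed.

(** Columns increase strictly, so the last value occurs at most once in each. In terms of counts:
    all entries of row i + 1 are less than n + 1, and [row_count_lt] bounds their number by that of
    the entries less than n in row i. *)
Lemma tab_shape_hstrip T : semistandard T -> hstrip la (tab_shape T).
Proof.
move=> ss; apply/hstripP => i; rewrite nth_tab_shape // row_count_le andbT.
rewrite -[leqLHS](row_countE (T := T) (v := n.+1) (leqnn _)); first exact: row_count_lt.
by move=> c <-; rewrite ltn_ord ccolP.
Qed.

Section FixedShape.
Variable mu : intpart.
Hypothesis hmu : hstrip la mu.

Lemma cell_incl_subproof (d : cell mu) :
  exists c : cell la, crow c = crow d /\ ccol c = ccol d.
Proof. by apply: mkcellP; apply: leq_trans (ccolP d) (hstrip_sub _ hmu). Qed.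

(** Cells of [mu] and of [la] are pairs of ordinals with different bounds, so the inclusion of
    diagrams is chosen as a cell with the same coordinates. *)
Definition cell_incl d := sval (cid (cell_incl_subproof d)).

Lemma crow_incl d : crow (cell_incl d) = crow d.
Proof. by rewrite /cell_incl; case: cid => c []. Qed.
Lemma ccol_incl d : ccol (cell_incl d) = ccol d.
Proof. by rewrite /cell_incl; case: cid => c []. Qed.

Lemma cell_incl_inj : injective cell_incl.
Proof.
move=> c d E; apply: cell_eq.
  by rewrite -crow_incl E crow_incl.
by rewrite -ccol_incl E ccol_incl.
Qed.

Definition cell_ret c : option (cell mu) := [pick d | cell_incl d == c].

Lemma cell_inclK d : cell_ret (cell_incl d) = Some d.
Proof.
rewrite /cell_ret; case: pickP => [d' /eqP/cell_incl_inj -> //|/(_ d)].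
by rewrite eqxx.
Qed.

Variant cell_ret_spec c : bool -> option (cell mu) -> Prop :=
| CellIn d of cell_incl d = c : cell_ret_spec c true (Some d)
| CellOut of (nth 0%N mu (crow c) <= ccol c)%N : cell_ret_spec c false None.

Lemma cell_retP c : cell_ret_spec c (ccol c < nth 0 mu (crow c))%N (cell_ret c).
Proof.
have [h|h] := ltnP.
  have [d [dr dc]] := mkcellP h.
  have -> : c = cell_incl d by apply: cell_eq; rewrite ?crow_incl ?ccol_incl.
  by rewrite cell_inclK; constructor.
rewrite /cell_ret; case: pickP => [d /eqP E|_]; last by constructor.
by move: h; rewrite -E crow_incl ccol_incl leqNgt ccolP.
Qed.

Definition tab_ext (T : {ffun cell mu -> 'I_n}) : {ffun cell la -> 'I_n.+1} :=
  [ffun c => if cell_ret c is Some d then lift ord_max (T d) else ord_max].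

Lemma lift_maxE (i : 'I_n) : lift ord_max i = i :> nat.
Proof. by rewrite /= /bump leqNgt ltn_ord. Qed.

Lemma tab_ext_incl T d : tab_ext T (cell_incl d) = lift ord_max (T d).
Proof. by rewrite ffunE cell_inclK. Qed.

Lemma tab_ext_inj : injective tab_ext.
Proof.
move=> T1 T2 E; apply/ffunP => d; apply: (lift_inj (h := ord_max)).
by rewrite -!tab_ext_incl E.
Qed.

Lemma tab_ext_lt T c : (tab_ext T c < n)%N = (ccol c < nth 0 mu (crow c))%N.
Proof.
by rewrite ffunE; case: cell_retP => [d _|_]; rewrite ?lift_maxE ?ltn_ord //= ltnn.
Qed.

Lemma tab_ext_semistandard T : semistandard T -> semistandard (tab_ext T).
Proof.
move=> /semistandardP ss; apply/semistandardP => c d; rewrite !ffunE.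
case: (cell_retP d) => [d' <-|hd]; case: (cell_retP c) => [c' <-|hc].
- rewrite !lift_maxE !crow_incl !ccol_incl; exact: ss.
- split=> [er ec|ec er].
    by have := ccolP d'; rewrite ltnNge -crow_incl -ccol_incl -er (leq_trans hc).
  have := ccolP d'; rewrite ltnNge -crow_incl -ccol_incl -ec (leq_trans _ hc) //.
  exact: parts_anti (ltnW er).
- by rewrite !lift_maxE /=; split=> _ _; rewrite ?ltn_ord // ltnW.
(* Both cells lie in la/mu and in one column, c above d. With r the row of c, that column is less
   than la_(r+1) <= mu_r, so c would lie in mu. *)
split=> // ec er; have := ccolP d; rewrite ltnNge -ec (leq_trans _ hc) //.
have /hstripP/(_ (crow c))/andP[h _] := hmu.
exact: leq_trans (parts_anti la er) h.
Qed.

Lemma tab_ext_shape T : semistandard T -> tab_shape (tab_ext T) = mu.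
Proof.
move=> ss; apply: intpart_eq => r; rewrite nth_tab_shape ?tab_ext_semistandard //.
by apply: row_countE => [|c <-]; [apply: hstrip_sub | rewrite tab_ext_lt].
Qed.

Lemma tab_ext_surj (T : {ffun cell la -> 'I_n.+1}) :
  semistandard T -> tab_shape T = mu -> exists2 T', semistandard T' & T = tab_ext T'.
Proof.
move=> ss E.
have Tlt c : (T c < n)%N = (ccol c < nth 0 mu (crow c))%N.
  by rewrite row_countP // -E nth_tab_shape.
have [d|T0 hT0] := @fin_all_exists _ _ (fun d j => T (cell_incl d) = lift ord_max j).
  have := Tlt (cell_incl d); rewrite crow_incl ccol_incl ccolP.
  case: (unliftP ord_max (T (cell_incl d))) => [j ->|->]; last by rewrite /= ltnn.
  by exists j.
have ET : T = tab_ext (finfun T0).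
  apply/ffunP => c; rewrite ffunE; have := Tlt c.
  case: cell_retP => [d <- _|_ /negbT]; first by rewrite hT0 ffunE.
  by rewrite -leqNgt => h; apply: val_inj; apply/eqP; rewrite eqn_leq h -ltnS ltn_ord.
exists (finfun T0) => //; apply/semistandardP => c d; rewrite -!lift_maxE -!tab_ext_incl -ET.
have /semistandardP/(_ (cell_incl c) (cell_incl d)) := ss.
by rewrite !crow_incl !ccol_incl.
Qed.

Lemma tab_ext_prod T :
  \prod_c muni ('X_(tab_ext T c) : {mpoly int[n.+1]}) =
  (\prod_d 'X_(T d) : {mpoly int[n]})%:P * 'X^(sumn la - sumn mu).
Proof.
pose ret c : bool := isSome (cell_ret c).
rewrite (bigID ret) /=; congr (_ * _).
  rewrite (reindex_omap cell_incl cell_ret) /=; last first.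
    by move=> c; rewrite /ret; case: cell_retP => //= d ->.
  rewrite rmorph_prod /=; apply: eq_big => [d|d _].
    by rewrite /ret cell_inclK /= eqxx.
  by rewrite tab_ext_incl muniX_ord liftK.
rewrite (eq_bigr (fun _ => 'X)) => [|c]; last first.
  by rewrite muniX_ord /ret ffunE; case: (cell_ret c) => //; rewrite unlift_none.
rewrite prodr_const; congr ('X ^+ _).
rewrite -!card_cell -[#|{: cell la}|](cardC ret) -addnBAC; last first.
  rewrite -(card_imset _ cell_incl_inj); apply: subset_leq_card; apply/subsetP => c.
  by case/imsetP => d _ ->; rewrite unfold_in /ret cell_inclK.
rewrite (_ : #|ret| = #|{: cell mu}|) ?subnn ?add0n //.
rewrite -cardsT -(card_imset _ cell_incl_inj); apply: eq_card => c.
rewrite [in LHS]unfold_in /ret; apply/idP/imsetP => [|[d _ ->]]; last by rewrite cell_inclK.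
by case: cell_retP => // d <- _; exists d.
Qed.

Lemma tab_sum_shape :
  \sum_(T : {ffun cell la -> 'I_n.+1} | semistandard T && (tab_shape T == mu))
    \prod_c muni 'X_(T c) =
  (schur_pol mu n)%:P * 'X^(sumn la - sumn mu) :> {poly {mpoly int[n]}}.
Proof.
rewrite /schur_pol raddf_sum mulr_suml.
rewrite (eq_bigl (mem (tab_ext @: [set T | semistandard T]))) => [|T]; last first.
  apply/andP/imsetP => [[ss /eqP E]|[T' + ->]].
    by have [T' ss' ->] := tab_ext_surj ss E; exists T'; rewrite ?inE.
  by rewrite inE => ss; rewrite tab_ext_semistandard ?tab_ext_shape.
rewrite big_imset /=; last by move=> ? ? _ _; apply: tab_ext_inj.
by apply: eq_big => [T|T _]; [rewrite inE | rewrite tab_ext_prod].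
Qed.

End FixedShape.

(** Tableaux are sorted by the shape of their entries other than the last value; the last variable
    then occurs once for each cell of the remaining strip. *)
Lemma schur_branch :
  muni (schur_pol la n.+1) =
  \sum_(mu <- hsubs la) (schur_pol mu n)%:P * 'X^(sumn la - sumn mu).
Proof.
rewrite raddf_sum /=; under eq_bigr => T _ do rewrite rmorph_prod.
have hs (mu : intpart) : mu \in hsubs la -> hstrip la mu by rewrite mem_hsubs.
rewrite [RHS]big_seq; under [RHS]eq_bigr => mu hmu do rewrite -(tab_sum_shape (hs mu hmu)).
rewrite -big_seq (exchange_big_dep (fun T => semistandard T)) /=; last by move=> mu T _ /andP[].
apply: eq_bigr => T ss; rewrite ss /= (big_rem (tab_shape T)) /= ?mem_hsubs ?tab_shape_hstrip //.
rewrite eqxx [X in _ + X]big_seq_cond [X in _ + X]big1 ?addr0 // => mu /andP[].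
by rewrite mem_rem_uniq ?hsubs_uniq // !inE eq_sym => /andP[/negPf ->].
Qed.

End Branching.

Lemma schur_branch_coef la n j :
  (muni (schur_pol la n.+1))`_j =
  \sum_(mu <- hsubs la | (sumn mu + j == sumn la)%N) schur_pol mu n.
Proof.
rewrite schur_branch coef_sum [RHS]big_mkcond /=; apply: eq_big_seq => mu.
rewrite mem_hsubs => /hstrip_sumn h; rewrite coefCM coefXn mulr_natr.
have -> : (j == sumn la - sumn mu)%N = (sumn mu + j == sumn la)%N by apply/eqP/eqP; lia.
by case: eqP.
Qed.

(** * Pieri's rule *)

Lemma sumn_nth_widen (s : seq nat) L : (size s <= L)%N ->
  sumn s = (\sum_(i < L) nth 0 s i)%N.
Proof.
move=> h; rewrite sumn_nth -(subnKC h) big_split_ord /= [X in (_ + X)%N]big1 ?addn0 // => i _.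
by rewrite nth_default // leq_addr.
Qed.

Lemma sumn_nth_recl (s : seq nat) L : (size s <= L.+1)%N ->
  sumn s = (nth 0 s 0 + \sum_(i < L) nth 0 s i.+1)%N.
Proof. by move=> h; rewrite (sumn_nth_widen h) big_ord_recl. Qed.

Definition part_max (mu ka : seq nat) i := maxn (nth 0%N mu i) (nth 0%N ka i).
Definition part_min (mu ka : seq nat) i := minn (nth 0%N mu i) (nth 0%N ka i).

Section Toggle.
Variables (mu ka : intpart) (k j : nat).
Hypothesis size_eq : (sumn ka + j = sumn mu + k)%N.

Local Notation L := (size mu + size ka)%N.
Local Notation hi := (part_max mu ka).
Local Notation lo := (part_min mu ka).

Let hi0 i : (L <= i)%N -> hi i = 0%N.
Proof. by rewrite /part_max => h; rewrite !nth_default; lia. Qed.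
Let lo0 i : (L <= i)%N -> lo i = 0%N.
Proof. by rewrite /part_min => h; rewrite !nth_default; lia. Qed.

Let sum_hi_lo : (hi 0 + \sum_(i < L) hi i.+1 + \sum_(i < L) lo i = sumn mu + sumn ka)%N.
Proof.
rewrite (@sumn_nth_widen mu L.+1) ?(@sumn_nth_widen ka L.+1); try lia.
rewrite -(big_ord_recl L (fun i => hi i)) -big_split /=.
have -> : (\sum_(i < L) lo i = \sum_(i < L.+1) lo i)%N.
  by rewrite big_ord_recr /= lo0 ?addn0.
rewrite -!big_split; apply: eq_bigr => i _; rewrite /part_max /part_min /=; lia.
Qed.

(* Both la/mu and la/ka are horizontal strips iff [hi i.+1 <= la_(i+1) <= lo i] for
   all i and [hi 0 <= la_0]; both mu/nu and ka/nu are horizontal strips iff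
   [hi i.+1 <= nu_i <= lo i] for all i.  Reflection in these intervals exchanges
   the two conditions, and la_0 is determined by the size. *)
Definition toggle_up (nu : intpart) : intpart :=
  part_of ((hi 0 + (sumn nu + j - sumn mu))%N ::
           [seq (hi i.+1 + lo i - nth 0 nu i)%N | i <- iota 0 L]).

Definition toggle_down (la : intpart) : intpart :=
  part_of [seq (hi i.+1 + lo i - nth 0 la i.+1)%N | i <- iota 0 L].

Let nth_tog (s : seq nat) i :
  nth 0%N [seq (hi i.+1 + lo i - nth 0 s i)%N | i <- iota 0 L] i = (hi i.+1 + lo i - nth 0 s i)%N.
Proof.
have [h|h] := ltnP i L; first by rewrite (nth_map 0%N) ?size_iota ?nth_iota.
by rewrite nth_default ?size_map ?size_iota // lo0 // hi0 // leqW.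
Qed.

Section Up.
Variable nu : intpart.
Hypotheses (h1 : hstrip mu nu) (h2 : hstrip ka nu).

Let bnd i : (hi i.+1 <= nth 0 nu i <= lo i)%N.
Proof.
have /hstripP/(_ i) a := h1; have /hstripP/(_ i) b := h2.
by rewrite /part_max /part_min; lia.
Qed.

Let lohi i : (lo i <= hi i)%N. Proof. by rewrite /part_max /part_min; lia. Qed.

Lemma nth_toggle_up i : nth 0%N (toggle_up nu) i =
  if i is i'.+1 then (hi i'.+1 + lo i' - nth 0 nu i')%N
  else (hi 0 + (sumn nu + j - sumn mu))%N.
Proof.
rewrite nth_part_of; first by case: i => //= i; rewrite nth_tog.
apply/(sortedP 0%N) => -[|m] /= _; rewrite !nth_tog.
  by have := bnd 0; have := lohi 0; lia.
by have := bnd m; have := bnd m.+1; have := lohi m.+1; lia.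
Qed.

Lemma toggle_up_hstrip : hstrip (toggle_up nu) mu && hstrip (toggle_up nu) ka.
Proof.
suff H i : (nth 0 (toggle_up nu) i.+1 <= lo i)%N && (hi i <= nth 0 (toggle_up nu) i)%N.
  by apply/andP; split; apply/hstripP => i; have := H i; rewrite /part_max /part_min; lia.
rewrite !nth_toggle_up; have := bnd i; case: i => [|i'] /=; first by lia.
by have := bnd i'; lia.
Qed.

(** Reflection keeps la_(i+1) + nu_i = hi_(i+1) + lo_i, while hi_i + lo_i = mu_i + ka_i; the size
    follows by summation. The hypothesis keeps the subtraction in the first part from being
    truncated. *)
Lemma toggle_up_sumn : (sumn mu <= sumn nu + j)%N -> sumn (toggle_up nu) = (sumn mu + k)%N.
Proof.
move=> h; rewrite (@sumn_nth_recl _ L); last first.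
  rewrite leqNgt; apply/negP => h'; have := nth_part_gt0 (toggle_up nu) L.+1.
  by rewrite h' nth_toggle_up lo0 // hi0 // leqW.
rewrite [X in (X + _)%N](nth_toggle_up 0).
have hn : sumn nu = (\sum_(i < L) nth 0 nu i)%N.
  apply: sumn_nth_widen; rewrite leqNgt; apply/negP => h'.
  have := nth_part_gt0 nu L; rewrite h'; have := bnd L; rewrite lo0 //; lia.
have : (\sum_(i < L) nth 0 (toggle_up nu) i.+1 + sumn nu =
        \sum_(i < L) hi i.+1 + \sum_(i < L) lo i)%N.
  rewrite hn -!big_split; apply: eq_bigr => i _; rewrite /= nth_toggle_up.
  by have := bnd i; rewrite /=; lia.
have := sum_hi_lo; lia.
Qed.
End Up.

Section Down.
Variable la : intpart.
Hypotheses (h1 : hstrip la mu) (h2 : hstrip la ka).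

Let bnd i : (hi i.+1 <= nth 0 la i.+1 <= lo i)%N.
Proof.
have /hstripP a := h1; have /hstripP b := h2.
by have := a i; have := b i; have := a i.+1; have := b i.+1; rewrite /part_max /part_min; lia.
Qed.

Lemma nth_toggle_down i : nth 0%N (toggle_down la) i = (hi i.+1 + lo i - nth 0 la i.+1)%N.
Proof.
have E m : nth 0%N [seq (hi i.+1 + lo i - nth 0 la i.+1)%N | i <- iota 0 L] m =
           (hi m.+1 + lo m - nth 0 la m.+1)%N.
  by rewrite -nth_behead -nth_tog; congr nth; apply: eq_map => x; rewrite nth_behead.
rewrite nth_part_of ?E //; apply/(sortedP 0%N) => m _; rewrite !E /=.
by have := bnd m; have := bnd m.+1; rewrite /part_max /part_min; lia.
Qed.

Lemma toggle_down_hstrip : hstrip mu (toggle_down la) && hstrip ka (toggle_down la).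
Proof.
by apply/andP; split; apply/hstripP => i; rewrite nth_toggle_down;
  have := bnd i; rewrite /part_max /part_min; lia.
Qed.

Lemma toggle_down_sumn : sumn la = (sumn mu + k)%N -> (sumn mu <= sumn (toggle_down la) + j)%N.
Proof.
move=> h; rewrite (@sumn_nth_widen (toggle_down la) L); last first.
  rewrite leqNgt; apply/negP => h'; have := nth_part_gt0 (toggle_down la) L.
  by rewrite h' nth_toggle_down lo0 // hi0 // leqW.
have hn : sumn la = (nth 0 la 0 + \sum_(i < L) nth 0 la i.+1)%N.
  apply: sumn_nth_recl; rewrite leqNgt; apply/negP => h'.
  have := nth_part_gt0 la L.+1; rewrite h'; have := bnd L; rewrite lo0 //; lia.
have : (\sum_(i < L) nth 0 (toggle_down la) i + \sum_(i < L) nth 0 la i.+1 =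
        \sum_(i < L) hi i.+1 + \sum_(i < L) lo i)%N.
  rewrite -!big_split; apply: eq_bigr => i _; rewrite /= nth_toggle_down.
  by have := bnd i; rewrite /=; lia.
have : (hi 0 <= nth 0 la 0)%N.
  by have /hstripP/(_ 0%N) := h1; have /hstripP/(_ 0%N) := h2; rewrite /part_max; lia.
have := sum_hi_lo; lia.
Qed.
End Down.

(** Ways from mu to ka that first add a strip and then remove one match those that first remove and
    then add. The strip mu/nu may have any size up to j: in [pieri_pol] the rest of x^j comes from
    the one-row factor. *)
Lemma toggle_count :
  count (fun la : intpart => hstrip la ka) (hsups k mu) =
  count (fun nu : intpart => hstrip ka nu && (sumn mu <= sumn nu + j)%N) (hsubs mu).
Proof.
rewrite -!size_filter; apply/eqP; rewrite eqn_leq; apply/andP; split.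
  rewrite -(size_map toggle_down); apply: uniq_leq_size.
    rewrite map_inj_in_uniq; first exact: filter_uniq (hsups_uniq _ _).
    move=> la la'.
    rewrite mem_filter mem_hsups => /and3P[b /eqP s a].
    rewrite mem_filter mem_hsups => /and3P[b' /eqP s' a'] E.
    have E1 i : nth 0%N la i.+1 = nth 0%N la' i.+1.
      have := congr1 (fun x : intpart => nth 0%N x i) E.
      rewrite !nth_toggle_down //.
      have /hstripP c := a; have /hstripP d := b.
      have /hstripP c' := a'; have /hstripP d' := b'.
      have := c i; have := d i; have := c' i; have := d' i.
      have := c i.+1; have := d i.+1; have := c' i.+1; have := d' i.+1.
      by rewrite /part_max /part_min; lia.
    (* [toggle_down] forgets the first part, which the size |mu| + k recovers. *)
    apply: intpart_eq => -[|i]; last exact: E1.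
    move: s s'; set R := (size la + size la')%N.
    rewrite (@sumn_nth_recl la R) ?(@sumn_nth_recl la' R) /R; try lia.
    by under eq_bigr => i _ do rewrite E1; move=> <- /addIn.
  move=> nu /mapP[la + ->]; rewrite mem_filter mem_hsups => /and3P[b /eqP s a].
  rewrite mem_filter mem_hsubs.
  by have /andP[-> ->] := toggle_down_hstrip a b; rewrite toggle_down_sumn.
rewrite -(size_map toggle_up); apply: uniq_leq_size.
  rewrite map_inj_in_uniq; first exact: filter_uniq (hsubs_uniq _).
  move=> nu nu'.
  rewrite mem_filter mem_hsubs => /andP[/andP[b s] a].
  rewrite mem_filter mem_hsubs => /andP[/andP[b' s'] a'] E.
  apply: intpart_eq => i; have := congr1 (fun x : intpart => nth 0%N x i.+1) E.
  rewrite !nth_toggle_up //.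
  have /hstripP/(_ i) := a; have /hstripP/(_ i) := b.
  have /hstripP/(_ i) := a'; have /hstripP/(_ i) := b'.
  by rewrite /part_max /part_min; lia.
move=> la /mapP[nu + ->]; rewrite mem_filter mem_hsubs => /andP[/andP[b s] a].
rewrite mem_filter mem_hsups.
by have /andP[-> ->] := toggle_up_hstrip a b; rewrite toggle_up_sumn ?eqxx.
Qed.

End Toggle.

Definition srow k : intpart := part_of [:: k].

Lemma nth_srow k i : nth 0%N (srow k) i = if i is 0%N then k else 0%N.
Proof. by rewrite nth_part_of; case: i => //= i; rewrite nth_nil. Qed.

Lemma sumn_srow k : sumn (srow k) = k.
Proof. by rewrite (sumn_nth_recl (L := 0)) ?big_ord0 ?nth_srow ?addn0 //=; case: k. Qed.

Lemma hstrip_srow k (nu : intpart) :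
  hstrip (srow k) nu = (nu == srow (sumn nu)) && (sumn nu <= k)%N.
Proof.
apply/idP/andP => [h|[/eqP E le]].
  have E : nu = srow (nth 0%N nu 0).
    apply: intpart_eq => -[|i]; rewrite nth_srow //; apply/eqP.
    by rewrite -leqn0 (leq_trans (hstrip_sub _ h)) ?nth_srow.
  have S : sumn nu = nth 0%N nu 0 by rewrite [in LHS]E sumn_srow.
  by rewrite S -E eqxx -S -[k]sumn_srow hstrip_sumn.
by apply/hstripP => i; rewrite E !nth_srow; case: i => //=; rewrite andbT.
Qed.

Lemma big_uniq_seq (T : eqType) (R : nmodType) (s t : seq T) (P : pred T) (F : T -> R) :
  uniq s -> uniq t -> (forall x, (x \in t) = (x \in s) && P x) ->
  \sum_(x <- s | P x) F x = \sum_(x <- t) F x.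
Proof.
move=> us ut E; rewrite -big_filter; apply: perm_big; apply: uniq_perm => //.
  exact: filter_uniq.
by move=> x; rewrite mem_filter E andbC.
Qed.

Lemma schur_row_coef k n j :
  (muni (schur_pol (srow k) n.+1))`_j =
  if (j <= k)%N then schur_pol (srow (k - j)%N) n else 0.
Proof.
rewrite schur_branch_coef sumn_srow.
rewrite (big_uniq_seq (t := if (j <= k)%N then [:: srow (k - j)%N] else [::])) ?hsubs_uniq //.
- by case: ifP => _; rewrite ?big_seq1 ?big_nil.
- by case: ifP.
move=> nu; rewrite mem_hsubs hstrip_srow; case: leqP => h; rewrite ?inE.
  apply/eqP/andP => [->|[/andP[/eqP E _] /eqP e]].
    by rewrite sumn_srow eqxx leq_subr subnK.
  by rewrite E -e addnK.
by apply/esym/negP => /andP[/andP[_ le] /eqP e]; lia.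
Qed.

Lemma schur_pol_nil n : schur_pol (part_of [::]) n = 1.
Proof.
have C (c : cell (part_of [::])) : False by case: c => [[[]]].
rewrite /schur_pol (big_pred1 [ffun c => match C c with end]) => [|T].
  by apply: big1 => c; case: (C c).
rewrite /=; have -> : T == [ffun c => match C c with end].
  by apply/eqP/ffunP => c; case: (C c).
by apply/semistandardP => c; case: (C c).
Qed.

Lemma sumn_eq0 (la : intpart) : (sumn la == 0)%N = (la == part_of [::]).
Proof.
apply/eqP/eqP => [e|->] //.
apply: intpart_eq => i; rewrite nth_nil; apply/eqP; rewrite -leqn0.
apply: leq_trans (_ : sumn la <= _)%N; last by rewrite e.
have [h|h] := ltnP i (size la); last by rewrite nth_default.
by rewrite sumnE (big_rem (nth 0%N la i)) ?mem_nth //= leq_addr.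
Qed.

Lemma schur_pol0 (la : intpart) : schur_pol la 0 = (sumn la == 0)%N%:R.
Proof.
case: eqP => [/eqP|/eqP]; first by rewrite sumn_eq0 => /eqP ->; apply: schur_pol_nil.
rewrite -lt0n -card_cell => /card_gt0P[c _].
by apply: big1 => T; case: (T c).
Qed.

Lemma hsups0 k (mu : intpart) : (sumn mu + k == 0)%N -> hsups k mu =i [:: part_of [::]].
Proof.
rewrite addn_eq0 sumn_eq0 => /andP[/eqP -> /eqP ->] la.
by rewrite mem_hsups inE sumn_eq0; case: eqP => // ->.
Qed.

(** Induction on the number of variables, comparing coefficients of x^j for the last variable x. By
    branching, and by induction on the left, both sides become sums of s_ka over |ka| + j = |mu| +
    k, and [toggle_count] identifies the multiplicities. *)
Lemma pieri_pol n k (mu : intpart) :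
  schur_pol (srow k) n * schur_pol mu n = \sum_(la <- hsups k mu) schur_pol la n.
Proof.
elim: n k mu => [|n IH] k mu.
  rewrite !schur_pol0 sumn_srow -natrM mulnb andbC -addn_eq0.
  have [e|ne] := boolP (_ == _).
    rewrite (big_uniq_seq (P := xpredT) (t := [:: part_of [::]])) ?hsups_uniq ?big_seq1 // => [|la].
      by rewrite schur_pol0.
    by rewrite andbT hsups0.
  rewrite big_seq big1 // => la; rewrite mem_hsups => /andP[/eqP e _].
  by rewrite schur_pol0 e (negPf ne).
apply: muni_inj; apply/polyP => j; rewrite muniM coefM.
have -> : muni (\sum_(la <- hsups k mu) schur_pol la n.+1) =
          \sum_(la <- hsups k mu) muni (schur_pol la n.+1) by apply: raddf_sum.
rewrite [RHS]coef_sum.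
pose U := [seq ka : intpart <- parts_of_size (sumn mu + k - j)%N | (sumn ka + j == sumn mu + k)%N].
have memU (ka : intpart) : (ka \in U) = (sumn ka + j == sumn mu + k)%N.
  by rewrite mem_filter andb_idr // => /eqP <-; rewrite addnK mem_parts_of_size.
have uU : uniq U by rewrite filter_uniq ?undup_uniq.
clearbody U.
transitivity (\sum_(ka <- U) schur_pol ka n *+
   count (fun nu : intpart => hstrip ka nu && (sumn mu <= sumn nu + j)%N) (hsubs mu)).
  have E (i : 'I_j.+1) : (muni (schur_pol (srow k) n.+1))`_i * (muni (schur_pol mu n.+1))`_(j - i)%N =
      \sum_(nu <- hsubs mu | (sumn nu + (j - i) == sumn mu)%N && (i <= k)%N)
        \sum_(ka <- U | hstrip ka nu) schur_pol ka n.
    have -> := congr2 *%R (schur_row_coef k n i) (schur_branch_coef mu n (j - i)).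
    case: leqP => [ik|_]; last first.
      by rewrite mul0r big_pred0 // => nu; rewrite andbF.
    rewrite mulr_sumr; apply: eq_big => [nu|nu /eqP e]; first by rewrite andbT.
    rewrite IH -[RHS]big_filter -[LHS]big_filter filter_predT.
    apply: perm_big; apply: uniq_perm; rewrite ?hsups_uniq ?filter_uniq // => ka.
    rewrite [RHS]mem_filter memU mem_hsups andbC; congr (_ && _).
    by have := ltn_ord i; rewrite ltnS => ij; apply/eqP/eqP; lia.
  etransitivity; first by apply: eq_bigr => i _; exact: E.
  rewrite (exchange_big_dep xpredT) //=.
  have E2 nu : nu \in hsubs mu ->
      \sum_(i < j.+1 | (sumn nu + (j - i) == sumn mu)%N && (i <= k)%N)
        \sum_(ka <- U | hstrip ka nu) schur_pol ka n =
      \sum_(ka <- U | hstrip ka nu && (sumn mu <= sumn nu + j)%N) schur_pol ka n.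
    rewrite mem_hsubs => /hstrip_sumn hs; case: leqP => h; last first.
      by rewrite big_pred0 ?big_pred0 // => [ka|i]; [rewrite andbF | apply/negP => /andP[/eqP e _]; lia].
    have hi : (j - (sumn mu - sumn nu) < j.+1)%N by rewrite ltnS leq_subr.
    under [RHS]eq_bigl => ka do rewrite andbT.
    have [ik|ik] := leqP (j - (sumn mu - sumn nu)) k.
      rewrite (big_pred1 (Ordinal hi)) // => i.
      have := ltn_ord i; rewrite ltnS => ij.
      apply/andP/eqP => [[/eqP e _]|-> /=]; first by apply: val_inj => /=; lia.
      by split=> //; apply/eqP; lia.
    rewrite [LHS]big_pred0 => [|i]; last first.
      by have := ltn_ord i; rewrite ltnS => ij; apply/negP => /andP[/eqP e ik']; lia.
    (* Here that i exceeds k, so |ka| = |mu| + k - j < |nu| and ka/nu is no strip. *)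
    rewrite big_seq_cond big_pred0 // => ka; rewrite memU; apply/negP => /andP[/eqP e /hstrip_sumn].
    lia.
  rewrite (eq_big_seq _ E2) (exchange_big_dep xpredT) //=.
  by apply: eq_bigr => ka _; rewrite big_const_seq iter_addr_0.
transitivity (\sum_(ka <- U) schur_pol ka n *+ count (fun la : intpart => hstrip la ka) (hsups k mu)).
  by apply: eq_big_seq => ka; rewrite memU => /eqP e; rewrite (toggle_count e).
have E (la : intpart) : la \in hsups k mu ->
    (muni (schur_pol la n.+1))`_j = \sum_(ka <- U | hstrip la ka) schur_pol ka n.
  rewrite mem_hsups => /andP[/eqP e _]; rewrite schur_branch_coef -[RHS]big_filter.
  apply: big_uniq_seq; rewrite ?hsubs_uniq ?filter_uniq // => ka.
  by rewrite mem_filter memU mem_hsubs e.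
rewrite [RHS](eq_big_seq _ E) (exchange_big_dep xpredT) //=.
by apply: eq_bigr => ka _; rewrite big_const_seq iter_addr_0.
Qed.

(** * The pairing and coefficients of monomials *)

Lemma trunc_sum (I : Type) (r : seq I) (P : pred I) (F : I -> symfun) n :
  trunc (\sum_(i <- r | P i) F i) n = \sum_(i <- r | P i) trunc (F i) n.
Proof. exact: (big_morph (fun f => trunc f n)). Qed.

Lemma trunc_prod (I : Type) (r : seq I) (P : pred I) (F : I -> symfun) n :
  trunc (\prod_(i <- r | P i) F i) n = \prod_(i <- r | P i) trunc (F i) n.
Proof. exact: (big_morph (fun f => trunc f n)). Qed.

Definition hsym k : symfun := schur (srow k).

Lemma pieri k mu : hsym k * schur mu = \sum_(la <- hsups k mu) schur la.
Proof. by apply: symfun_eq => n; rewrite trunc_sum -pieri_pol. Qed.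

Lemma schur_nil : schur (part_of [::]) = 1.
Proof. by apply: symfun_eq => n; apply: schur_pol_nil. Qed.

Lemma hsym0 : hsym 0 = 1.
Proof. by rewrite -schur_nil /hsym; congr schur; apply: val_inj. Qed.

(** * Schur functions span *)

Section Span.

Lemma muni_coef0 n (p : {mpoly int[n.+1]}) : (muni p)`_0 = p \mPo restrict_vars n.
Proof.
rewrite -horner_coef0 [p]mpolyE !raddf_sum /= horner_sum; apply: eq_bigr => m _.
rewrite muniZ hornerZ comp_mpolyZ comp_mpolyX mul_mpolyC; congr (_ *: _).
rewrite mpolyXE_id rmorph_prod /= horner_prod; apply: eq_bigr => i _.
rewrite rmorphXn /= muniX_ord tnth_mktuple horner_exp.
by case: unliftP => [j _|_]; rewrite ?hornerC ?hornerX.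
Qed.

(** If f vanishes in n variables but not in n + 1, its leading monomial in n + 1 variables has
    weakly decreasing exponents, the last one positive because setting the last variable to 0 gives
    0. So they form a partition with exactly n + 1 parts, the number of variables in which
    [part_coef] evaluates f. *)
Lemma symfun_coef_eq0 f : (forall la, part_coef la f = 0) -> f = 0.
Proof.
move=> H; have [fS fC _] := symfunP f.
apply: symfun_eq => n /=; elim: n => [|n IH].
  apply/mpolyP => m; rewrite mcoeff0 -[RHS](H (part_of [::])).
  rewrite /part_coef /=; congr (mcoeff _ _); by apply/mnmP => -[].
apply/eqP; apply/negPn/negP => nz; set p := trunc f n.+1 in nz.
pose m := mlead p; have m_sorted := mlead_msym_sorted (fS n.+1).
have mp : p@_m != 0 by rewrite mleadc_eq0.
have m_last : m ord_max != 0%N.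
  apply: contraNneq mp => e; rewrite mcoeff_muni e muni_coef0 /p fC IH.
  by rewrite mcoeff0.
have m_nth (i : nat) (hi : (i < n.+1)%N) : nth 0%N m i = m (Ordinal hi).
  by rewrite (mnm_nth 0%N).
have m_part : is_partition m.
  apply/andP; split.
    apply/(sortedP 0%N) => i; rewrite size_tuple => hi.
    by rewrite (m_nth _ hi) (m_nth _ (ltnW hi)); apply: m_sorted => /=.
  apply/negP => /(nthP 0%N)[i]; rewrite size_tuple => hi; rewrite (m_nth _ hi) => e.
  have := m_sorted (Ordinal hi) ord_max; rewrite -/p -/m e leqn0 (negPf m_last).
  by rewrite /= -ltnS hi => /(_ isT).
have := H (IntPart m_part); rewrite /part_coef /= size_tuple => e.
case/eqP: mp; rewrite -e /p; congr (mcoeff _ _).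
by apply/mnmP => i; rewrite mnmE (mnm_nth 0%N).
Qed.

Lemma schur_coef_stable k k' (la : intpart) f :
  (part_weight la < k)%N -> (part_weight la < k')%N ->
  schur_coef k la f = schur_coef k' la f.
Proof.
elim: k k' la => [|k IH] [|k'] la //=; rewrite !ltnS => h h'.
by congr (_ - _); apply: eq_bigr => mu /andP[_ hm]; congr (_ * _); apply: IH; lia.
Qed.

Lemma schur_coord_eq0 f : (forall la, schur_coord la f = 0) -> f = 0.
Proof.
move=> H; apply: symfun_coef_eq0 => la; have := H la.
rewrite /schur_coord /= big1 ?subr0 // => mu /andP[_ hm].
rewrite (@schur_coef_stable _ (part_weight mu).+1) //.
by rewrite -/(schur_coord mu f) H mulr0.
Qed.

Lemma schur_coordD la f g : schur_coord la (f + g) = schur_coord la f + schur_coord la g.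
Proof. exact: schur_coefD. Qed.

End Span.

Section AdditiveFun.
Variables (U V : zmodType) (phi : U -> V).
Hypothesis phiD : forall u v, phi (u + v) = phi u + phi v.

Lemma addf0 : phi 0 = 0.
Proof. by apply: (addrI (phi 0)); rewrite -phiD !addr0. Qed.

Lemma addfN u : phi (- u) = - phi u.
Proof. by apply: (addrI (phi u)); rewrite -phiD !subrr addf0. Qed.

Lemma addfB u v : phi (u - v) = phi u - phi v.
Proof. by rewrite phiD addfN. Qed.

Lemma addf_sum (I : Type) (r : seq I) (P : pred I) (F : I -> U) :
  phi (\sum_(i <- r | P i) F i) = \sum_(i <- r | P i) phi (F i).
Proof. exact: (big_morph phi phiD addf0). Qed.

Lemma addfMn u n : phi (u *+ n) = phi u *+ n.
Proof. by elim: n => [|n IH]; rewrite ?mulr0n ?addf0 // !mulrS phiD IH. Qed.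

Lemma addfMz u c : phi (u *~ c) = phi u *~ c.
Proof.
case: c => n; first by rewrite -!pmulrn addfMn.
by rewrite !NegzE !mulrNz addfN -!pmulrn addfMn.
Qed.

End AdditiveFun.

(** The coordinates vanish from the degree bound on, so subtracting a finite combination kills all
    of them, and [schur_coord_eq0] applies. *)
Lemma schur_span f : exists s : seq (int * intpart), f = \sum_(x <- s) schur x.2 *~ x.1.
Proof.
have [d fd] := deg_ltP f.
pose L := undup (flatten [seq parts_of_size i | i <- iota 0 d]).
exists [seq (schur_coord la f, la) | la <- L]; rewrite big_map /=.
apply/eqP; rewrite -subr_eq0; apply/eqP; apply: schur_coord_eq0 => la.
rewrite (addfB (schur_coordD la)) (addf_sum (schur_coordD la)).
have C mu : schur_coord la (schur mu *~ schur_coord mu f) = schur_coord mu f *+ (la == mu).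
  rewrite (addfMz (schur_coordD la)) [schur_coord la _]schur_coef_schur //.
  by case: eqP => _; rewrite ?mul0rz // mulr1n intz.
under eq_bigr => mu _ do rewrite C; have [hL|hL] := boolP (la \in L).
  rewrite (bigD1_seq la) ?undup_uniq //= eqxx mulr1n big1 ?addr0 ?subrr // => mu.
  by rewrite eq_sym => /negPf ->.
rewrite big1_seq ?subr0 => [|mu /andP[_ hm]]; last first.
  by case: eqP hm hL => // -> ->.
apply: (schur_coef_big _ fd); rewrite leqNgt; apply: contra hL => h.
rewrite mem_undup; apply/flattenP; exists (parts_of_size (sumn la)); last exact: mem_parts_of_size.
by apply/mapP; exists (sumn la); rewrite ?mem_iota.
Qed.

Lemma eq_on_schur (V : zmodType) (phi psi : symfun -> V) :
  (forall u v, phi (u + v) = phi u + phi v) ->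
  (forall u v, psi (u + v) = psi u + psi v) ->
  (forall la, phi (schur la) = psi (schur la)) -> phi =1 psi.
Proof.
move=> phiD psiD H f; have [s ->] := schur_span f.
by rewrite (addf_sum phiD) (addf_sum psiD); apply: eq_bigr => x _; rewrite (addfMz phiD) (addfMz psiD) H.
Qed.

Lemma hallDl f g h : hall (f + g) h = hall f h + hall g h.
Proof. by have [[+ _] _] := hallP; apply. Qed.

Lemma hallDr h f g : hall h (f + g) = hall h f + hall h g.
Proof. by have [[_ +] _] := hallP; apply. Qed.

Lemma hall_schur la mu : hall (schur la) (schur mu) = (la == mu)%:R.
Proof. by have [_] := hallP; apply. Qed.

Lemma hall_sym f g : hall f g = hall g f.
Proof.
apply: (eq_on_schur (phi := fun f => hall f g) (psi := hall g)) => [u v|u v|la].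
- exact: hallDl.
- exact: hallDr.
apply: (eq_on_schur (phi := hall (schur la)) (psi := fun g => hall g _)) => [u v|u v|mu].
- exact: hallDr.
- exact: hallDl.
by rewrite !hall_schur eq_sym.
Qed.

(** The adjoint of multiplication by h_k removes horizontal strips of size k. For u = s_nu both
    sides are 1 or 0 according to whether la/nu is such a strip. *)
Lemma hall_hsym u k la :
  hall (u * hsym k) (schur la) =
  \sum_(mu <- hsubs la | (sumn mu + k == sumn la)%N) hall u (schur mu).
Proof.
apply: (eq_on_schur (phi := fun u => hall (u * hsym k) (schur la))
  (psi := fun u => \sum_(mu <- hsubs la | (sumn mu + k == sumn la)%N) hall u (schur mu)))
  => [v w|v w|nu].
- by rewrite mulrDl hallDl.
- by rewrite -big_split; apply: eq_bigr => mu _; rewrite hallDl.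
rewrite mulrC pieri (addf_sum (phi := fun f => hall f _)) => [|v w]; last exact: hallDl.
under eq_bigr => mu _ do rewrite hall_schur.
under [RHS]eq_bigr => mu _ do rewrite hall_schur.
have E (T : eqType) (r : seq T) (P : pred T) x (Q : pred T) : uniq r -> (forall y, Q y = (y == x)) ->
  \sum_(y <- r | P y) (Q y)%:R = ((x \in r) && P x)%:R :> int.
  move=> ur EQ; under eq_bigr => y _ do rewrite EQ.
  rewrite big_mkcond; have [xr|xr] := boolP (x \in r); last first.
    rewrite big1_seq // => y /andP[_ hy]; case: ifP => // _.
    by case: eqP hy xr => // -> ->.
  rewrite (bigD1_seq x) //= eqxx big1 ?addr0 => [|y /negPf ->]; last by case: ifP.
  by case: (P x).
rewrite (E _ _ _ la) ?hsups_uniq // (E _ _ _ nu) ?hsubs_uniq //.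
by rewrite andbT mem_hsups mem_hsubs andbC eq_sym.
Qed.

Definition mon_coef (gm : seq nat) (f : symfun) : int :=
  (trunc f (size gm))@_(part_exp (size gm) gm).

Lemma mon_coefD gm f g : mon_coef gm (f + g) = mon_coef gm f + mon_coef gm g.
Proof. exact: mcoeffD. Qed.

Lemma mon_coef_rcons gm k f :
  mon_coef (rcons gm k) f = ((muni (trunc f (size gm).+1))`_k)@_(part_exp (size gm) gm).
Proof.
rewrite /mon_coef size_rcons mcoeff_muni mnmE nth_rcons ltnn eqxx.
by congr (mcoeff _ _); apply/mnmP => i; rewrite !mnmE nth_rcons /= ltn_ord.
Qed.

Lemma mon_coef_rcons_schur gm k la :
  mon_coef (rcons gm k) (schur la) =
  \sum_(mu <- hsubs la | (sumn mu + k == sumn la)%N) mon_coef gm (schur mu).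
Proof.
rewrite mon_coef_rcons schur_branch_coef raddf_sum /=.
by apply: eq_bigr.
Qed.

Lemma mon_coef_rcons_schurM gm k la mu :
  mon_coef (rcons gm k) (schur la * schur mu) =
  \sum_(i < k.+1) \sum_(ka <- hsubs la | (sumn ka + i == sumn la)%N)
    \sum_(nu <- hsubs mu | (sumn nu + (k - i) == sumn mu)%N)
      mon_coef gm (schur ka * schur nu).
Proof.
rewrite mon_coef_rcons muniM coefM raddf_sum /=; apply: eq_bigr => i _.
have -> := congr2 *%R (schur_branch_coef la (size gm) i) (schur_branch_coef mu (size gm) (k - i)).
rewrite mulr_suml raddf_sum /=.
by apply: eq_bigr => ka _; rewrite mulr_sumr raddf_sum.
Qed.

Definition hprod (gm : seq nat) : symfun := \prod_(k <- gm) hsym k.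

Lemma hprod_rcons gm k : hprod (rcons gm k) = hprod gm * hsym k.
Proof. by rewrite /hprod -cats1 big_cat big_seq1. Qed.

Lemma mon_coef_nil la : mon_coef [::] (schur la) = (la == part_of [::])%:R.
Proof.
rewrite /mon_coef /= schur_pol0 sumn_eq0; case: (_ == _); rewrite ?mcoeff0 // mcoeff1.
have -> : part_exp 0 [::] = 0%MM by apply/mnmP => -[].
by rewrite eqxx.
Qed.

(** Both sides obey the same recursion on the last entry k of [gm]: the adjoint of h_k and the
    coefficient of x^k in the last variable both remove horizontal strips of size k. *)
Lemma hall_hprod gm f : hall (hprod gm) f = mon_coef gm f.
Proof.
apply: (eq_on_schur (phi := hall (hprod gm)) (psi := mon_coef gm)) => [u v|u v|la].
- exact: hallDr.
- exact: mon_coefD.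
elim/last_ind: gm la => [|gm k IH] la.
  by rewrite /hprod big_nil mon_coef_nil -schur_nil hall_schur eq_sym.
by rewrite hprod_rcons hall_hsym mon_coef_rcons_schur; apply: eq_bigr => mu _; apply: IH.
Qed.

(** * Shapes with two rows or two columns *)

Definition trow p q : intpart := part_of [:: p; q].
(* The transpose of [trow p q]. *)
Definition tcol p q : intpart := part_of (nseq q 2%N ++ nseq (p - q)%N 1%N).

Lemma nth_trow p q i : (q <= p)%N ->
  nth 0%N (trow p q) i = if i is i'.+1 then if i' is 0%N then q else 0%N else p.
Proof.
move=> le; rewrite nth_part_of /= ?le //.
by case: i => [|[|i]] //=; rewrite nth_nil.
Qed.

Lemma nth_tcol p q i : (q <= p)%N -> nth 0%N (tcol p q) i = ((i < p) + (i < q))%N.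
Proof.
move=> le; have E j : nth 0%N (nseq q 2 ++ nseq (p - q) 1%N) j = ((j < p) + (j < q))%N.
  rewrite nth_cat size_nseq !nth_nseq; case: ltnP => h; first by rewrite (leq_trans h le).
  by rewrite ltn_subLR // subnKC //; case: (j < p)%N.
rewrite nth_part_of ?E //; apply/(sortedP 0%N) => j _; rewrite !E /=.
by case: (ltnP j.+1 p); case: (ltnP j.+1 q); case: (ltnP j p); case: (ltnP j q); lia.
Qed.

Lemma sumn_part_of s : sumn (part_of s) = sumn s.
Proof.
rewrite /= (perm_sumn (permEl (perm_sort _ _))).
by elim: s => //= x s IH; case: eqP => [->|_] /=; rewrite IH.
Qed.

Lemma sumn_trow p q : sumn (trow p q) = (p + q)%N.
Proof. by rewrite sumn_part_of /= addn0. Qed.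

Lemma sumn_tcol p q : (q <= p)%N -> sumn (tcol p q) = (p + q)%N.
Proof. by move=> le; rewrite sumn_part_of sumn_cat !sumn_nseq; lia. Qed.

Lemma hstrip_srowE (la : intpart) p :
  hstrip la (srow p) = (nth 0 la 1 <= p <= nth 0 la 0)%N && (nth 0 la 2 == 0)%N.
Proof.
apply/hstripP/andP => [H|[h1 /eqP h2] i].
  by have := H 0%N; have := H 1%N; rewrite !nth_srow leqn0 => /andP[].
case: i => [|[|i]]; rewrite nth_srow ?h2 //=.
by rewrite andbT (leq_trans (parts_anti la (isT : (2 <= i.+3)%N))) ?h2.
Qed.

Lemma sumn_two (la : intpart) : nth 0%N la 2 = 0%N ->
  sumn la = (nth 0 la 0 + nth 0 la 1)%N.
Proof.
move=> h; rewrite (sumn_nth_widen (L := 2)) ?big_ord_recl ?big_ord0 ?addn0 //.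
by rewrite leqNgt -nth_part_gt0 h.
Qed.

Lemma eq_trow (la : intpart) p q : (q <= p)%N ->
  (la == trow p q) = [&& nth 0 la 0 == p, nth 0 la 1 == q & nth 0 la 2 == 0]%N.
Proof.
move=> le; apply/eqP/and3P => [->|[/eqP h0 /eqP h1 /eqP h2]]; first by rewrite !nth_trow.
apply: intpart_eq => -[|[|i]]; rewrite nth_trow //.
by apply/eqP; rewrite -leqn0 (leq_trans (parts_anti la (isT : (2 <= i.+2)%N))) ?h2.
Qed.

(** By Pieri, h_p h_(q+1) runs over the two-row shapes with second part at most q + 1, and h_(p+1)
    h_q over those with second part at most q. Writing the second part as q + 1 avoids a truncated
    index; [schur_trow0] covers the second part 0. *)
Lemma jacobi_trudi_two p q : (q < p)%N ->
  schur (trow p q.+1) = hsym p * hsym q.+1 - hsym p.+1 * hsym q.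
Proof.
move=> le; apply/eqP; rewrite eq_sym subr_eq; apply/eqP.
rewrite [hsym p * _]mulrC [hsym p.+1 * _]mulrC (pieri q.+1 (srow p)) (pieri q (srow p.+1)).
rewrite -[RHS](big_cons _ _ (trow p q.+1) _ xpredT (fun la => schur la)).
apply: perm_big; apply: uniq_perm; rewrite /= ?hsups_uniq ?andbT //.
  rewrite mem_hsups hstrip_srowE !nth_trow //; lia.
move=> la; rewrite inE !mem_hsups !hstrip_srowE !sumn_srow eq_trow //.
case: (nth 0%N la 2 =P 0%N) => [h2|_]; rewrite ?andbF // (sumn_two h2).
have := parts_anti la (leqnSn 0).
move: (nth 0%N la 0) (nth 0%N la 1) => x y; lia.
Qed.

Lemma schur_trow0 p : schur (trow p 0) = hsym p.
Proof.
by congr schur; apply: intpart_eq => i; rewrite nth_trow // nth_srow.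
Qed.

Section TwoVar.

Definition two_coef a b (f : symfun) : int := mon_coef [:: a; b] f.

Lemma two_coefE a b f : two_coef a b f = hall (hsym a * hsym b) f.
Proof. by rewrite /two_coef -hall_hprod /hprod !big_cons big_nil mulr1. Qed.

Lemma two_coefC a b f : two_coef a b f = two_coef b a f.
Proof. by rewrite !two_coefE mulrC. Qed.

Lemma hall_trow p q f : (q < p)%N ->
  hall f (schur (trow p q.+1)) = two_coef p q.+1 f - two_coef p.+1 q f.
Proof.
by move=> le; rewrite jacobi_trudi_two // hall_sym (addfB (phi := fun x => hall x f)) ?two_coefE // => u v; rewrite hallDl.
Qed.

Lemma hall_trow0 p f : hall f (schur (trow p 0)) = two_coef p 0 f.
Proof. by rewrite schur_trow0 hall_sym two_coefE hsym0 mulr1. Qed.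

Lemma muni_widen n (p : {mpoly int[n]}) : muni (mwiden p) = p%:P.
Proof.
rewrite [p]mpolyE (addf_sum (@mwidenD n int)) (addf_sum (@muniD n int)) (addf_sum (@polyCD _)).
apply: eq_bigr => m _.
rewrite mwidenZ muniZ -[RHS]/((_ *: _)%:P) -mul_mpolyC polyCM mul_polyC; congr (_ *: _).
rewrite mwidenX mpolyXE_id rmorph_prod big_ord_recr /= rmorphXn /= mnmwiden_ordmax expr0 mulr1.
rewrite [in RHS]mpolyXE_id rmorph_prod; apply: eq_bigr => i _.
rewrite mnmwiden_widen !rmorphXn /= muniX_ord.
by rewrite (_ : widen_ord _ i = lift ord_max i) ?liftK //; apply: val_inj; rewrite /= /bump leqNgt ltn_ord.
Qed.

Lemma muni_mesym n k : muni (mesym n.+1 int k.+1) = (mesym n int k.+1)%:P + (mesym n int k)%:P * 'X.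
Proof. by rewrite mesymSS muniD muniM !muni_widen muniX_ord unlift_none. Qed.
End TwoVar.

Lemma hstrip_tcol p q p' q' : (q <= p)%N -> (q' <= p')%N ->
  (p' <= p <= p'.+1)%N -> (q' <= q <= q'.+1)%N -> hstrip (tcol p q) (tcol p' q').
Proof.
move=> h h' hp hq; apply/hstripP => i; rewrite !nth_tcol //.
by case: (ltnP i p); case: (ltnP i q); case: (ltnP i p'); case: (ltnP i q');
  case: (ltnP i.+1 p); case: (ltnP i.+1 q); lia.
Qed.

Lemma hstrip_tcolP p q (nu : intpart) : (q <= p)%N -> hstrip (tcol p q) nu ->
  exists p' q', [/\ q' <= p', p' <= p <= p'.+1, q' <= q <= q'.+1 & nu = tcol p' q']%N.
Proof.
move=> le /hstripP H.
(* A column of [tcol p q] loses its bottom cell when that cell is not in nu: the first column if row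
   p - 1 of nu is empty, the second if row q - 1 has at most one cell. *)
pose p' := (p - ((0 < p) && (nth 0 nu p.-1 == 0)))%N.
pose q' := (q - ((0 < q) && (nth 0 nu q.-1 <= 1)))%N.
have Hp := H p.-1; have Hq := H q.-1; rewrite !nth_tcol // in Hp Hq.
have le' : (q' <= p')%N.
  rewrite /p' /q'; move: le Hp Hq; have := parts_anti nu (leq_pred q).
  have [->|ne] := eqVneq p q; first by lia.
  by lia.
exists p', q'; split=> //; rewrite ?/p' ?/q'; [lia|lia|].
apply: intpart_eq => i; have := H i; rewrite !nth_tcol // {le' H Hp Hq} /p' /q' {p' q'}.
case: (ltngtP i.+1 p) => hip; [| |subst p; rewrite /=]; (case: (ltngtP i.+1 q) => hiq; [| |subst q; rewrite /=]).
all: lia.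
Qed.

(* The pairs (p', q') such that [tcol p q] / [tcol p' q'] is a horizontal strip of
   size i; equivalently, [trow p q] / [trow p' q'] is a vertical strip. *)
Definition strip_pairs (i p q : nat) : seq (nat * nat) :=
  match i with
  | 0 => [:: (p, q)]
  | 1 => (if (q < p)%N then [:: (p.-1, q)] else [::]) ++ (if (0 < q)%N then [:: (p, q.-1)] else [::])
  | 2 => if (0 < q)%N then [:: (p.-1, q.-1)] else [::]
  | _ => [::]
  end.

Lemma big_hsubs_tcol (V : nmodType) (F : intpart -> V) i p q : (q <= p)%N ->
  \sum_(ka <- hsubs (tcol p q) | (sumn ka + i == sumn (tcol p q))%N) F ka =
  \sum_(x <- strip_pairs i p q) F (tcol x.1 x.2).
Proof.
move=> le; rewrite -(big_map (fun x => tcol x.1 x.2) xpredT F).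
apply: big_uniq_seq; first exact: hsubs_uniq.
  case: i => [|[|[|i]]] //=; last by case: ifP.
  case: (ltnP q p) => h; last by case: ifP.
  case: (ltnP 0 q) => h' //=; rewrite andbT inE; apply/negP => /eqP E.
  have := congr1 (fun x : intpart => nth 0%N x p.-1) E; rewrite !nth_tcol; lia.
move=> nu; rewrite mem_hsubs; apply/idP/andP => [|[hs /eqP e]].
  rewrite sumn_tcol //; case: i => [|[|[|i]]] //=.
  - by rewrite inE => /eqP ->; (split; [apply: hstrip_tcol; lia | apply/eqP; rewrite sumn_tcol; lia]).
  - rewrite map_cat mem_cat; case: (ltnP q p) => h; case: (ltnP 0 q) => h' //=; rewrite ?inE ?orbF //.
    + by case/orP => /eqP ->; (split; [apply: hstrip_tcol; lia | apply/eqP; rewrite sumn_tcol; lia]).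
    + by move/eqP ->; (split; [apply: hstrip_tcol; lia | apply/eqP; rewrite sumn_tcol; lia]).
    + by move/eqP ->; (split; [apply: hstrip_tcol; lia | apply/eqP; rewrite sumn_tcol; lia]).
  - case: (ltnP 0 q) => h' //=; rewrite inE => /eqP ->.
    by (split; [apply: hstrip_tcol; lia | apply/eqP; rewrite sumn_tcol; lia]).
have [p' [q' [le' hp hq E]]] := hstrip_tcolP le hs.
move: e; rewrite {nu hs}E !sumn_tcol // => e.
have [e1|e1] : p' = p \/ p = p'.+1 by lia.
  have [e2|e2] : q' = q \/ q = q'.+1 by lia.
    have -> : i = 0%N by lia.
    by rewrite e1 e2 /= inE.
  have -> : i = 1%N by lia.
  by rewrite e1 e2 /= map_cat mem_cat inE eqxx orbT.
have [e2|e2] : q' = q \/ q = q'.+1 by lia.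
  have -> : i = 1%N by lia.
  by rewrite e1 e2 /= -e2 ltnS le' /= inE eqxx.
have -> : i = 2%N by lia.
by rewrite e1 e2 /= inE.
Qed.

(** * Multiplication by elementary functions *)

Lemma tcol00 : tcol 0 0 = part_of [::].
Proof. by []. Qed.

(** Both sides satisfy e_(k+1)(x, t) = e_(k+1)(x) + t e_k(x), since a horizontal strip removed from
    a column is empty or its bottom cell. *)
Lemma elem_tcol k : elem k = schur (tcol k 0).
Proof.
apply: symfun_eq => n /=; elim: n k => [|n IH] k.
  rewrite schur_pol0 sumn_tcol // addn0; case: k => [|k]; first by rewrite mesym0E.
  by rewrite mesym_geqnE.
case: k => [|k]; first by rewrite mesym0E schur_pol_nil.
apply: muni_inj; rewrite muni_mesym !IH schur_branch.
rewrite (big_uniq_seq (P := xpredT) (t := [:: tcol k.+1 0; tcol k 0])) ?hsubs_uniq //.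
- rewrite big_cons big_seq1 !sumn_tcol // !addn0 subnn subSnn expr0 mulr1 expr1 //.
- rewrite /= inE andbT; apply/negP => /eqP/(congr1 (fun la : intpart => sumn la)).
  by rewrite !sumn_tcol // !addn0 => /eqP; rewrite eqn_leq ltnn.
move=> nu; rewrite mem_hsubs andbT !inE; apply/orP/idP => [[|] /eqP ->|].
- by apply: hstrip_tcol; lia.
- by apply: hstrip_tcol; lia.
move/hstrip_tcolP => /(_ isT) [p' [q' [h1 h2 h3 ->]]].
have -> : q' = 0%N by lia.
have [->|->] : p' = k.+1 \/ p' = k by lia.
  by left.
by right.
Qed.

Lemma elem0 : elem 0 = 1.
Proof. by rewrite elem_tcol tcol00 schur_nil. Qed.

Section TwoCoefElem.
Implicit Types f : symfun.

Definition pcoef1 a (p : {mpoly int[1]}) : int := p@_(part_exp 1 [:: a]).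

Lemma pcoef1_0 a : pcoef1 a 0 = 0.
Proof. exact: mcoeff0. Qed.

Lemma two_coef_muni a b f : two_coef a b f = pcoef1 a (muni (trunc f 2))`_b.
Proof. exact: (@mon_coef_rcons [:: a] b f). Qed.

Lemma pcoef1_muni a (p : {mpoly int[1]}) : pcoef1 a p = ((muni p)`_a)@_0%MM.
Proof.
rewrite /pcoef1 mcoeff_muni mnmE /=; congr (mcoeff _ _).
by apply/mnmP => -[].
Qed.

Lemma pcoef1_mul_mesym1 a p :
  pcoef1 a (p * mesym 1 int 1) = if a is a'.+1 then pcoef1 a' p else 0.
Proof.
rewrite pcoef1_muni muniM muni_mesym mesym_geqnE // mesym0E add0r polyC1 mul1r coefMX.
by case: a => [|a] /=; rewrite ?mcoeff0 -?pcoef1_muni.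
Qed.

Lemma two_coef_mulS a b f i :
  two_coef a b (f * elem i.+1) =
  pcoef1 a ((muni (trunc f 2))`_b * mesym 1 int i.+1) +
  (if b is b'.+1 then pcoef1 a ((muni (trunc f 2))`_b' * mesym 1 int i) else 0).
Proof.
rewrite two_coef_muni -[trunc (f * _) 2]/(trunc f 2 * mesym 2 int i.+1) muniM muni_mesym.
move: (muni _) (mesym 1 int i.+1) (mesym 1 int i) => q x y.
have -> : (q * (x%:P + y%:P * 'X))`_b = q`_b * x + (if b is b'.+1 then q`_b' * y else 0).
  rewrite mulrDr mulrA; apply: etrans (coefD _ _ _) _; congr (_ + _); first exact: coefMC.
  by rewrite coefMX; case: b => // b; exact: coefMC.
by rewrite /pcoef1 mcoeffD; case: b => // ; rewrite mcoeff0.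
Qed.

Lemma two_coef_elem1 a b f : two_coef a b (f * elem 1) =
  (if a is a'.+1 then two_coef a' b f else 0) + (if b is b'.+1 then two_coef a b' f else 0).
Proof.
rewrite two_coef_mulS pcoef1_mul_mesym1 mesym0E.
by case: a => [|a]; case: b => [|b]; rewrite ?mulr1 -?two_coef_muni.
Qed.

Lemma two_coef_elem2 a b f : two_coef a b (f * elem 2) =
  if a is a'.+1 then if b is b'.+1 then two_coef a' b' f else 0 else 0.
Proof.
rewrite two_coef_mulS mesym_geqnE // mulr0 pcoef1_0 add0r.
case: b => [|b]; first by case: a.
by rewrite pcoef1_mul_mesym1; case: a => // a; rewrite -two_coef_muni.
Qed.

Lemma two_coef_elem_gt2 a b f i : (2 < i)%N -> two_coef a b (f * elem i) = 0.
Proof.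
case: i => [|[|[|i]]] // _; rewrite two_coef_mulS !mesym_geqnE //.
by case: b => [|b]; rewrite ?mulr0 ?pcoef1_0 ?addr0.
Qed.

(** The adjoint of e_i removes vertical strips, and two rows allow only i <= 2. The pairing with a
    two-row Schur function is a difference of coefficients in two variables, where e_1 = x + y, e_2
    = x y and e_i = 0 for i > 2; for p = q, two coefficients cancel by the symmetry in x and y. *)
Lemma hall_elem_trow f i p q : (q <= p)%N ->
  hall (f * elem i) (schur (trow p q)) = \sum_(x <- strip_pairs i p q) hall f (schur (trow x.1 x.2)).
Proof.
have H0 p' : hall f (schur (trow p' 0)) = two_coef p' 0 f := hall_trow0 p' f.
case: i => [|[|[|i]]] le; rewrite ?big_nil ?elem0 ?mulr1 ?big_seq1 //.
- rewrite /= big_cat /=; case: q le => [|q] le.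
    rewrite hall_trow0 two_coef_elem1 big_nil !addr0; case: p le => [|p] le /=.
      by rewrite big_nil.
    by rewrite big_seq1 H0.
  rewrite hall_trow // !two_coef_elem1 big_seq1 /=.
  case: p le => // p; rewrite ltnS leq_eqVlt => /orP[/eqP <-|lt].
    rewrite ltnn big_nil add0r; case: q => [|q].
      by rewrite H0 two_coefC addr0 addrK.
    rewrite hall_trow //=; rewrite [two_coef q.+1 q.+2 _]two_coefC.
    by rewrite opprD addrA addrK.
  rewrite ltnS lt big_seq1 /= hall_trow //.
  case: q lt => [|q] lt; first by rewrite H0 addr0 addrAC.
  by rewrite hall_trow; [rewrite opprD !addrA addrK subrK | lia].
- case: q le => [|q] le /=.
    by rewrite hall_trow0 two_coef_elem2 big_nil; case: p le.
  rewrite hall_trow // !two_coef_elem2 big_seq1 /=; case: p le => // p le.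
  case: q le => [|q] le; first by rewrite subr0 H0.
  by rewrite hall_trow.
by rewrite /=; case: q le => [|q] le; rewrite ?hall_trow0 ?hall_trow // !two_coef_elem_gt2 ?subr0.
Qed.

End TwoCoefElem.

(** * The pairing on the tensor square *)

Lemma tensDl (a a' b : symfun) : tens (a + a') b = tens a b + tens a' b.
Proof. exact: (tens_biadditive _ _).1. Qed.
Lemma tensDr (a b b' : symfun) : tens a (b + b') = tens a b + tens a b'.
Proof. exact: (tens_biadditive _ _).2. Qed.

Lemma eq_on_tens (V : zmodType) (phi psi : symfun2 -> V) :
  (forall u v, phi (u + v) = phi u + phi v) ->
  (forall u v, psi (u + v) = psi u + psi v) ->
  (forall a b, phi (tens a b) = psi (tens a b)) -> phi =1 psi.
Proof.
move=> phiD psiD H u; rewrite -(tens_sum_repr u) tens_sumE.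
by rewrite (addf_sum phiD) (addf_sum psiD); apply: eq_bigr.
Qed.

Lemma hall2Dl u v w : hall2 (u + v) w = hall2 u w + hall2 v w.
Proof. by have [[+ _] _] := hall2P; apply. Qed.

Lemma hall2Dr w u v : hall2 w (u + v) = hall2 w u + hall2 w v.
Proof. by have [[_ +] _] := hall2P; apply. Qed.

Lemma hall2_tens a b c d : hall2 (tens a b) (tens c d) = hall a c * hall b d.
Proof.
apply: (eq_on_schur (phi := fun a => hall2 (tens a b) (tens c d))
                    (psi := fun a => hall a c * hall b d)) => [u v|u v|la].
- by rewrite tensDl hall2Dl.
- by rewrite hallDl mulrDl.
apply: (eq_on_schur (phi := fun b => hall2 (tens (schur la) b) (tens c d))
                    (psi := fun b => hall (schur la) c * hall b d)) => [u v|u v|mu].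
- by rewrite tensDr hall2Dl.
- by rewrite hallDl mulrDr.
apply: (eq_on_schur (phi := fun c => hall2 (tens (schur la) (schur mu)) (tens c d))
                    (psi := fun c => hall (schur la) c * hall (schur mu) d)) => [u v|u v|la'].
- by rewrite tensDl hall2Dr.
- by rewrite hallDr mulrDl.
apply: (eq_on_schur (phi := fun d => hall2 (tens (schur la) (schur mu)) (tens (schur la') d))
                    (psi := fun d => hall (schur la) (schur la') * hall (schur mu) d)) => [u v|u v|mu'].
- by rewrite tensDr hall2Dr.
- by rewrite hallDr mulrDr.
have [_ /(_ (la, mu) (la', mu'))] := hall2P; rewrite /schur2 /= !hall_schur => ->.
by rewrite xpair_eqE -mulnb natrM.
Qed.

(* The image of [hsym k] under the coproduct, followed by the involution omega on
   the second factor. *)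
Definition theta k : symfun2 := \sum_(i < k.+1) tens (hsym (k - i)%N) (elem i).

Lemma strip_pairs_le i p q x : (q <= p)%N -> x \in strip_pairs i p q -> (x.2 <= x.1)%N.
Proof.
move=> le; case: i => [|[|[|i]]] //=; first by rewrite inE => /eqP ->.
  rewrite mem_cat; case: ltnP => h; case: ltnP => h'; rewrite ?inE ?orbF //=.
  - by case/orP => /eqP -> /=; lia.
  - by move/eqP -> => /=; lia.
  - by move/eqP -> => /=; lia.
by case: ltnP => h //; rewrite inE => /eqP -> /=; lia.
Qed.

Lemma hall2_theta u k mu p q : (q <= p)%N ->
  hall2 (u * theta k) (tens (schur mu) (schur (trow p q))) =
  \sum_(i < k.+1) \sum_(x <- strip_pairs i p q)
    \sum_(nu <- hsubs mu | (sumn nu + (k - i) == sumn mu)%N)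
      hall2 u (tens (schur nu) (schur (trow x.1 x.2))).
Proof.
move=> le; rewrite mulr_sumr (addf_sum (phi := fun v => hall2 v _)) => [|v w]; last exact: hall2Dl.
apply: eq_bigr => i _; move: u.
apply: eq_on_tens => [u v|u v|a b].
- by rewrite mulrDl hall2Dl.
- by rewrite -big_split; apply: eq_bigr => x _; rewrite -big_split; apply: eq_bigr => nu _; rewrite hall2Dl.
rewrite tensM hall2_tens hall_elem_trow // hall_hsym mulr_sumr; apply: eq_bigr => x _.
by rewrite mulr_suml; apply: eq_bigr => nu _; rewrite hall2_tens.
Qed.

(** On the left the last variable removes horizontal strips of sizes i and k - i from [tcol p q] and
    mu; on the right the adjoints of e_i and h_(k-i) act on [trow p q] and mu. The same
    [strip_pairs] describe horizontal strips of the first shape and vertical strips of its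
    transpose. *)
Lemma mon_coef_tcolM gm p q mu : (q <= p)%N ->
  mon_coef gm (schur (tcol p q) * schur mu) =
  hall2 (\prod_(k <- gm) theta k) (tens (schur mu) (schur (trow p q))).
Proof.
elim/last_ind: gm p q mu => [|gm k IH] p q mu le.
  rewrite big_nil -[1]/(tens 1 1) hall2_tens -schur_nil !hall_schur.
  rewrite /mon_coef /= !schur_pol0 sumn_tcol // -[(p + q)%N]sumn_trow !sumn_eq0.
  have -> : part_exp 0 [::] = 0%MM by apply/mnmP => -[].
  rewrite ![part_of [::] == _]eq_sym mulrC.
  by case: eqP => _; case: eqP => _; rewrite ?mul0r ?mulr0 ?mulr1 ?mcoeff0 ?mcoeff1 ?eqxx.
rewrite mon_coef_rcons_schurM -cats1 big_cat big_seq1 hall2_theta //.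
apply: eq_bigr => i _; rewrite (big_hsubs_tcol (fun ka => _)) //.
by apply: eq_big_seq => x /(strip_pairs_le le) hx; apply: eq_bigr => nu _; apply: IH.
Qed.

Definition s22 : symfun := hsym 2 * hsym 2 - hsym 1 * hsym 3.
Definition theta22 : symfun2 := theta 2 * theta 2 - theta 1 * theta 3.

Lemma schur22 : schur (rect 2 2) = s22.
Proof. by rewrite -[rect 2 2]/(trow 2 2) jacobi_trudi_two // mulrC [hsym 3 * _]mulrC. Qed.

Lemma rect_trow N : rect N 2 = trow N N. Proof. by []. Qed.
Lemma rect_tcol N : rect 2 N = tcol N N.
Proof. by apply: val_inj; rewrite /= subnn cats0. Qed.

(** A general prefix [gm] lets the induction move the factors of each s_22 = h_2 h_2 - h_1 h_3 into
    it, until [mon_coef_tcolM] applies. *)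
Lemma hall_s22_exp p q mu N gm : (q <= p)%N ->
  hall (hprod gm * s22 ^+ N) (schur (tcol p q) * schur mu) =
  hall2 ((\prod_(k <- gm) theta k) * theta22 ^+ N) (tens (schur mu) (schur (trow p q))).
Proof.
move=> le; elim: N gm => [|N IH] gm.
  by rewrite !expr0 !mulr1 hall_hprod mon_coef_tcolM.
have E (R : comPzRingType) (x y z t r : R) : x * ((y * y - z * t) * r) =
    (y * (y * x)) * r - (z * (t * x)) * r by ring.
rewrite !exprS !E (addfB (phi := fun v => hall v _)) => [|u v]; last exact: hallDl.
rewrite [RHS](addfB (phi := fun v => hall2 v _)) => [|u v]; last exact: hall2Dl.
have := IH [:: 1, 3 & gm]; have := IH [:: 2, 2 & gm].
by rewrite /hprod !big_cons => -> ->.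
Qed.

Lemma pairing_g_theta N :
  hall (schur (rect 2 N) * schur (rect N 2)) (schur (rect 2 2) ^+ N) =
  hall2 (theta22 ^+ N) (tens (schur (rect N 2)) (schur (rect N 2))).
Proof.
rewrite hall_sym schur22 rect_tcol rect_trow.
have := @hall_s22_exp N N (trow N N) N [::] (leqnn N).
by rewrite /hprod !big_nil !mul1r.
Qed.

(** * Valuations of the terms *)

Section TwoAdic.
Local Open Scope nat_scope.

Definition vfact n := logn 2 n`!.

Lemma vfactS n : vfact n.+1 = logn 2 n.+1 + vfact n.
Proof. by rewrite /vfact factS lognM ?fact_gt0. Qed.

Lemma vfact_double n : vfact n.*2 = n + vfact n.
Proof.
elim: n => // n IH; rewrite doubleS !vfactS IH.
have -> : logn 2 n.*2.+1 = 0 by rewrite lognE dvdn2 /= odd_double.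
by rewrite -doubleS -mul2n lognM // (_ : logn 2 2 = 1) //; lia.
Qed.

Lemma vfact_doubleS n : vfact n.*2.+1 = n + vfact n.
Proof.
by rewrite vfactS vfact_double (_ : logn 2 n.*2.+1 = 0) // lognE dvdn2 /= odd_double.
Qed.

Lemma vfactD m n : vfact m + vfact n <= vfact (m + n).
Proof.
rewrite /vfact -lognM ?fact_gt0 //; apply: dvdn_leq_log; rewrite ?fact_gt0 //.
by rewrite -(@bin_fact (m + n) m) ?leq_addr // addKn dvdn_mull.
Qed.

Lemma vfact_lt n : 0 < n -> vfact n < n.
Proof.
elim/ltn_ind: n => n IH n0; rewrite -(odd_double_half n) in n0 *.
case: (odd n) n0 => /=; rewrite ?add1n ?add0n => n0.
  rewrite vfact_doubleS; have [->//|h] := posnP n./2; have := IH n./2; lia.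
by rewrite vfact_double; have := IH n./2; lia.
Qed.

Lemma vfact_le n : vfact n <= n.
Proof. by case: n => // n; apply: ltnW; apply: vfact_lt. Qed.

Lemma vfact_mersenne f : vfact (2 ^ f - 1) + f = 2 ^ f - 1.
Proof.
elim: f => // f IH; have p := expn_gt0 2 f.
have -> : 2 ^ f.+1 - 1 = (2 ^ f - 1).*2.+1 by rewrite expnS; lia.
by rewrite vfact_doubleS; lia.
Qed.

Definition catalan m := 'C(m.*2, m) %/ m.+1.

(** The form in which Catalan numbers come out of the two-row pairing: a difference of neighbouring
    binomial coefficients. *)
Lemma catalan_bin m : 'C(m.*2, m) = 'C(m.*2, m.+1) + catalan m.
Proof.
have E := mul_bin_left m.*2 m; rewrite -addnn addnK addnn in E.
have le : 'C(m.*2, m.+1) <= 'C(m.*2, m).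
  by rewrite -(leq_pmul2l (ltn0Sn m)) E leq_pmul2r // bin_gt0; lia.
rewrite -(subnKC le); congr addn.
have -> : catalan m = m.+1 * ('C(m.*2, m) - 'C(m.*2, m.+1)) %/ m.+1.
  by rewrite mulnBr E mulSn addnK.
by rewrite mulKn.
Qed.

Lemma catalan_fact m : catalan m * (m.+1`! * m`!) = (m.*2)`!.
Proof.
have E : m.+1 * catalan m = 'C(m.*2, m).
  have := mul_bin_left m.*2 m; rewrite -[X in X - m]addnn addnK => E.
  by have := catalan_bin m; nia.
have := @bin_fact m.*2 m; rewrite -[X in X - m]addnn addnK -E => <-; last by lia.
by rewrite factS; nia.
Qed.

Lemma catalan_gt0 m : 0 < catalan m.
Proof.
rewrite lt0n; apply/eqP => e; have := catalan_fact m.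
by rewrite e mul0n => /esym/eqP; rewrite -leqn0 leqNgt fact_gt0.
Qed.

(** The Catalan number is (2m)! / ((m + 1)! m!), and (2m)! / m! has valuation m. *)
Lemma logn_catalan m : logn 2 (catalan m) + vfact m.+1 = m.
Proof.
have := congr1 (logn 2) (catalan_fact m).
have := vfact_double m; rewrite lognM ?muln_gt0 ?fact_gt0 ?catalan_gt0 //.
rewrite (lognM 2 (fact_gt0 m.+1) (fact_gt0 m)) /vfact; lia.
Qed.

End TwoAdic.

(* c0, ..., c6 are the exponents of b^2, B^2, bB, abA, a^2 B, b A^2, aAB, where
   a = e_1, b = e_2, A = e_1' and B = e_2'. *)
Section Divisibility.
Local Open Scope nat_scope.
Variables (f : nat) (c0 c1 c2 c3 c4 c5 c6 : nat).
Hypothesis f0 : 0 < f.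
Local Notation N := (2 ^ f - 2).
Hypothesis sumc : c0 + c1 + c2 + c3 + c4 + c5 + c6 = N.
Variables (M m m' : nat).
Hypothesis MN : M * (c0`! * (c1`! * (c2`! * (c3`! * (c4`! * (c5`! * c6`!)))))) = N`!.
Hypothesis mE : c3 + 2 * c4 + c6 = m.*2.
Hypothesis mE' : c3 + 2 * c5 + c6 = m'.*2.
Hypothesis degE : m + (2 * c0 + c2 + c3 + c5) = N.

Lemma mult_gt0 : 0 < M.
Proof. by rewrite lt0n; apply/eqP => e; move: MN (fact_gt0 N); rewrite e mul0n => <-. Qed.

(** The power of 2 comes from the coefficient -2 of bB, the Catalan numbers from the pairings in the
    two factors. *)
Definition term_abs := M * 2 ^ c2 * catalan m * catalan m'.

Lemma term_logn :
  logn 2 term_abs + (vfact c0 + vfact c1 + vfact c2 + vfact c3 + vfact c4 + vfact c5 + vfact c6)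
  + vfact m.+1 + vfact m'.+1 = vfact N + c2 + m + m'.
Proof.
have -> : logn 2 term_abs = logn 2 M + c2 + logn 2 (catalan m) + logn 2 (catalan m').
  by rewrite /term_abs !lognM ?muln_gt0 ?mult_gt0 ?expn_gt0 ?catalan_gt0 // pfactorK.
have := congr1 (logn 2) MN; rewrite !lognM ?muln_gt0 ?fact_gt0 ?mult_gt0 //.
have := logn_catalan m; have := logn_catalan m'; rewrite /vfact; lia.
Qed.

Lemma vfact_N : vfact N + f = 2 ^ f - 1.
Proof.
have two : 2 ^ f = (2 ^ f.-1).*2 by rewrite -{1}(prednK f0) expnS mul2n.
have p := expn_gt0 2 f.-1.
have -> : N = (2 ^ f.-1 - 1).*2 by lia.
by rewrite vfact_double; have := vfact_mersenne f.-1; lia.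
Qed.

(** The two decompositions absorb all factorials in the denominators. As m + m' = c3 + c4 + c5 + c6,
    the valuation is at least c0 + ... + c6 + v(c2) - (N + 1 - f), and the c_i add up to N. *)
Lemma term_dvd : f - 1 <= logn 2 term_abs.
Proof.
have := term_logn; have := vfact_N.
have two : 1 < 2 ^ f by rewrite -{1}(expn0 2) ltn_exp2l.
(* The exponent of e_2 and half that of e_1 add up to N. Doubling c0, as b^2 does, yields the extra
   summand c0 in v(2 c0) = c0 + v(c0). *)
have h1 : vfact c0.*2 + vfact c2 + vfact c3 + vfact m.+1 + vfact c5 <= vfact (2 ^ f - 1).
  have -> : 2 ^ f - 1 = c0.*2 + c2 + c3 + m.+1 + c5 by lia.
  by do ![apply: leq_trans (vfactD _ _); rewrite leq_add2r].
have h2 : vfact c1.*2 + vfact c2 + vfact c6 + vfact m'.+1 + vfact c4 <= vfact (2 ^ f - 1).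
  have -> : 2 ^ f - 1 = c1.*2 + c2 + c6 + m'.+1 + c4 by lia.
  by do ![apply: leq_trans (vfactD _ _); rewrite leq_add2r].
have := vfact_mersenne f; move: h1 h2; rewrite !vfact_double; lia.
Qed.

Section Fixed.
Hypotheses (e01 : c0 = c1) (e36 : c3 = c6) (e45 : c4 = c5) (e34 : c3 = c4).

(** With c2 = 2t, superadditivity for 2^(f-1) - 1 = c0 + t + 2 c3 bounds the valuation below by f -
    1 + t + v(t) + 4 (c3 - v(c3)), and v(n) < n for n > 0. *)
Lemma term_fixed : (0 < c2 + c3) -> f <= logn 2 term_abs.
Proof.
move=> pos; have := term_logn; have := vfact_N.
have two : 2 ^ f = (2 ^ f.-1).*2 by rewrite -{1}(prednK f0) expnS mul2n.
have p := expn_gt0 2 f.-1.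
have [t tE] : exists t, c2 = t.*2 by exists c2./2; lia.
have mc : m = c3.*2 by lia.
have mc' : m' = c3.*2 by lia.
have h : vfact c0 + vfact t + vfact c3.*2 <= vfact (2 ^ f.-1 - 1).
  have -> : 2 ^ f.-1 - 1 = c0 + t + c3.*2 by lia.
  by do ![apply: leq_trans (vfactD _ _); rewrite leq_add2r].
have := vfact_mersenne f.-1; move: h.
rewrite -e01 -e36 -e45 -e34 mc mc' tE !vfact_doubleS !vfact_double.
have := vfact_le t; have := vfact_le c3; have := @vfact_lt t; have := @vfact_lt c3.
have : 0 < t \/ 0 < c3 by lia.
by move=> + h1 h2; case=> [/h2|/h1]; lia.
Qed.

Lemma term_top : c2 = 0 -> c3 = 0 -> logn 2 term_abs = f - 1.
Proof.
move=> z2 z3; have := term_logn; have := vfact_N.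
have two : 2 ^ f = (2 ^ f.-1).*2 by rewrite -{1}(prednK f0) expnS mul2n.
have p := expn_gt0 2 f.-1.
have -> : m = 0 by lia.
have -> : m' = 0 by lia.
rewrite -e01 -e36 -e45 -e34 z2 z3.
have -> : c0 = 2 ^ f.-1 - 1 by lia.
have : vfact 0 = 0 by []; have : vfact 1 = 0 by [].
have := vfact_mersenne f.-1; lia.
Qed.
End Fixed.
End Divisibility.

(** * Multinomial coefficients and involutions *)

Section Multinomial.
Variable n : nat.
Implicit Types m : 'X_{1..n}.

(** Multinomial coefficients are taken to be the coefficients of powers of this generic sum, so that
    the multinomial theorem is an evaluation of it. *)
Definition sumX : {mpoly int[n]} := \sum_(i < n) 'X_i.

Lemma mcoeffMXU (p : {mpoly int[n]}) i m :
  (p * 'X_i)@_m = if m i is 0%N then 0 else p@_(m - U_(i)).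
Proof.
case E : (m i) => [|k].
  rewrite [p]mpolyE mulr_suml raddf_sum big1 // => k _ /=.
  rewrite -scalerAl -mpolyXD mcoeffZ mcoeffX; case: eqP => [e|_]; last by rewrite mulr0.
  by move/mnmP/(_ i): e; rewrite mnmDE mnm1E eqxx E addn1.
have le : (U_(i) <= m)%MM by rewrite lep1mP E.
by rewrite -{1}(submK le) addmC mcoeffMX.
Qed.

Lemma sumX_homog N : sumX ^+ N \is N.-homog.
Proof.
rewrite -[X in X.-homog]mul1n; apply: dhomogMn.
by apply: rpred_sum => i _; rewrite dhomogX /= mdeg1.
Qed.

Lemma sumX_coef0 N m : mdeg m != N -> (sumX ^+ N)@_m = 0.
Proof. exact: dhomog_nemf_coeff (sumX_homog N). Qed.

Lemma sumX_msize N : (msize (sumX ^+ N) <= N.+1)%N.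
Proof.
rewrite msizeE; apply/bigmax_leqP_seq => m hm _.
by rewrite ltnS (dhomog_mf (sumX_homog N) hm).
Qed.

(** Splitting off one factor x_i gives m_i N! by induction, and the m_i add up to N + 1. *)
Lemma sumX_coef N m : mdeg m = N ->
  (sumX ^+ N)@_m * (\prod_i (m i)`!)%N%:Z = N`!%:Z.
Proof.
elim: N m => [|N IH] m mN.
  have -> : m = 0%MM by apply/eqP; rewrite -mdeg_eq0 mN.
  by rewrite expr0 mcoeff1 eqxx mul1r big1 // => i _; rewrite mnm0E.
rewrite exprSr {2}/sumX mulr_sumr raddf_sum mulr_suml /=.
transitivity (\sum_i (m i)%:Z * N`!%:Z).
  apply: eq_bigr => i _; rewrite mcoeffMXU; case E : (m i) => [|k]; first by rewrite !mul0r.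
  have le : (U_(i) <= m)%MM by rewrite lep1mP E.
  have d : mdeg (m - U_(i))%MM = N.
    by apply: succn_inj; rewrite -mN -{2}(submK le) mdegD mdeg1 addn1.
  rewrite -(IH _ d) mulrCA; congr (_ * _); rewrite -PoszM; congr Posz.
  rewrite (bigD1 i) //= [in RHS](bigD1 i) //= E mnmBE E mnm1E eqxx subn1 /= factS -mulnA.
  congr (_ * (_ * _))%N; apply: eq_bigr => j ne.
  by rewrite mnmBE mnm1E eq_sym (negPf ne) subn0.
by rewrite -mulr_suml -(big_morph Posz PoszD (erefl _)) -PoszM factS -mN mdegE.
Qed.

Lemma multinomial_expansion (S : comNzRingType) (x : 'I_n -> S) N :
  (\sum_i x i) ^+ N =
  \sum_(m : 'X_{1..n < N.+1}) (\prod_i x i ^+ m i) *~ (sumX ^+ N)@_m.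
Proof.
have -> : \sum_i x i = mmap intr x sumX.
  by rewrite /sumX raddf_sum; apply: eq_bigr => i _; rewrite /= mmapX mmap1U.
rewrite -rmorphXn /= (mmapE N.+1) ?sumX_msize //.
by apply: eq_bigr => m _; rewrite mulrzl.
Qed.

(** Permuting the exponents preserves the degree, so the result is within the bound and [insubd]
    returns it. *)
Definition bmperm k (s : 'S_n) (m : 'X_{1..n < k}) : 'X_{1..n < k} :=
  insubd m [multinom m (s i) | i < n].

Lemma bmpermE k s (m : 'X_{1..n < k}) i : bmperm s m i = m (s i).
Proof. by rewrite /bmperm insubdK ?mnmE // unfold_in /= mdeg_mperm bmdeg. Qed.

Lemma bmperm_inv k s : (s * s = 1)%g -> involutive (@bmperm k s).
Proof.
move=> ss m; apply: val_inj; apply/mnmP => i.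
by rewrite !bmpermE -permM ss perm1.
Qed.

Lemma bmpermC k s t (m : 'X_{1..n < k}) : (s * t = t * s)%g ->
  bmperm s (bmperm t m) = bmperm t (bmperm s m).
Proof.
move=> st; apply: val_inj; apply/mnmP => i.
by rewrite !bmpermE -!permM st.
Qed.

End Multinomial.

(** Points that are not fixed come in pairs with equal values, each divisible by d. *)
Lemma sum_involution (T : finType) (s : T -> T) (F : T -> int) (d : int) :
  involutive s -> (forall x, F (s x) = F x) -> (forall x, (d %| F x)%Z) ->
  (2 * d %| \sum_x F x - \sum_(x | s x == x) F x)%Z.
Proof.
move=> sK Fs dF; rewrite [X in X - _](bigID (fun x => s x == x)) /= addrAC subrr add0r.
(* The rank selects one point of each two-element orbit. *)
rewrite (bigID (fun x => enum_rank x < enum_rank (s x))%N) /=.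
set A := \sum_(i | _) _; suff -> : \sum_(x | (s x != x) && ~~ (enum_rank x < enum_rank (s x))%N) F x = A.
  have /dvdzP[q ->] : (d %| A)%Z by apply: rpred_sum => x _; apply: dF.
  by apply/dvdzP; exists q; ring.
rewrite (reindex_inj (inv_inj sK)) /=; apply: eq_big => [x|x _]; last exact: Fs.
rewrite sK eq_sym; case: eqP => //= ne.
have : enum_rank x != enum_rank (s x) :> nat.
  by apply/eqP => /val_inj/enum_rank_inj e; case: ne.
by move: (nat_of_ord _) (nat_of_ord _) => a b; lia.
Qed.

(** * Expansion of the kernel *)

Lemma hsym1E : hsym 1 = elem 1.
Proof. by rewrite elem_tcol; congr schur; apply: val_inj. Qed.

Lemma schur11 : schur (trow 1 1) = elem 2.
Proof. by rewrite elem_tcol; congr schur; apply: val_inj. Qed.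

Lemma hsym2E : hsym 2 = elem 1 ^+ 2 - elem 2.
Proof. by rewrite -schur11 jacobi_trudi_two // !hsym1E hsym0; ring. Qed.

Lemma hsym1_schur11 : hsym 1 * schur (trow 1 1) = schur (trow 2 1) + elem 3.
Proof.
rewrite pieri elem_tcol; transitivity (\sum_(la <- [:: trow 2 1; tcol 3 0]) schur la); last first.
  by rewrite big_cons big_seq1.
apply: perm_big; apply: uniq_perm => //; first exact: hsups_uniq.
move=> la; rewrite mem_hsups sumn_trow !inE; apply/andP/orP => [[/eqP s /hstripP H]|].
  have := H 0%N; have := H 1%N; have := H 2%N; rewrite !nth_trow // => h2 h1 h0.
  have e : sumn la = (nth 0 la 0 + (nth 0 la 1 + nth 0 la 2))%N.
    rewrite (sumn_nth_widen (L := 3)) ?big_ord_recl ?big_ord0 ?addn0 //.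
    by rewrite leqNgt -nth_part_gt0 -leqNgt; case/andP: h2.
  have [z|z] := posnP (nth 0%N la 2).
    by left; rewrite eq_trow // z; lia.
  right; apply/eqP/intpart_eq => i; rewrite nth_tcol // ltn0 addn0.
  case: i => [|[|[|i]]] /=; [lia | lia | lia |].
  apply/eqP; rewrite -leqn0; apply: leq_trans (_ : nth 0 la 3 <= _)%N; last by case/andP: h2.
  exact: parts_anti.
move=> [] /eqP ->; first by rewrite sumn_trow; split=> //; apply/hstripP => i; rewrite !nth_trow //; case: i => [|[|[|i]]].
by rewrite sumn_tcol //; split=> //; apply/hstripP => i; rewrite !nth_tcol // !nth_trow //; case: i => [|[|[|i]]].
Qed.

Lemma schur21 : schur (trow 2 1) = elem 1 * elem 2 - elem 3.
Proof. by rewrite -hsym1E -schur11 hsym1_schur11 addrK. Qed.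

Lemma hsym3E : hsym 3 = elem 1 ^+ 3 - 2%:R * elem 1 * elem 2 + elem 3.
Proof.
have : schur (trow 2 1) = hsym 2 * hsym 1 - hsym 3 * hsym 0 by apply: jacobi_trudi_two.
rewrite schur21 hsym0 mulr1 hsym2E hsym1E => /eqP; rewrite eq_sym subr_eq => /eqP E.
have -> : hsym 3 = (elem 1 ^+ 2 - elem 2) * elem 1 - (elem 1 * elem 2 - elem 3).
  by rewrite E; ring.
ring.
Qed.

Lemma s22E : s22 = elem 2 ^+ 2 - elem 1 * elem 3.
Proof. by rewrite /s22 hsym1E hsym2E hsym3E; ring. Qed.

(** Turns identities between tensors into polynomial identities in the e_i and e_j', which [ring]
    decides. *)
Lemma tens_split (a b : symfun) : tens a b = tens a 1 * tens 1 b.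
Proof. by rewrite tensM mul1r mulr1. Qed.

Lemma tensXl (a : symfun) n : tens (a ^+ n) 1 = tens a 1 ^+ n :> symfun2.
Proof. by elim: n => // n IH; rewrite !exprS -IH tensM mulr1. Qed.
Lemma tensXr (a : symfun) n : tens 1 (a ^+ n) = tens 1 a ^+ n :> symfun2.
Proof. by elim: n => // n IH; rewrite !exprS -IH tensM mulr1. Qed.
Lemma tensMl (a b : symfun) : tens (a * b) 1 = tens a 1 * tens b 1 :> symfun2.
Proof. by rewrite tensM mulr1. Qed.
Lemma tensMr (a b : symfun) : tens 1 (a * b) = tens 1 a * tens 1 b :> symfun2.
Proof. by rewrite tensM mulr1. Qed.
Lemma tensBl (a b : symfun) : tens (a - b) 1 = tens a 1 - tens b 1 :> symfun2.
Proof. exact: (addfB (fun a b => tensDl a b 1)). Qed.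
Lemma tensBr (a b : symfun) : tens 1 (a - b) = tens 1 a - tens 1 b :> symfun2.
Proof. exact: (addfB (fun a b => tensDr 1 a b)). Qed.
Lemma tensnl n : tens n%:R 1 = n%:R :> symfun2.
Proof. exact: (addfMn (fun a b => tensDl a b 1)). Qed.
Lemma tensnr n : tens 1 n%:R = n%:R :> symfun2.
Proof. exact: (addfMn (fun a b => tensDr 1 a b)). Qed.

Definition tensE := (tensXl, tensXr, tensnl, tensnr, tensBl, tensBr, tensDl, tensDr, tensMl, tensMr).

Section Kernel.
Local Notation a := (tens (elem 1) 1 : symfun2).
Local Notation b := (tens (elem 2) 1 : symfun2).
Local Notation c := (tens (elem 3) 1 : symfun2).
Local Notation A := (tens 1 (elem 1) : symfun2).
Local Notation B := (tens 1 (elem 2) : symfun2).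
Local Notation C := (tens 1 (elem 3) : symfun2).

Definition kernel2 : symfun2 :=
  b ^+ 2 + B ^+ 2 - 2%:R * (b * B) + a * b * A + a ^+ 2 * B + b * A ^+ 2 + a * A * B.

Definition kernel_rest : symfun2 := c * (A + a) + C * (a + A).

Lemma theta1 : theta 1 = a + A.
Proof.
have -> : theta 1 = tens (hsym 1) (elem 0) + tens (hsym 0) (elem 1).
  by rewrite /theta !big_ord_recl big_ord0 addr0.
by rewrite hsym0 elem0 hsym1E.
Qed.

Lemma theta2 : theta 2 = a ^+ 2 - b + a * A + B.
Proof.
have -> : theta 2 = tens (hsym 2) (elem 0) + tens (hsym 1) (elem 1) + tens (hsym 0) (elem 2).
  by rewrite /theta !big_ord_recl big_ord0 addr0 addrA.
by rewrite hsym0 elem0 hsym2E hsym1E (tens_split (elem 1) (elem 1)) !tensE.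
Qed.

Lemma theta3 : theta 3 = a ^+ 3 - 2%:R * a * b + c + (a ^+ 2 - b) * A + a * B + C.
Proof.
have -> : theta 3 = tens (hsym 3) (elem 0) + tens (hsym 2) (elem 1) +
    tens (hsym 1) (elem 2) + tens (hsym 0) (elem 3).
  by rewrite /theta !big_ord_recl big_ord0 addr0 !addrA.
rewrite hsym0 elem0 hsym3E hsym2E hsym1E (tens_split (_ - _) (elem 1)).
by rewrite (tens_split (elem 1) (elem 2)) !tensE.
Qed.

Lemma theta22E : theta22 = kernel2 - kernel_rest.
Proof.
rewrite /theta22 theta1 theta2 theta3 /kernel2 /kernel_rest.
ring.
Qed.

Lemma kernel22E : kernel22 = kernel2 - kernel_rest.
Proof.
rewrite /kernel22 /sub22 /= !big_cons big_nil addr0.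
have tr i j i' j' : parts (transpose (dual22 (part_of [:: i; j]))) = parts (trow i' j') ->
  transpose (dual22 (part_of [:: i; j])) = trow i' j' by move=> e; apply: val_inj.
rewrite (@tr 0 0 2 2)%N // (@tr 1 0 2 1)%N // (@tr 1 1 2 0)%N // (@tr 2 0 1 1)%N //.
rewrite (@tr 2 1 1 0)%N // (@tr 2 2 0 0)%N // -!/(trow _ _).
rewrite -[trow 2 2]/(rect 2 2) schur22 s22E schur21 schur11 !schur_trow0 hsym0 hsym1E hsym2E.
rewrite (tens_split (elem 1)) (tens_split (elem 2)) (tens_split (elem 1 ^+ 2 - _)).
rewrite (tens_split (_ - elem 3) (elem 1)) !tensE /kernel2 /kernel_rest.
ring.
Qed.
End Kernel.

(** * Catalan numbers *)

Lemma two_coef1 a b : two_coef a b 1 = ((a == 0) && (b == 0))%N%:R.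
Proof.
rewrite /two_coef /mon_coef mcoeff1 /=; congr (_%:R); congr nat_of_bool.
apply/eqP/andP => [/mnmP E|[/eqP -> /eqP ->]].
  by have := E ord0; have := E ord_max; rewrite !mnmE /= => -> ->.
by apply/mnmP => -[[|[|]]] // i; rewrite mnmE mnm0E.
Qed.

(** In two variables the product is (x + y)^i (x y)^j. *)
Lemma two_coef_elem12 a b i j :
  two_coef a b (elem 1 ^+ i * elem 2 ^+ j) =
  if [&& j <= a, j <= b & a + b == i + 2 * j]%N then 'C(i, a - j)%:Z else 0.
Proof.
elim: j a b => [|j IH] a b; last first.
  rewrite exprSr mulrA two_coef_elem2; case: a => // a; case: b => [|b].
    by rewrite andbF.
  have -> : (a.+1 + b.+1 == i + 2 * j.+1)%N = (a + b == i + 2 * j)%N by apply/eqP/eqP; lia.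
  by rewrite IH !ltnS subSS.
rewrite expr0 mulr1 muln0 addn0 subn0 /=.
elim: i a b => [|i IH] a b.
  by rewrite two_coef1 addn_eq0; case: a => [|a]; case: b.
rewrite exprSr two_coef_elem1; case: a => [|a]; case: b => [|b].
- by rewrite addr0.
- by rewrite IH !add0n eqSS bin0 add0r bin0.
- by rewrite IH !addn0 eqSS addr0; case: eqP => // ->; rewrite !binn.
rewrite !IH !addSn !addnS eqSS; case: eqP => _; last by rewrite addr0.
by rewrite binS addnC PoszD.
Qed.

(** With i = 2m the pairing is the difference of the binomial coefficients of 2m over m and over m +
    1. *)
Lemma hall_elem12 N i j :
  hall (elem 1 ^+ i * elem 2 ^+ j) (schur (trow N N)) =
  if ~~ odd i && (i./2 + j == N)%N then (catalan i./2)%:Z else 0.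
Proof.
have cond : (~~ odd i && (i./2 + j == N)%N) = (N + N == i + 2 * j)%N.
  by rewrite -[in RHS](odd_double_half i); case: (odd i) => /=; apply/idP/eqP; lia.
case: N cond => [|N] cond.
  rewrite hall_trow0 two_coef_elem12 cond; case: eqP => [e|_]; last by rewrite !andbF.
  by have [-> ->] : i = 0%N /\ j = 0%N by lia.
rewrite hall_trow // !two_coef_elem12 cond (_ : N.+2 + N = N.+1 + N.+1)%N; last by lia.
case: eqP => [e|_]; last by rewrite !andbF subr0.
have [m im] : exists m, i = m.*2 by exists i./2; lia.
have le : (j <= N.+1)%N by lia.
rewrite le leqW //= im doubleK (_ : N.+1 - j = m)%N; last by lia.
case: (leqP j N) => h /=; last by have -> : m = 0%N by lia.
rewrite ?andbT (_ : N.+2 - j = m.+1)%N; last by lia.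
by rewrite catalan_bin PoszD addrC addKr.
Qed.

Notation pair_sq N u := (hall2 u (tens (schur (trow N N)) (schur (trow N N)))).

Lemma pair_sq_elem3l N u : pair_sq N (tens (elem 3) 1 * u) = 0.
Proof.
move: u; apply: (eq_on_tens (psi := fun=> 0)) => [u v|u v|x y]; rewrite ?addr0 //.
  by rewrite mulrDr hall2Dl.
by rewrite tensM hall2_tens mulrC [elem 3 * x]mulrC hall_elem_trow // big_nil mulr0.
Qed.

Lemma pair_sq_elem3r N u : pair_sq N (tens 1 (elem 3) * u) = 0.
Proof.
move: u; apply: (eq_on_tens (psi := fun=> 0)) => [u v|u v|x y]; rewrite ?addr0 //.
  by rewrite mulrDr hall2Dl.
by rewrite tensM hall2_tens [elem 3 * y]mulrC hall_elem_trow // big_nil mulr0.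
Qed.

(* [mmap], used for the multinomial expansion, requires a nonzero target ring. *)
Fact symfun2_1neq0 : (1 : symfun2) != 0.
Proof.
apply/eqP => /(congr1 (fun u => pair_sq 0 u)).
rewrite (addf0 (phi := fun u => pair_sq 0 u)) => [|u v]; last exact: hall2Dl.
have -> : trow 0 0 = part_of [::] by apply: val_inj.
by rewrite -[1]/(tens 1 1) hall2_tens -schur_nil hall_schur eqxx.
Qed.

HB.instance Definition _ := GRing.PzSemiRing_isNonZero.Build symfun2 symfun2_1neq0.

Lemma big_ord7 (R : Type) (idx : R) (op : Monoid.law idx) (F : nat -> R) :
  \big[op/idx]_(i < 7) F i = op (F 0%N) (op (F 1%N) (op (F 2%N) (op (F 3%N) (op (F 4%N) (op (F 5%N) (F 6%N)))))).
Proof. by rewrite -(big_mkord xpredT F) unlock /= Monoid.mulm1. Qed.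

(** * The terms of the multinomial expansion *)

Section Terms.
Local Notation a := (tens (elem 1) 1 : symfun2).
Local Notation b := (tens (elem 2) 1 : symfun2).
Local Notation A := (tens 1 (elem 1) : symfun2).
Local Notation B := (tens 1 (elem 2) : symfun2).

Definition mono (k : nat) : symfun2 :=
  nth 0 [:: b ^+ 2; B ^+ 2; b * B; a * b * A; a ^+ 2 * B; b * A ^+ 2; a * A * B] k.

Definition mono_coef (k : nat) : int := if k == 2%N then - 2%:R else 1.

Lemma kernel2_sum : kernel2 = \sum_(i < 7) mono i *~ mono_coef i.
Proof.
rewrite (big_ord7 _ (fun i => mono i *~ mono_coef i)) /mono /mono_coef /= !mulr1z.
by rewrite /kernel2 mulrNz; ring.
Qed.

Variable c : nat -> nat.

Lemma mono_prod :
  \prod_(i < 7) mono i ^+ c i =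
  tens (elem 1 ^+ (c 3 + 2 * c 4 + c 6) * elem 2 ^+ (2 * c 0 + c 2 + c 3 + c 5))
       (elem 1 ^+ (c 3 + 2 * c 5 + c 6) * elem 2 ^+ (2 * c 1 + c 2 + c 4 + c 6)).
Proof.
rewrite (big_ord7 _ (fun i => mono i ^+ c i)) /mono /=.
rewrite (tens_split (_ * _)) !tensE !exprMn !exprD !expr0.
ring.
Qed.

Lemma mono_coef_prod : \prod_(i < 7) mono_coef i ^+ c i = (- 2%:R) ^+ c 2%N.
Proof.
rewrite (big_ord7 _ (fun i => mono_coef i ^+ c i)) /mono_coef /= !expr1n.
by rewrite !mul1r !mulr1.
Qed.

Section Deg.
Variables (f : nat) (M : nat).
Hypothesis f0 : (0 < f)%N.
Local Notation N := (2 ^ f - 2)%N.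
Hypothesis sumc : (\sum_(i < 7) c i)%N = N.
Hypothesis MN : (M * \prod_(i < 7) (c i)`!)%N = N`!.

Definition term7 : int := M%:Z * (- 2%:R) ^+ c 2%N * pair_sq N (\prod_(i < 7) mono i ^+ c i).

Lemma term7P : term7 = 0 \/
  exists m m', [/\ (c 3 + 2 * c 4 + c 6 = m.*2)%N, (c 3 + 2 * c 5 + c 6 = m'.*2)%N,
     (m + (2 * c 0 + c 2 + c 3 + c 5) = N)%N & `|term7|%N = term_abs (c 2) M m m'].
Proof.
rewrite /term7 mono_prod hall2_tens !hall_elem12.
case: ifP => [/andP[o1 /eqP e1]|_]; last by left; rewrite mul0r mulr0.
case: ifP => [/andP[o2 /eqP e2]|_]; last by left; rewrite !mulr0.
right; eexists; eexists; split; last by rewrite /term_abs !abszM abszX abszN !absz_nat mulnA.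
- by rewrite -[LHS]odd_double_half (negPf o1).
- by rewrite -[LHS]odd_double_half (negPf o2).
- by rewrite -[RHS]e1.
Qed.

Lemma sumc7 : (c 0 + c 1 + c 2 + c 3 + c 4 + c 5 + c 6 = N)%N.
Proof. by rewrite -sumc (big_ord7 _ c) /= !addnA. Qed.

Lemma fact7 : (M * ((c 0)`! * ((c 1)`! * ((c 2)`! * ((c 3)`! * ((c 4)`! * ((c 5)`! * (c 6)`!)))))) = N`!)%N.
Proof. by rewrite -MN (big_ord7 _ (fun i => (c i)`!)). Qed.

Lemma dvdz_term7 : (2%:Z ^+ (f - 1) %| term7)%Z.
Proof.
have [->|[m [m' [e1 e2 e3 e4]]]] := term7P; first exact: dvdz0.
rewrite dvdzE e4 abszX absz_nat pfactor_dvdn ?(term_dvd f0 sumc7 fact7 e1 e2 e3) //.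
rewrite /term_abs !muln_gt0 (mult_gt0 fact7) expn_gt0 !catalan_gt0 //.
Qed.

End Deg.
End Terms.

(** * Valuation of g *)

Lemma multinomial_dvd n (c : 'I_n -> nat) :
  (\prod_i (c i)`! %| (\sum_i c i)`!)%N.
Proof.
pose m : 'X_{1..n} := [multinom c i | i < n].
have -> : (\prod_i (c i)`! = \prod_i (m i)`!)%N by apply: eq_bigr => i _; rewrite mnmE.
have mE : mdeg m = (\sum_i c i)%N by rewrite mdegE; apply: eq_bigr => i _; rewrite mnmE.
have /(congr1 absz) := sumX_coef mE.
by rewrite abszM !absz_nat => <-; rewrite dvdn_mull.
Qed.

Lemma sumX_coefE n N (m : 'X_{1..n}) : mdeg m = N ->
  (sumX n ^+ N)@_m = (N`! %/ \prod_i (m i)`!)%N%:Z.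
Proof.
move=> /(@sumX_coef n); set k := _@_m; set p := (\prod_i _)%N => E.
have p0 : (0 < p)%N by apply: prodn_gt0 => i; apply: fact_gt0.
have k0 : 0 <= k by rewrite -(Num.Theory.pmulr_lge0 (x := p%:Z) k) ?ltz_nat // E.
have := congr1 absz E; rewrite abszM !absz_nat => <-.
by rewrite mulnK // gez0_abs.
Qed.

Lemma exprMz (R : comPzRingType) (x : R) k n : (x *~ k) ^+ n = x ^+ n *~ (k ^+ n).
Proof. by rewrite -mulrzl exprMn -rmorphXn mulrzl. Qed.

Lemma prodMz (R : comPzRingType) n (x : 'I_n -> R) (k : 'I_n -> int) :
  \prod_i (x i *~ k i) = (\prod_i x i) *~ (\prod_i k i).
Proof.
rewrite -mulrzl rmorph_prod -big_split /=; apply: eq_bigr => i _.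
by rewrite mulrzl.
Qed.

Lemma Posz_expn (p k : nat) : (p ^ k)%N%:Z = p%:Z ^+ k.
Proof. by elim: k => // k IH; rewrite expnS PoszM IH exprS. Qed.

(** * The two involutions on the exponents *)

Section Reindex.

Definition reidx (l : seq nat) (i : 'I_7) : 'I_7 := inord (nth 0%N l i).
(* Exchanges the two tensor factors of [mono]. *)
Definition swap_list := [:: 1; 0; 2; 6; 5; 4; 3]%N.
(* Preserves the terms only at the fixed points of the swap. *)
Definition turn_list := [:: 0; 1; 2; 4; 3; 6; 5]%N.

Lemma swapK : involutive (reidx swap_list).
Proof.
move=> i; apply: val_inj; rewrite /reidx.
by case: i => [[|[|[|[|[|[|[|//]]]]]]] hi]; rewrite /= !inordK //= !inordK.
Qed.

Lemma turnK : involutive (reidx turn_list).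
Proof.
move=> i; apply: val_inj; rewrite /reidx.
by case: i => [[|[|[|[|[|[|[|//]]]]]]] hi]; rewrite /= !inordK //= !inordK.
Qed.

Definition swap_perm := perm (inv_inj swapK).
Definition turn_perm := perm (inv_inj turnK).

Lemma swap_perm2 : (swap_perm * swap_perm = 1)%g.
Proof. by apply/permP => i; rewrite permM !permE swapK. Qed.

Lemma turn_perm2 : (turn_perm * turn_perm = 1)%g.
Proof. by apply/permP => i; rewrite permM !permE turnK. Qed.

(** Because the two commute, the turn acts on the fixed points of the swap. *)
Lemma swap_turn : (swap_perm * turn_perm = turn_perm * swap_perm)%g.
Proof.
apply/permP => i; rewrite !permM !permE; apply: val_inj; rewrite /reidx.
by case: i => [[|[|[|[|[|[|[|//]]]]]]] hi]; rewrite /= !inordK //= !inordK.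
Qed.

Lemma nth_bmperm k l (lK : involutive (reidx l)) (m : 'X_{1..7 < k}) i :
  (i < 7)%N -> all (gtn 7) l -> nth 0%N (bmperm (perm (inv_inj lK)) m) i = nth 0%N m (nth 0%N l i).
Proof.
move=> hi hl; have := bmpermE (perm (inv_inj lK)) m (Ordinal hi).
rewrite (mnm_nth 0%N) /= => ->; rewrite permE (mnm_nth 0%N) inordK //.
have [h|h] := ltnP i (size l); last by rewrite nth_default.
exact: (allP hl _ (mem_nth 0%N h)).
Qed.

End Reindex.

Section Terms7.
Variable f : nat.
Hypothesis f0 : (0 < f)%N.
Local Notation N := (2 ^ f - 2)%N.

(** The difference of the powers is a multiple of [kernel2 - kernel22], which lies in the ideal
    generated by e_3 and e_3'. *)
Lemma pair_kernel : pair_sq N (kernel22 ^+ N) = pair_sq N (kernel2 ^+ N).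
Proof.
apply/eqP; rewrite eq_sym -subr_eq0 -(addfB (phi := fun u => pair_sq N u)) => [|u v]; last exact: hall2Dl.
rewrite subrXX; set S := \sum_(i < _) _.
rewrite (_ : (kernel2 - kernel22) * S = tens (elem 3) 1 * ((tens 1 (elem 1) + tens (elem 1) 1) * S) +
  tens 1 (elem 3) * ((tens (elem 1) 1 + tens 1 (elem 1)) * S)).
  by rewrite hall2Dl pair_sq_elem3l pair_sq_elem3r.
by rewrite kernel22E /kernel_rest; ring.
Qed.

Definition mult7 (c : nat -> nat) : nat :=
  (N`! %/ ((c 0)`! * ((c 1)`! * ((c 2)`! * ((c 3)`! * ((c 4)`! * ((c 5)`! * (c 6)`!)))))))%N.

Local Notation h i j := (hall (elem 1 ^+ i%N * elem 2 ^+ j%N) (schur (trow N N))).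

(** The summation index also takes degrees below N; there the value 0 agrees with the vanishing
    coefficient of [sumX ^+ N]. *)
Definition kernel_term (c : nat -> nat) : int :=
  if (c 0 + c 1 + c 2 + c 3 + c 4 + c 5 + c 6 == N)%N then
    (mult7 c)%:Z * (- 2%:R) ^+ c 2%N *
    (h (c 3 + 2 * c 4 + c 6) (2 * c 0 + c 2 + c 3 + c 5) *
     h (c 3 + 2 * c 5 + c 6) (2 * c 1 + c 2 + c 4 + c 6))
  else 0.

Lemma kernel_term_term (c : nat -> nat) : (\sum_(i < 7) c i)%N = N -> kernel_term c = term7 c f (mult7 c).
Proof.
move=> e; have E := sumc7 e.
by rewrite /kernel_term E eqxx /term7 mono_prod hall2_tens.
Qed.

Lemma pair_kernel2_sum :
  pair_sq N (kernel2 ^+ N) = \sum_(m : 'X_{1..7 < N.+1}) kernel_term (nth 0%N m).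
Proof.
rewrite kernel2_sum multinomial_expansion.
rewrite (addf_sum (phi := fun u => pair_sq N u)) => [|u v]; last exact: hall2Dl.
apply: eq_bigr => m _; rewrite (addfMz (phi := fun u => pair_sq N u)) => [|u v]; last exact: hall2Dl.
have [e|ne] := eqVneq (mdeg m) N; last first.
  rewrite sumX_coef0 // mulr0z /kernel_term ifN //; apply: contraNN ne => /eqP e; apply/eqP.
  rewrite -[RHS]e mdegE (eq_bigr (fun i : 'I_7 => nth 0 m i)%N) => [|i _]; last exact: mnm_nth.
  by rewrite (big_ord7 _ (nth 0%N m)) /= !addnA.
rewrite sumX_coefE // kernel_term_term; last first.
  by rewrite -[RHS]e mdegE; apply: eq_bigr => i _; rewrite (mnm_nth 0%N).
rewrite /term7 /mult7 -(big_ord7 _ (fun i => (nth 0 m i)`!)%N) /=.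
rewrite -mono_coef_prod (eq_bigr (fun i : 'I_7 => (nth 0 m i)`!)%N) => [|i _]; last by rewrite (mnm_nth 0%N).
rewrite (eq_bigr (fun i : 'I_7 => (mono i ^+ nth 0 m i) *~ (mono_coef i ^+ nth 0 m i))%N) => [|i _]; last first.
  by rewrite exprMz (mnm_nth 0%N).
rewrite prodMz (addfMz (phi := fun u => pair_sq N u)) => [|u v]; last exact: hall2Dl.
set x := pair_sq N _; set y := \prod_(i < 7) mono_coef i ^+ _; set k := (_ %/ _)%N.
by rewrite !mulrzz -mulrA mulrC; congr (_ * _); rewrite mulrC.
Qed.

Lemma kernel_term_dvd (m : 'X_{1..7 < N.+1}) : ((2 ^ (f - 1))%N%:Z %| kernel_term (nth 0%N m))%Z.
Proof.
have [e|ne] := eqVneq (nth 0 m 0 + nth 0 m 1 + nth 0 m 2 + nth 0 m 3 + nth 0 m 4 + nth 0 m 5 + nth 0 m 6)%N N;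
  last by rewrite /kernel_term (negPf ne) dvdz0.
have E : (\sum_(i < 7) nth 0 m i)%N = N by rewrite (big_ord7 _ (nth 0%N m)) /= !addnA.
rewrite kernel_term_term //; have := @dvdz_term7 (nth 0%N m) f (mult7 (nth 0%N m)) f0 E.
rewrite -Posz_expn; apply.
rewrite /mult7 -(big_ord7 _ (fun i => (nth 0 m i)`!)%N) /= divnK //.
by rewrite -[in X in (_ %| X)%N]E multinomial_dvd.
Qed.

Lemma kernel_term_swap (m : 'X_{1..7 < N.+1}) : kernel_term (nth 0%N (bmperm swap_perm m)) = kernel_term (nth 0%N m).
Proof.
rewrite /kernel_term /mult7 !nth_bmperm //=.
move: (nth 0%N m) => c.
have -> : (c 1 + c 0 + c 2 + c 6 + c 5 + c 4 + c 3 = c 0 + c 1 + c 2 + c 3 + c 4 + c 5 + c 6)%N by lia.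
have -> : ((c 1)`! * ((c 0)`! * ((c 2)`! * ((c 6)`! * ((c 5)`! * ((c 4)`! * (c 3)`!))))) =
  (c 0)`! * ((c 1)`! * ((c 2)`! * ((c 3)`! * ((c 4)`! * ((c 5)`! * (c 6)`!))))))%N by ring.
case: ifP => // _; congr (_ * _); rewrite mulrC; congr (h _ _ * h _ _); lia.
Qed.

Definition fixc (c : nat -> nat) := [/\ c 0 = c 1, c 3 = c 6 & c 4 = c 5]%N.

Lemma swap_fixed (m : 'X_{1..7 < N.+1}) : bmperm swap_perm m = m -> fixc (nth 0%N m).
Proof.
move=> e; have H i (hi : (i < 7)%N) := @nth_bmperm _ swap_list swapK m i hi isT.
by split; [have := H 0%N isT | have := H 3%N isT | have := H 4%N isT]; rewrite -/swap_perm e.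
Qed.

Lemma turn_fixed (m : 'X_{1..7 < N.+1}) : bmperm turn_perm m = m -> nth 0%N m 3 = nth 0%N m 4.
Proof.
move=> e; have H i (hi : (i < 7)%N) := @nth_bmperm _ turn_list turnK m i hi isT.
by have := H 3%N isT; rewrite -/turn_perm e.
Qed.

(** At a fixed point of the swap, the turn exchanges the values c3 = c6 and c4 = c5. The exponents 2
    (c3 + c4) of e_1 and 2 c0 + c2 + c3 + c4 of e_2 are symmetric in them. *)
Lemma kernel_term_turn (m : 'X_{1..7 < N.+1}) : bmperm swap_perm m = m ->
  kernel_term (nth 0%N (bmperm turn_perm m)) = kernel_term (nth 0%N m).
Proof.
move/swap_fixed; rewrite /kernel_term /mult7 !nth_bmperm //=.
move: (nth 0%N m) => c [e01 e36 e45]; rewrite -e01 -e36 -e45.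
have -> : (c 0 + c 0 + c 2 + c 4 + c 3 + c 3 + c 4 = c 0 + c 0 + c 2 + c 3 + c 4 + c 4 + c 3)%N by lia.
have -> : ((c 0)`! * ((c 0)`! * ((c 2)`! * ((c 4)`! * ((c 3)`! * ((c 3)`! * (c 4)`!))))) =
  (c 0)`! * ((c 0)`! * ((c 2)`! * ((c 3)`! * ((c 4)`! * ((c 4)`! * (c 3)`!))))))%N by ring.
case: ifP => // _; congr (_ * _); congr (h _ _ * h _ _); lia.
Qed.

End Terms7.

Lemma logn_congr p n (x y : int) : prime p -> x != 0 ->
  logn p `|x| = n -> (p%:Z ^+ n.+1 %| y - x)%Z -> logn p `|y| = n.
Proof.
move=> pp x0 lx d.
have dE k (z : int) : z != 0 -> (p%:Z ^+ k %| z)%Z = (k <= logn p `|z|)%N.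
  by move=> z0; rewrite dvdzE abszX absz_nat pfactor_dvdn // absz_gt0.
have nx : ~~ (p%:Z ^+ n.+1 %| x)%Z by rewrite dE // lx ltnn.
have ny : ~~ (p%:Z ^+ n.+1 %| y)%Z.
  by apply: contra nx => h; rewrite -[x](subKr y) rpredB.
have y0 : y != 0 by apply: contraNneq ny => ->; apply: dvdz0.
have dy : (p%:Z ^+ n %| y)%Z.
  rewrite -[y](subrK x); apply: rpredD; last by rewrite -/(dvdz _ _) dE ?lx.
  by apply: dvdz_trans d; rewrite exprS dvdz_mull.
by move: dy ny; rewrite !dE // -ltnNge ltnS => h1 h2; apply/eqP; rewrite eqn_leq h1 h2.
Qed.

(** * The surviving term *)

Section TopTerm.
Variable f : nat.
Hypothesis f0 : (0 < f)%N.
Local Notation N := (2 ^ f - 2)%N.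
Local Notation r := (2 ^ f.-1 - 1)%N.

Let two_r : (r + r = N)%N.
Proof.
have : (2 ^ f = (2 ^ f.-1).*2)%N by rewrite -{1}(prednK f0) expnS mul2n.
by have := expn_gt0 2 f.-1; lia.
Qed.

(** Exponents r of b^2 and of B^2; the other five are the default 0 of [nth]. *)
Definition topc : 'X_{1..7} := [multinom nth 0%N [:: r; r] i | i < 7].

Lemma nth_topc k : nth 0%N topc k = nth 0%N [:: r; r] k.
Proof.
have [h|h] := ltnP k 7; last by rewrite !nth_default ?size_tuple // (leq_trans _ h).
by rewrite -[k]/(nat_of_ord (Ordinal h)) -mnm_nth mnmE.
Qed.

Lemma mdeg_topc : (mdeg topc < N.+1)%N.
Proof.
rewrite ltnS mdegE (eq_bigr (fun i : 'I_7 => nth 0 [:: r; r] i)%N) => [|i _]; last by rewrite mnmE.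
by rewrite (big_ord7 _ (nth 0%N [:: r; r])) /= !addn0 two_r.
Qed.

Definition topm : 'X_{1..7 < N.+1} := BMultinom mdeg_topc.

Lemma mult7_fact c : (c 0 + c 1 + c 2 + c 3 + c 4 + c 5 + c 6 = N)%N ->
  (mult7 f c * ((c 0)`! * ((c 1)`! * ((c 2)`! * ((c 3)`! * ((c 4)`! * ((c 5)`! * (c 6)`!)))))) = N`!)%N.
Proof.
move=> e; have E : (\sum_(i < 7) c i)%N = N by rewrite (big_ord7 _ c) /= !addnA.
rewrite divnK // -(big_ord7 _ (fun i => (c i)`!)) /=.
by rewrite -[in X in (_ %| X)%N]E multinomial_dvd.
Qed.

Lemma kernel_term_top : kernel_term f (nth 0%N topm) != 0 /\ logn 2 `|kernel_term f (nth 0%N topm)| = (f - 1)%N.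
Proof.
have sumc : (nth 0 topm 0 + nth 0 topm 1 + nth 0 topm 2 + nth 0 topm 3 + nth 0 topm 4 +
   nth 0 topm 5 + nth 0 topm 6)%N = N by rewrite !nth_topc /= !addn0.
have M := mult7_fact sumc.
have E : kernel_term f (nth 0%N topm) = (mult7 f (nth 0%N topm))%:Z.
  rewrite /kernel_term sumc eqxx !nth_topc /= expr0 mulr1 !hall_elem12 /= !addn0 add0n.
  by rewrite mul2n -addnn two_r eqxx /catalan bin0 !mulr1.
rewrite E absz_nat; split; first by rewrite -absz_eq0 absz_nat -lt0n (mult_gt0 M).
have := @term_top f _ _ _ _ _ _ _ f0 sumc _ 0 0 M.
rewrite !nth_topc /= /term_abs /catalan bin0 !muln1; apply=> //; lia.
Qed.

Lemma kernel_term_fixed (m : 'X_{1..7 < N.+1}) :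
  bmperm swap_perm m = m -> bmperm turn_perm m = m -> m != topm ->
  (2%:Z ^+ f %| kernel_term f (nth 0%N m))%Z.
Proof.
move=> /swap_fixed [e01 e36 e45] /turn_fixed e34 ne.
have [e|ne'] := eqVneq (nth 0 m 0 + nth 0 m 1 + nth 0 m 2 + nth 0 m 3 + nth 0 m 4 + nth 0 m 5 + nth 0 m 6)%N N;
  last by rewrite /kernel_term (negPf ne') dvdz0.
have M := mult7_fact e.
have E : (\sum_(i < 7) nth 0 m i)%N = N by rewrite (big_ord7 _ (nth 0%N m)) /= !addnA.
(* If c2 = c3 = 0, only c0 = c1 remain, and the degree forces [m] to be [topm]. *)
have pos : (0 < nth 0 m 2 + nth 0 m 3)%N.
  rewrite lt0n; apply: contraNneq ne => z; apply/eqP/val_inj/mnmP => i.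
  rewrite !(mnm_nth 0%N) nth_topc.
  by case: i => [[|[|[|[|[|[|[|//]]]]]]] hi] /=; lia.
rewrite kernel_term_term //.
have M' : (mult7 f (nth 0%N m) * \prod_(i < 7) (nth 0 m i)`!)%N = N`!.
  by rewrite (big_ord7 _ (fun i => (nth 0 m i)`!)%N).
have [->|[m1 [m2 [E1 E2 E3 E4]]]] := @term7P (nth 0%N m) f (mult7 f (nth 0%N m)).
  exact: dvdz0.
rewrite dvdzE E4 abszX absz_nat pfactor_dvdn //; last first.
  by rewrite /term_abs !muln_gt0 (mult_gt0 M) expn_gt0 !catalan_gt0.
exact: (term_fixed f0 e M E1 E2 E3 e01 e36 e45 e34 pos).
Qed.

Lemma pair_kernel2_logn : logn 2 `|pair_sq N (kernel2 ^+ N)| = (f - 1)%N.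
Proof.
have [F0 Ft] := kernel_term_top; rewrite pair_kernel2_sum.
pose F (m : 'X_{1..7 < N.+1}) := kernel_term f (nth 0%N m).
have dF m : (2%:Z ^+ (f - 1) %| F m)%Z by rewrite -Posz_expn; apply: kernel_term_dvd.
have two : 2%:Z * 2%:Z ^+ (f - 1) = 2%:Z ^+ f by rewrite -exprS subn1 prednK.
have D1 := sum_involution (bmperm_inv swap_perm2) (kernel_term_swap f0) dF.
(* Extension by 0 off the fixed points of the swap, so that the second involution acts on the whole
   index type. *)
pose F' m := if bmperm swap_perm m == m then F m else 0.
have dF' m : (2%:Z ^+ (f - 1) %| F' m)%Z by rewrite /F'; case: ifP => // _; apply: dvdz0.
have FT m : F' (bmperm turn_perm m) = F' m.
  rewrite /F' bmpermC ?swap_turn // (inj_eq (inv_inj (bmperm_inv turn_perm2))).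
  by case: eqP => // e; apply: kernel_term_turn.
have D2 := sum_involution (bmperm_inv turn_perm2) FT dF'.
have EF : \sum_m F' m = \sum_(m | bmperm swap_perm m == m) F m by rewrite [RHS]big_mkcond.
rewrite two in D1; rewrite two EF in D2.
have topfix l (lK : involutive (reidx l)) : all (gtn 7) l ->
    (forall i, (i < 7)%N -> nth 0%N [:: r; r] (nth 0%N l i) = nth 0%N [:: r; r] i) ->
    bmperm (perm (inv_inj lK)) topm = topm.
  move=> hl H; apply: val_inj; apply/mnmP => i.
  by rewrite (mnm_nth 0%N) nth_bmperm // [RHS](mnm_nth 0%N) !nth_topc H.
have top_swap : bmperm swap_perm topm = topm.
  by apply: topfix => // -[|[|[|[|[|[|[|i]]]]]]].
have top_turn : bmperm turn_perm topm = topm.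
  by apply: topfix => // -[|[|[|[|[|[|[|i]]]]]]].
have D3 : (2%:Z ^+ f %| \sum_(m | bmperm turn_perm m == m) F' m - F topm)%Z.
  rewrite (bigD1 topm) ?top_turn ?eqxx //= {1}/F' top_swap eqxx addrAC subrr add0r.
  apply: rpred_sum => m /andP[/eqP e ne]; rewrite /F'; case: eqP => [e'|_]; last exact: dvdz0.
  exact: kernel_term_fixed.
apply: logn_congr F0 Ft _; rewrite ?subn1 ?prednK //.
(* The three congruences modulo 2^f telescope: from the full sum to the fixed points of the swap, to
   the common fixed points, to the top term. *)
have := rpredD (rpredD D1 D2) D3.
by rewrite !addrA !subrK.
Qed.
End TopTerm.

Lemma logn_pairing_g f : (0 < f)%N -> logn 2 `|pairing_g 2 (2 ^ f)| = (f - 1)%N.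
Proof.
move=> f0; rewrite -(pair_kernel2_logn f0) -pair_kernel kernel22E -theta22E -rect_trow.
rewrite -pairing_g_theta /pairing_g; congr (logn 2 (absz (hall _ (_ ^+ _)))).
have : (2 ^ f = 2 * 2 ^ f.-1)%N by rewrite -{1}(prednK f0) expnS.
by move=> ->; rewrite mulKn //; lia.
Qed.

(** * Uniqueness of the elementary expansion *)

Section ElemCoef.
Variable n : nat.
Local Notation S := [tuple mesym n int i.+1 | i < n].

Definition part_mult (mu : intpart) : 'X_{1..n} := [multinom count_mem i.+1 (mu : seq nat) | i < n].

(** In n variables f is a unique polynomial in e_1, ..., e_n; for mu with parts at most n, this is
    its coefficient at the monomial e_mu. *)
Definition elem_coef (mu : intpart) (f : symfun) : int := (symf (trunc f n))@_(part_mult mu).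

Lemma symf_comp t : t \mPo S \is symmetric -> symf (t \mPo S) = t.
Proof. by move=> s; apply: (@msym_fundamental_un n int); rewrite -symfP. Qed.

Lemma elem_coefD mu f g : elem_coef mu (f + g) = elem_coef mu f + elem_coef mu g.
Proof.
have [fS _ _] := symfunP f; have [gS _ _] := symfunP g.
have E : trunc (f + g) n = (symf (trunc f n) + symf (trunc g n)) \mPo S.
  by rewrite raddfD /= -!symfP.
have [s _ _] := symfunP (f + g).
by rewrite /elem_coef -mcoeffD -[in RHS](symf_comp (t := _ + _)) -E.
Qed.

(** Either la has a part k > n, so that e_k vanishes in n variables while mu has no such part, or
    e_la is a single monomial in e_1, ..., e_n, whose exponents determine la. *)
Lemma elem_coef_prod (mu la : intpart) : all (geq n) mu -> elem_coef mu (elem_prod la) = (la == mu)%:R.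
Proof.
move=> hmu; rewrite /elem_coef; have [s _ _] := symfunP (elem_prod la).
have [hla|] := boolP (all (geq n) la); last first.
  rewrite -has_predC => /hasP[k kla /= hk].
  have -> : trunc (elem_prod la) n = 0 \mPo S.
    by rewrite trunc_prod (big_rem k) //= mesym_geqnE ?mul0r ?comp_mpoly0 // ltnNge.
  rewrite symf_comp ?comp_mpoly0 ?rpred0 // mcoeff0; case: eqP => // e.
  by rewrite -e in hmu; have := allP hmu _ kla; rewrite /= (negPf hk).
have E : trunc (elem_prod la) n = 'X_[part_mult la] \mPo S.
  rewrite trunc_prod comp_mpolyX.
  have pos k : k \in (la : seq nat) -> (0 < k)%N.
    by move=> kla; rewrite lt0n; apply: contraNneq (proj2 (andP (valP la))) => <-.
  have {pos} : {in (la : seq nat), forall k, 0 < k <= n}%N.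
    by move=> k kla; rewrite pos //; apply: (allP hla).
  rewrite (eq_bigr (fun i : 'I_n => mesym n int i.+1 ^+ count_mem i.+1 (la : seq nat))) => [|i _]; last first.
    by rewrite mnmE tnth_mktuple.
  elim: (la : seq nat) => [|k l IH] H; first by rewrite big_nil big1.
  rewrite big_cons IH => [|j hj]; last by apply: H; rewrite inE hj orbT.
  have /andP[k0 kn] := H k (mem_head _ _); case: k k0 kn {H IH} => // k _ kn.
  rewrite (bigD1 (Ordinal kn)) //= [RHS](bigD1 (Ordinal kn)) //= eqxx exprS mulrA; congr (_ * _).
  apply: eq_bigr => i ne; rewrite eqSS (_ : (k == i) = false) //.
  by apply/negP => /eqP e; case/eqP: ne; apply: val_inj.
rewrite E symf_comp -?E // mcoeffX; congr (_%:R); congr nat_of_bool.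
apply/eqP/eqP => [e|-> //].
have P : perm_eq la mu.
  apply/allP => k _ /=; apply/eqP.
  case: k => [|k].
    by rewrite !(count_memPn _) //; [case/andP: (valP mu) | case/andP: (valP la)].
  have [kn|kn] := ltnP k n.
    by have /mnmP/(_ (Ordinal kn)) := e; rewrite !mnmE.
  rewrite !(count_memPn _) //; apply/negP => /(allP _)h.
    by have := h _ hmu; rewrite /= ltnNge kn.
  by have := h _ hla; rewrite /= ltnNge kn.
have gtr : transitive geq by move=> x y z /= h1 h2; apply: leq_trans h2 h1.
apply: val_inj; apply: (sorted_eq gtr) P.
- by move=> x y /= /andP[h1 h2]; apply/eqP; rewrite eqn_leq h1 h2.
- by case/andP: (valP la).
by case/andP: (valP mu).
Qed.

End ElemCoef.

(** A product of two coefficient functionals is biadditive, so it extends to the tensor product and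
    reads off one coefficient of any expansion. *)
Lemma elem2_expansion_unique u a a' :
  elem2_expansion u a -> elem2_expansion u a' -> a = a'.
Proof.
have coefE b : elem2_expansion u b -> forall (p : intpart * intpart) n, all (geq n) (p.1 : seq nat) -> all (geq n) (p.2 : seq nat) ->
    b p = tens_lift (fun x y => elem_coef n p.1 x * elem_coef n p.2 y) u.
  move=> E p n h1 h2.
  have B : biadditive (fun x y => elem_coef n p.1 x * elem_coef n p.2 y).
    by split=> *; rewrite elem_coefD (mulrDl, mulrDr).
  have LD v w := tens_liftD v w B.
  rewrite [in RHS]E (addf_sum LD).
  transitivity (\sum_(q <- finsupp b) (q == p)%:R * b q).
    have [hp|hp] := boolP (p \in finsupp b).
      rewrite (big_rem p) //= eqxx mul1r big1_seq ?addr0 // => q /=.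
      by rewrite mem_rem_uniq ?fset_uniq // inE => /andP[/negPf -> _]; rewrite mul0r.
    rewrite fsfun_dflt // big1_seq // => q /= hq.
    by case: eqP hq hp => [-> ->|] //; rewrite mul0r.
  apply: eq_bigr => q _; rewrite (addfMz LD) tens_lift_tens // !elem_coef_prod // mulrzz.
  by congr (_ * _); rewrite -natrM mulnb.
move=> E E'; apply/fsfunP => p.
(* Any bound on the parts of both partitions serves; their sum is one. *)
pose n := (\sum_(k <- p.1 ++ p.2) k)%N.
have H k : k \in (p.1 ++ p.2 : seq nat) -> (k <= n)%N.
  by move=> hk; rewrite /n (big_rem k) //= leq_addr.
have h1 : all (geq n) (p.1 : seq nat) by apply/allP => k hk; apply: H; rewrite mem_cat hk.
have h2 : all (geq n) (p.2 : seq nat) by apply/allP => k hk; apply: H; rewrite mem_cat hk orbT.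
by rewrite (coefE _ E p n) // (coefE _ E' p n).
Qed.

(** * Divisibility of every term *)

(* In the order of [mono], followed by the four terms containing e_3. *)
Definition terms22 : seq ((intpart * intpart) * int) :=
  let p s t := (part_of s, part_of t) in
  [:: (p [:: 2; 2]%N [::], 1); (p [::] [:: 2; 2]%N, 1); (p [:: 2]%N [:: 2]%N, - 2%:R);
      (p [:: 2; 1]%N [:: 1]%N, 1); (p [:: 1; 1]%N [:: 2]%N, 1);
      (p [:: 2]%N [:: 1; 1]%N, 1); (p [:: 1]%N [:: 2; 1]%N, 1);
      (p [:: 3]%N [:: 1]%N, - 1); (p [:: 3; 1]%N [::], - 1);
      (p [:: 1]%N [:: 3]%N, - 1); (p [::] [:: 3; 1]%N, - 1)].

Definition key22 k : intpart * intpart := (nth ((part_of [::], part_of [::]), 0) terms22 k).1.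
Definition coef22 k : int := (nth ((part_of [::], part_of [::]), 0) terms22 k).2.
Definition keys22 := [seq x.1 | x <- terms22].

Definition a22 : {fsfun intpart * intpart -> int with 0} :=
  [fsfun p in [fset p | p in keys22]%fset => coef22 (index p keys22) | 0].

Lemma keys22_uniq : uniq keys22. Proof. by []. Qed.

Lemma nth_keys22 k : (k < 11)%N -> nth (part_of [::], part_of [::]) keys22 k = key22 k.
Proof. by move=> h; rewrite (nth_map ((part_of [::], part_of [::]), 0)). Qed.

Lemma a22E k : (k < 11)%N -> a22 (key22 k) = coef22 k.
Proof.
move=> h; have hk : key22 k \in keys22 by rewrite -nth_keys22 // mem_nth.
rewrite fsfunE in_fset hk -nth_keys22 // index_uniq //.
Qed.

Lemma finsupp_a22 : finsupp a22 =i keys22.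
Proof.
move=> p; rewrite mem_finsupp; apply/idP/idP => [|hp].
  by rewrite fsfunE in_fset; case: ifP => //; rewrite eqxx.
have h : (index p keys22 < 11)%N by rewrite -[11%N]/(size keys22) index_mem.
have -> : p = key22 (index p keys22) by rewrite -nth_keys22 // nth_index.
rewrite a22E //; move: (index p keys22) h.
by do 11! [case=> //].
Qed.

Lemma big_a22 (R : Type) (idx : R) (op : Monoid.com_law idx) (F : intpart * intpart -> R) :
  \big[op/idx]_(p <- finsupp a22) F p = \big[op/idx]_(k < 11) F (key22 k).
Proof.
rewrite (perm_big keys22) /=; last first.
  by apply: uniq_perm; rewrite ?fset_uniq ?keys22_uniq //; apply: finsupp_a22.
rewrite (big_nth (part_of [::], part_of [::])) big_mkord.
by apply: eq_bigr => i _; rewrite nth_keys22.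
Qed.

Lemma elem_prod_part_of s : elem_prod (part_of s) = \prod_(k <- s) elem k.
Proof.
rewrite /elem_prod /= (perm_big _ (permEl (perm_sort _ _))) big_filter big_mkcond /=.
by apply: eq_bigr => -[|k] _ //=; rewrite elem0.
Qed.

Lemma elem2_part_of s t :
  elem2 (part_of s, part_of t) = tens (\prod_(k <- s) elem k) 1 * tens 1 (\prod_(k <- t) elem k).
Proof. by rewrite /elem2 !elem_prod_part_of tens_split. Qed.

Lemma tens11 : tens 1 1 = 1 :> symfun2. Proof. by []. Qed.

Lemma elem2_mono k : (k < 7)%N -> elem2 (key22 k) = mono k.
Proof.
do 7! [case: k => [_|k]; first by rewrite /key22 /= elem2_part_of !big_cons ?big_nil ?big_seq1 !mulr1 /mono /= ?tensE ?tens11; ring].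
by [].
Qed.

Lemma expansion22 : elem2_expansion kernel22 a22.
Proof.
rewrite /elem2_expansion kernel22E.
rewrite (big_a22 _ (fun p => elem2 p *~ a22 p)).
rewrite (eq_bigr (fun k : 'I_11 => elem2 (key22 k) *~ coef22 k)) => [|k _]; last by rewrite a22E.
rewrite -(big_mkord xpredT (fun k => elem2 (key22 k) *~ coef22 k)) (@big_cat_nat _ _ _ 7) //=.
congr (_ + _).
  rewrite kernel2_sum big_mkord; apply: eq_bigr => k _; rewrite elem2_mono //.
  by congr (_ *~ _); case: k => [[|[|[|[|[|[|[|//]]]]]]] hk].
rewrite unlock /= /key22 /coef22 /= !elem2_part_of !big_cons !big_nil !mulr1 !tensE ?tens11 !mulrNz !mulr1z.
rewrite /kernel_rest; ring.
Qed.

Lemma pair_elem3_term N k u : (6 < k < 11)%N -> pair_sq N (elem2 (key22 k) * u) = 0.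
Proof.
do 7! [case: k => [//|k]]; case: k => [_|[_|[_|[_|//]]]];
  rewrite /key22 /= elem2_part_of !big_cons !big_nil !mulr1 ?tensE ?tens11.
- by rewrite -mulrA pair_sq_elem3l.
- by rewrite -!mulrA pair_sq_elem3l.
- by rewrite mulrAC mulrC pair_sq_elem3r.
- by rewrite mul1r -mulrA pair_sq_elem3r.
Qed.

Section PartTwo.
Variable f : nat.
Hypothesis f0 : (0 < f)%N.
Local Notation N := (2 ^ f - 2)%N.

(** A positive exponent on a term with e_3 or e_3' makes the pairing vanish; otherwise only the
    seven terms of [mono] occur and [dvdz_term7] applies. *)
Lemma term22_dvd (d : nat -> nat) : (\sum_(k < 11) d k)%N = N ->
  (2%:Z ^+ (f - 1) %|
     ((\sum_(k < 11) d k)`! %/ \prod_(k < 11) (d k)`!)%N%:Z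
     * (\prod_(k < 11) coef22 k ^+ d k)
     * pair_sq N (\prod_(k < 11) elem2 (key22 k) ^+ d k))%Z.
Proof.
move=> dN; rewrite dN.
have [/existsP[k /andP[k6 dk]]|] := boolP [exists k : 'I_11, (6 < k)%N && (0 < d k)%N].
  have [u ->] : exists u, \prod_(k < 11) elem2 (key22 k) ^+ d k = elem2 (key22 k) * u.
    by rewrite (bigD1 k) //= -(prednK dk) exprS -mulrA; eexists.
  by rewrite pair_elem3_term ?k6 ?ltn_ord // mulr0 dvdz0.
rewrite negb_exists => /forallP H.
have d0 k : (7 <= k < 11)%N -> d k = 0%N.
  move=> /andP[k6 hk]; have := H (Ordinal hk); rewrite /= k6 /= -eqn0Ngt.
  by move/eqP.
have split7 (R : Type) (idx : R) (op : Monoid.com_law idx) (F : nat -> R) :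
    (forall k, (7 <= k < 11)%N -> F k = idx) ->
    \big[op/idx]_(k < 11) F k = \big[op/idx]_(k < 7) F k.
  move=> F0; rewrite -(big_mkord xpredT F) (@big_cat_nat _ _ _ 7) //= big_mkord.
  rewrite [X in op _ X]big_nat [X in op _ X]big1 ?Monoid.mulm1 // => k hk; exact: F0.
have sum7 : (\sum_(k < 7) d k)%N = N by rewrite -dN (split7 _ _ _ d).
rewrite (split7 _ _ _ (fun k => (d k)`!)) => [|k /d0 -> //].
rewrite (split7 _ _ _ (fun k => coef22 k ^+ d k)) => [|k /d0 -> //].
rewrite (split7 _ _ _ (fun k => elem2 (key22 k) ^+ d k)) => [|k /d0 -> //].
rewrite (eq_bigr (fun k : 'I_7 => mono k ^+ d k)) => [|k _]; last by rewrite elem2_mono.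
have -> : \prod_(k < 7) coef22 k ^+ d k = (- 2%:R) ^+ d 2%N.
  rewrite -mono_coef_prod; apply: eq_bigr => k _; congr (_ ^+ _).
  by case: k => [[|[|[|[|[|[|[|//]]]]]]] hk].
apply: (@dvdz_term7 d f) => //.
by rewrite divnK // -[in X in (_ %| X)%N]sum7 multinomial_dvd.
Qed.

(** Passes from the support of [a22], which indexes the exponents in the theorem, to the explicit
    list of eleven keys; [insub] finds the exponent of a key. *)
Lemma big_finsupp22 (R : Type) (idx : R) (op : Monoid.com_law idx)
    (c : {ffun finsupp a22 -> nat}) (G : intpart * intpart -> nat -> R) :
  \big[op/idx]_p G (val p) (c p) =
  \big[op/idx]_(k < 11) G (key22 k) (oapp c 0%N (insub (key22 k))).
Proof.
rewrite -(big_a22 _ (fun p => G p (oapp c 0%N (insub p)))) big_seq_fsetE /=.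
by apply: eq_bigr => p _; rewrite valK.
Qed.

End PartTwo.

Theorem theorem11 (f : nat) (hf : (1 < f)%N) :
  logn 2 `|pairing_g 2 (2 ^ f)|%N = (f - 1)%N /\
  exists a : {fsfun intpart * intpart -> int with 0},
    [/\ elem2_expansion kernel22 a,
        forall a', elem2_expansion kernel22 a' -> a' = a
      & forall c : {ffun finsupp a -> nat},
          (\sum_p c p)%N = (2 * (2 ^ (f - 1) - 1))%N ->
          ((2 ^ (f - 1))%N%:Z %|
             ((\sum_p c p)`! %/ \prod_p (c p)`!)%N%:Z
             * (\prod_p a (val p) ^+ c p)
             * hall2 (\prod_p elem2 (val p) ^+ c p)
                 (tens (schur (rect (2 ^ f - 2) 2))
                       (schur (rect (2 ^ f - 2) 2))))%Z].
Proof.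
have f0 : (0 < f)%N := ltnW hf.
split; first exact: logn_pairing_g.
exists a22; split=> [|a' E|c]; first exact: expansion22.
  exact: elem2_expansion_unique E expansion22.
have -> : (2 * (2 ^ (f - 1) - 1))%N = (2 ^ f - 2)%N.
  by rewrite mulnBr -expnS subn1 prednK.
rewrite (big_finsupp22 _ c (fun _ n => n)) (big_finsupp22 _ c (fun _ n => n`!)).
rewrite (big_finsupp22 _ c (fun p n => a22 p ^+ n)) (big_finsupp22 _ c (fun p n => elem2 p ^+ n)).
rewrite (eq_bigr (fun k : 'I_11 => coef22 k ^+ oapp c 0%N (insub (key22 k)))) => [|k _]; last by rewrite a22E.
move=> dN; rewrite Posz_expn rect_trow.
exact: (term22_dvd f0 (d := fun k => oapp c 0%N (insub (key22 k)))).
Qed.
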